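(* Let $\Omega\Subset\mathbb{C}$ be open, bounded, strictly convex with smooth boundary, $\sigma\in\{\pm1\}$, and define for $k\in\mathbb{C}$, $|k|\ge1$, $Au(z)=\frac{1}{2\pi}\int_\Omega\frac{e^{-kw+\overline{kw}}}{z-w}u(w)L(dw)$, $Bu(z)=\frac{\sigma}{2\pi}\int_\Omega\frac{e^{kw-\overline{kw}}}{\overline z-\overline w}u(w)L(dw)$. Then there is a constant $C$ (depending on $q$, $\epsilon$, $\Omega$ but not on $k$) such that the operator $AB$ has norm at most $C/|k|$ as an operator $L^q(\mathbb{C})\to L^q(\mathbb{C})$ when $2<q<\infty$, and as an operator $L^q(\mathbb{C})\to\langle\cdot\rangle^\epsilon L^q(\mathbb{C})$ when $1<q\le2$ and $\epsilon>\frac2q-1$.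
   Context: $L(dw)$ is Lebesgue measure on $\mathbb{C}$; $\langle z\rangle=(1+|z|^2)^{1/2}$ and $\langle\cdot\rangle^\epsilon L^q=\{\langle\cdot\rangle^\epsilon v:v\in L^q\}$ with norm $\|\langle\cdot\rangle^{-\epsilon}u\|_{L^q}$. *)

(* Defs.v *)
From HB Require Import structures.
From mathcomp Require Import all_boot all_order all_algebra.
From mathcomp Require Import all_classical all_reals all_analysis.
From mathcomp Require Import complex.
Set Implicit Arguments. Unset Strict Implicit. Unset Printing Implicit Defensive.
Import Order.TTheory GRing.Theory Num.Theory.
Import numFieldNormedType.Exports.
Local Open Scope classical_set_scope.
Local Open Scope ring_scope.

Section Defs.
Variable R : realType.

(** The complex plane C is modelled as R * R (measure-theoretic/topological
    carrier), identified with R[i] via [toC]. *)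
Definition toC (w : R * R) : R[i] := (w.1 +i* w.2)%C.

Definition cabs (z : R[i]) : R := Num.sqrt (complex.Re z ^+ 2 + complex.Im z ^+ 2).

Definition cexp (z : R[i]) : R[i] :=
  ((expR (complex.Re z) * cos (complex.Im z)) +i* (expR (complex.Re z) * sin (complex.Im z)))%C.

Definition leb2 := ((@lebesgue_measure R) \x (@lebesgue_measure R))%E.

Definition cintegral (D : set (R * R)) (f : R * R -> R[i]) : R[i] :=
  (Rintegral leb2 D (fun w => complex.Re (f w)) +i* Rintegral leb2 D (fun w => complex.Im (f w)))%C.

Definition cLnorm (q : R) (f : R * R -> R[i]) : \bar R :=
  Lnorm leb2 q%:E (fun z => (cabs (f z))%:E).

Definition in_Lq (q : R) (f : R * R -> R[i]) : Prop :=
  measurable_fun setT (fun z => complex.Re (f z)) /\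
  measurable_fun setT (fun z => complex.Im (f z)) /\
  (cLnorm q f < +oo)%E.

Definition jbr (z : R * R) : R := Num.sqrt (1 + cabs (toC z) ^+ 2).

Definition opA (k : R[i]) (Om : set (R * R)) (u : R * R -> R[i]) (z : R * R) : R[i] :=
  ((2 * pi)^-1)%:C%C * cintegral Om (fun w =>
     cexp (- (k * toC w) + conjc (k * toC w)) * (toC z - toC w)^-1 * u w).

Definition opB (k : R[i]) (Om : set (R * R)) (sigma : R) (u : R * R -> R[i]) (z : R * R) : R[i] :=
  (sigma / (2 * pi))%:C%C * cintegral Om (fun w =>
     cexp (k * toC w - conjc (k * toC w)) * (conjc (toC z) - conjc (toC w))^-1 * u w).

Fixpoint iterD (vs : seq (R * R)) (f : R * R -> R) : R * R -> R :=
  match vs with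
  | [::] => f
  | v :: vs' => fun x => derive (iterD vs' f) x v
  end.

Definition smooth (f : R * R -> R) : Prop :=
  forall vs : seq (R * R),
    continuous (iterD vs f) /\ forall (v x : R * R), derivable (iterD vs f) x v.

(** Omega has smooth boundary: a smooth global defining function rho,
    Omega = {rho < 0}, with nonvanishing gradient on the boundary. *)
Definition smooth_boundary (Om : set (R * R)) : Prop :=
  exists rho : R * R -> R,
    smooth rho /\ Om = [set x | rho x < 0] /\
    forall x, x \in closure Om -> x \notin Om ->
      exists v : R * R, derive rho x v != 0.

Definition strictly_convex (Om : set (R * R)) : Prop :=
  forall x y : R * R, closure Om x -> closure Om y -> x != y ->
    forall t : R, 0 < t < 1 -> Om ((1 - t) *: x + t *: y).

Definition opAB (k : R[i]) (Om : set (R * R)) (sigma : R) (u : R * R -> R[i]) : R * R -> R[i] :=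
  opA k Om (opB k Om sigma u).

End Defs.

(* Main.v *)
(* Exchanging the two integrals, AB becomes the operator whose kernel is, up to a constant,
   the integral over zeta in Om of e^{-k zeta + conj(k zeta)} / ((z - zeta) conj(zeta - w)).
   Partial fractions split the integrand into two halves, each singular at only one of z
   and w.  In each half the pole is mollified at scale 1 / |k| and one integrates by parts
   once, the phase being an eigenfunction of d-bar with eigenvalue conj k.  Slicing the
   convex set Om by lines yields Green's formula with the boundary covered by four graphs,
   and the kernel of AB is at most
     C / |k| * (1 / |z - w| + int_{bd Om} |du| / (|z - u| |w - u|)).
   For z far from Om this decays like 1 / |z|, and <z>^{-1-eps} is in L^q because
   (1 + eps) q > 2; near Om, Hoelder's inequality with the singularities distributed
   between the two exponents (Schur's test) bounds the operator on L^q. *)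

Require Import Defs.
From HB Require Import structures.
From mathcomp Require Import all_boot all_order all_algebra.
From mathcomp Require Import all_classical all_reals all_analysis.
From mathcomp Require Import complex.
From mathcomp Require Import measurable_realfun.
From mathcomp Require Import ring lra.
Import Order.TTheory GRing.Theory Num.Theory.
Import numFieldNormedType.Exports.
Local Open Scope classical_set_scope.
Local Open Scope ring_scope.
Set Implicit Arguments.
Unset Strict Implicit.
Unset Printing Implicit Defensive.

(** * Power integrals on the line and the plane *)

Section PowerIntegrals.
Variable R : realType.
Local Notation mu := (@lebesgue_measure R).

(** The undivided kernel cannot be integrated by parts: d-bar of 1 / conj(u - w) is a multiple of 1
    / conj(u - w)^2, which is not locally integrable. Partial fractions with the denominator S = |u
    - z|^2 + |u - w|^2, positive because z and w differ, leave one half with the pole 1 / (z - u)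
    alone, whose d-bar is only a point mass; the other half is the conjugate of the first after k ->
    -k and z <-> w. Green's formula is stated for functions that are C^1 on the whole plane, hence
    the mollification; at scale 1 / |k| its error has the size 1 / (|k| |z - w|) of the gain.
    Slicing parametrizes the boundary by a coordinate t instead of arc length, and |z - c(t)| >= |t
    - b|, with b a coordinate of z, controls the singularity there. This bound on 1 / |z - c(t)|
    just fails to be integrable in t, so the Hoelder exponents are shifted off the symmetric split
    by a small g. Planar integrals become products of line integrals through |eta|^2 >= |x y|. Both
    cases of the theorem are the one condition (1 + eps) q > 2, with eps = 0 when q > 2. *)

Lemma derivable_powR_at (s x : R) : 0 < x -> derivable (fun y : R => y `^ s) x 1.
Proof. by move=> x0; apply: derivable_powR; rewrite in_itv/= x0. Qed.

Lemma continuous_powR_at (s x : R) : 0 < x -> continuous_at x (fun y : R => y `^ s).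
Proof.
by move=> x0; apply/differentiable_continuous/derivable1_diffP/derivable_powR_at.
Qed.

Lemma is_derive_powR_antiderivative (s x : R) : s != 1 -> 0 < x ->
  is_derive x 1 (fun y : R => y `^ (1 - s) / (1 - s)) (x `^ (- s)).
Proof.
move=> s1 x0.
have s0 : 1 - s != 0 by rewrite subr_eq0 eq_sym.
have H : is_derive x 1 (fun y : R => y `^ (1 - s)) ((1 - s) * x `^ (1 - s - 1)).
  exact: is_derive1_powR.
have E : x `^ (- s) = (1 - s)^-1 *: ((1 - s) * x `^ (1 - s - 1)).
  by rewrite /GRing.scale/= mulKf// addrAC subrr sub0r.
have -> : (fun y : R => y `^ (1 - s) / (1 - s)) =
    (1 - s)^-1 \*: (fun y : R => y `^ (1 - s)).
  by apply/funext => y /=; rewrite mulrC.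
by rewrite E; exact: is_deriveZ.
Qed.

Lemma derivable_powR_antiderivative (s x : R) : s != 1 -> 0 < x ->
  derivable (fun y : R => y `^ (1 - s) / (1 - s)) x 1.
Proof. by move=> s1 x0; have [] := is_derive_powR_antiderivative s1 x0. Qed.

Lemma derive1_powR_antiderivative (s x : R) : s != 1 -> 0 < x ->
  derive1 (fun y : R => y `^ (1 - s) / (1 - s)) x = x `^ (- s).
Proof.
move=> s1 x0; have [_ +] := is_derive_powR_antiderivative s1 x0.
by rewrite derive1E.
Qed.

Lemma continuous_powR_antiderivative (s x : R) : s != 1 -> 0 < x ->
  continuous_at x (fun y : R => y `^ (1 - s) / (1 - s)).
Proof.
move=> s1 x0; apply/differentiable_continuous/derivable1_diffP.
exact: derivable_powR_antiderivative.
Qed.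

Lemma integral_powR_segment (s a b : R) : s != 1 -> 0 < a -> a < b ->
  (\int[mu]_(x in `[a, b]) (x `^ (- s))%:E =
   (b `^ (1 - s) / (1 - s))%:E - (a `^ (1 - s) / (1 - s))%:E)%E.
Proof.
move=> s1 a0 ab.
have pos (x : R) : a <= x -> 0 < x by apply: lt_le_trans.
apply: (@continuous_FTC2 R _ (fun y : R => y `^ (1 - s) / (1 - s))) => //.
- apply: continuous_in_subspaceT => x /[!inE]/=; rewrite in_itv/= => /andP[ax _].
  exact/continuous_powR_at/pos.
- split.
  + move=> x /[!in_itv]/= /andP[/ltW ax _].
    by apply: derivable_powR_antiderivative => //; exact: pos.
  + by apply: cvg_at_right_filter; exact: continuous_powR_antiderivative.
  + by apply: cvg_at_left_filter; apply: continuous_powR_antiderivative; rewrite ?(lt_trans a0).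
- move=> x /[!in_itv]/= /andP[/ltW ax _].
  by apply: derive1_powR_antiderivative => //; exact: pos.
Qed.

Lemma measurable_powR_fun d (T : measurableType d) (D : set T) (f : T -> R) (s : R) :
  measurable_fun D f -> measurable_fun D (fun x => f x `^ s).
Proof. by move=> mf; apply: (measurableT_comp (measurable_powR s)). Qed.

Lemma integral_powR_near0 (s c : R) : s < 1 -> 0 < c ->
  (\int[mu]_(x in `]0%R, c]) (x `^ (- s))%:E <= (c `^ (1 - s) / (1 - s))%:E)%E.
Proof.
move=> s1 c0.
(* Monotone convergence along this exhaustion. The index starts at 2 so that every segment is
   nondegenerate, as [integral_powR_segment] demands. *)
have -> : `]0, c]%classic = \bigcup_i `[c / i.+2%:R, c]%classic.
  apply/seteqP; split => x /=.
    rewrite in_itv/= => /andP[x0 xc].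
    exists (Num.Def.archi_bound (c / x)) => //=; rewrite in_itv/= xc andbT.
    rewrite ler_pdivrMr// mulrC -ler_pdivrMr//.
    apply: (le_trans (ltW (archi_boundP (ltW (divr_gt0 c0 x0))))).
    by rewrite ler_nat -addn2 leq_addr.
  move=> [n _] /=; rewrite !in_itv/= => /andP[nx ->]; rewrite andbT.
  by rewrite (lt_le_trans _ nx)// divr_gt0.
have mf i : measurable_fun `[c / i.+2%:R, c] (fun x : R => (x `^ (- s))%:E).
  by apply/measurable_EFinP; apply: measurable_powR_fun; exact: measurable_id.
have nd : nondecreasing_seq (fun i => `[c / i.+2%:R, c]%classic).
  apply/nondecreasing_seqP => n; rewrite subsetEset => x /=.
  rewrite !in_itv/= => /andP[+ ->]; rewrite andbT; apply: le_trans.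
  by rewrite ler_pM2l// lef_pV2 ?posrE// ler_nat.
have cv : (\int[mu]_(x in `[(c / i.+2%:R)%R, c]) (x `^ (- s))%:E @[i --> \oo] -->
    \int[mu]_(x in \bigcup_i `[(c / i.+2%:R)%R, c]%classic) (x `^ (- s))%:E)%E.
  apply: ge0_nondecreasing_set_cvg_integral => //.
  by move=> i x _; rewrite lee_fin powR_ge0.
rewrite -(cvg_lim _ cv)//; apply: lime_le; first by apply/cvg_ex; eexists; exact: cv.
apply: nearW => n; rewrite integral_powR_segment//; last 3 first.
- by rewrite lt_eqF.
- by rewrite divr_gt0.
- by rewrite ltr_pdivrMr// ltr_pMr// ltr1n.
rewrite -EFinB lee_fin lerBlDr lerDl divr_ge0 ?powR_ge0// subr_ge0 ltW//.
Qed.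

Lemma integral_powR_infty (s c : R) : 1 < s -> 0 < c ->
  (\int[mu]_(x in `[c, +oo[) (x `^ (- s))%:E = (c `^ (1 - s) / (s - 1))%:E)%E.
Proof.
move=> s1 c0.
have pos (x : R) : c <= x -> 0 < x by apply: lt_le_trans.
rewrite (@ge0_continuous_FTC2y R _ (fun y : R => y `^ (1 - s) / (1 - s)) c 0).
- by rewrite sub0e -EFinN -mulrN -invrN opprB.
- by move=> x _; exact: powR_ge0.
- apply: continuous_in_subspaceT => x /[!inE]/=; rewrite in_itv/= andbT => ax.
  exact/continuous_powR_at/pos.
- rewrite -[X in _ --> X](mul0r (1 - s)^-1).
  apply: cvgM; last exact: cvg_cst.
  have -> : (fun x : R => x `^ (1 - s)) = (fun x : R => (x `^ (s - 1))^-1).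
    by apply/funext => x; rewrite -powRN opprB.
  apply/gtr0_cvgV0.
    by near=> x; rewrite powR_gt0.
  apply/cvgryPge => A; near=> x.
  have [A0|A0] := leP A 0; first by rewrite (le_trans A0)// powR_ge0.
  have -> : A = (A `^ (s - 1)^-1) `^ (s - 1).
    by rewrite -powRrM mulVf ?powRr1 ?ltW// subr_eq0 gt_eqF.
  by rewrite ge0_ler_powR ?nnegrE ?powR_ge0 ?subr_ge0 ?(ltW s1)//.
- by move=> x /ltW cx; apply: derivable_powR_antiderivative; [rewrite gt_eqF|exact: pos].
- by apply: cvg_at_right_filter; apply: continuous_powR_antiderivative; rewrite ?gt_eqF.
- move=> x /[!in_itv]/= /andP[/ltW cx _].
  by apply: derive1_powR_antiderivative; [rewrite gt_eqF|exact: pos].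
Unshelve. all: by end_near. Qed.

End PowerIntegrals.

(** * Even integrands and translation invariance on the line *)

Section OneDimensional.
Variable R : realType.
Local Notation mu := (@lebesgue_measure R).

Lemma integral_even (f : R -> \bar R) : measurable_fun setT f ->
  (forall x, 0 <= f x)%E -> (forall x, f (- x) = f x) ->
  (\int[mu]_x f x = 2%:E * \int[mu]_(x in `]0%R, +oo[) f x)%E.
Proof.
move=> mf f0 fN.
have E : [set: R] = `]-oo, 0%R] `|` `]0%R, +oo[.
  apply/seteqP; split => // x _ /=; rewrite !in_itv/= andbT.
  by case: (leP x 0) => _; [left|right].
rewrite E ge0_integral_setU//=; last 2 first.
- by rewrite -E.
- apply/disj_setPS => x [] /=; rewrite !in_itv/= andbT => x0 x1.
  by move: (lt_le_trans x1 x0); rewrite ltxx.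
rewrite mule_natl mule2n; congr (_ + _)%E.
under eq_integral do rewrite -fN.
rewrite -ge0_integration_by_substitution0// [RHS]integral_itv_obnd_cbnd//.
exact: measurable_funS mf.
Qed.

(** Evenness leaves the half-line, and the cut at [c] leaves one convergent power integral on each
    side. The cut is a parameter because [integral_scaled_kernel] has to place it at its own scale
    [d]. *)
Lemma integral_radial_le (phi : R -> R) (s t A B c : R) :
  measurable_fun setT phi -> (forall x, 0 <= phi x) ->
  s < 1 -> 1 < t -> 0 < c -> 0 <= A -> 0 <= B ->
  (forall x, 0 < x <= c -> phi x <= A * x `^ (- s)) ->
  (forall x, c < x -> phi x <= B * x `^ (- t)) ->
  (\int[mu]_x (phi `|x|)%:E <=
   (2 * (A * (c `^ (1 - s) / (1 - s)) + B * (c `^ (1 - t) / (t - 1))))%:E)%E.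
Proof.
move=> mphi phi0 s1 t1 c0 A0 B0 hA hB.
have mpow (p : R) D : measurable_fun D (fun x : R => (x `^ p)%:E).
  by apply/measurable_EFinP; apply: measurable_powR_fun; exact: measurable_id.
rewrite integral_even//; last 3 first.
- by apply/measurable_EFinP; apply: measurableT_comp.
- by move=> x; rewrite lee_fin.
- by move=> x; rewrite normrN.
rewrite EFinM; apply: lee_wpmul2l => //.
have E : `]0%R, +oo[%classic = `]0%R, c] `|` `]c, +oo[.
  apply/seteqP; split => x /=; rewrite !in_itv/= !andbT.
    by move=> x0; case: (leP x c) => _; [left|right] => //; rewrite x0.
  by move=> [/andP[]//|]; apply: lt_trans.
have mphi' D : measurable_fun D (fun x : R => (phi `|x|)%:E).
  by apply/measurable_EFinP; apply: measurable_funTS; exact: measurableT_comp.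
rewrite E ge0_integral_setU//=; last 3 first.
- exact: mphi'.
- by move=> x _; rewrite lee_fin.
- apply/disj_setPS => x [] /=; rewrite !in_itv/= andbT => /andP[_ x0] x1.
  by move: (lt_le_trans x1 x0); rewrite ltxx.
rewrite EFinD; apply: leeD.
  apply: (@le_trans _ _ (\int[mu]_(x in `]0%R, c]) (A%:E * (x `^ (- s))%:E))%E).
    apply: ge0_le_integral => //.
    - by move=> x _; rewrite lee_fin.
    - exact: mphi'.
    - apply: emeasurable_funM; [exact: measurable_cst|exact: mpow].
    - move=> x /=; rewrite in_itv/= => /andP[x0 xc].
      by rewrite lee_fin gtr0_norm// hA// x0.
  rewrite ge0_integralZl//; [|exact: mpow|by move=> x _; rewrite lee_fin powR_ge0].
  by rewrite EFinM lee_wpmul2l// integral_powR_near0.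
apply: (@le_trans _ _ (\int[mu]_(x in `]c, +oo[) (B%:E * (x `^ (- t))%:E))%E).
  apply: ge0_le_integral => //.
  - by move=> x _; rewrite lee_fin.
  - exact: mphi'.
  - apply: emeasurable_funM; [exact: measurable_cst|exact: mpow].
  - move=> x /=; rewrite in_itv/= andbT => xc.
    by rewrite lee_fin gtr0_norm ?hB// (lt_trans c0).
rewrite ge0_integralZl//; [|exact: mpow|by move=> x _; rewrite lee_fin powR_ge0].
rewrite integral_itv_obnd_cbnd; last exact: mpow.
by rewrite EFinM lee_wpmul2l// integral_powR_infty.
Qed.

Definition shiftR (c : R) (x : measurableTypeR R) : measurableTypeR R := x - c.

Lemma measurable_shiftR (c : R) : measurable_fun setT (shiftR c).
Proof. by apply: measurable_funB => //; exact: measurable_id. Qed.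

HB.instance Definition _ (c : R) :=
  isMeasurableFun.Build _ _ _ _ (shiftR c) (measurable_shiftR c).

(** Uniqueness of Lebesgue measure: the pushforward gives half-open intervals their length. *)
Lemma lebesgue_measure_shift (c : R) (A : set R) : measurable A ->
  pushforward mu (shiftR c) A = mu A.
Proof.
move=> mA; apply/esym/lebesgue_measure_unique => //= _ [[a b]] _ <-.
rewrite /pushforward/=.
have -> : shiftR c @^-1` `]a, b] = `](a + c)%R, (b + c)%R]%classic.
  by apply/seteqP; split => x /=; rewrite !in_itv/= /shiftR ltrBrDr lerBlDr.
rewrite !lebesgue_measure_itv/= !lte_fin ltrD2r.
by case: ifP => // _; rewrite -!EFinB; congr EFin; ring.
Qed.

Lemma integral_shift (f : R -> \bar R) (c : R) : measurable_fun setT f ->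
  (forall x, 0 <= f x)%E -> (\int[mu]_x f (x - c)%R = \int[mu]_x f x)%E.
Proof.
move=> mf f0.
have := @ge0_integral_pushforward _ _ _ _ R _ (measurable_shiftR c) mu setT f measurableT mf.
rewrite preimage_setT => <-//.
by apply: eq_measure_integral => A mA _; exact: lebesgue_measure_shift.
Qed.

End OneDimensional.

(** * Singular integrals on the plane as products of line integrals *)

Section PlaneIntegrals.
Variable R : realType.
Local Notation mu := (@lebesgue_measure R).
Local Notation mu2 := (@leb2 R).

Definition dist (z w : R * R) : R :=
  Num.sqrt ((z.1 - w.1) ^+ 2 + (z.2 - w.2) ^+ 2).

Lemma dist_ge0 z w : 0 <= dist z w. Proof. exact: sqrtr_ge0. Qed.

Lemma distC z w : dist z w = dist w z.
Proof. by rewrite /dist -sqrrN opprB -[X in _ + X]sqrrN opprB. Qed.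

Lemma sqr_dist z w : dist z w ^+ 2 = (z.1 - w.1) ^+ 2 + (z.2 - w.2) ^+ 2.
Proof. by rewrite sqr_sqrtr// addr_ge0// sqr_ge0. Qed.

Lemma abs1_le_dist z w : `|z.1 - w.1| <= dist z w.
Proof. by rewrite -sqrtr_sqr ler_sqrt ?addr_ge0 ?sqr_ge0// lerDl sqr_ge0. Qed.

Lemma abs2_le_dist z w : `|z.2 - w.2| <= dist z w.
Proof. by rewrite -sqrtr_sqr ler_sqrt ?addr_ge0 ?sqr_ge0// lerDr sqr_ge0. Qed.

Lemma dist_eq0 z w : (dist z w == 0) = (z == w).
Proof.
case: z w => [a b] [c d]; rewrite /dist sqrtr_eq0 xpair_eqE /=.
rewrite le_eqVlt ltNge addr_ge0 ?sqr_ge0//= orbF paddr_eq0 ?sqr_ge0//.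
by rewrite !sqrf_eq0 !subr_eq0.
Qed.

Lemma dist_gt0 z w : z != w -> 0 < dist z w.
Proof. by move=> zw; rewrite lt_def dist_ge0 dist_eq0 zw. Qed.

Lemma ae_neq (b : R) (P : R -> Prop) : (forall y, y != b -> P y) ->
  {ae mu, forall y, [set: R] y -> P y}.
Proof.
move=> h; exists [set b]; split; [exact: measurable_set1|exact: lebesgue_measure_set1|].
move=> y /= nP; apply: contrapT => yb; apply: nP => _; apply: h.
by apply/eqP.
Qed.

Lemma measurable_section (f : R * R -> R) (x : R) : measurable_fun setT f ->
  measurable_fun setT (fun y => f (x, y)).
Proof. by move=> mf; exact: (measurableT_comp mf (measurable_pair1 x)). Qed.

(** One value of each coordinate is exempt because the product majorants fail there: a negative
    power of 0 is 0 by convention, so on an axis through the pole the majorant vanishes or drops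
    while the integrand does not. *)
Lemma integral_prod_le (f : R * R -> R) (g h : R -> R) (a b : R) :
  measurable_fun setT f -> measurable_fun setT g -> measurable_fun setT h ->
  (forall z, 0 <= f z) -> (forall x, 0 <= g x) -> (forall x, 0 <= h x) ->
  (forall x y, x != a -> y != b -> f (x, y) <= g x * h y) ->
  (\int[mu2]_z (f z)%:E <= (\int[mu]_x (g x)%:E) * (\int[mu]_x (h x)%:E))%E.
Proof.
move=> mf mg mh f0 g0 h0 fgh.
have Ef : measurable_fun setT (EFin \o f) by exact/measurable_EFinP.
have Eg : measurable_fun setT (EFin \o g) by exact/measurable_EFinP.
have Eh : measurable_fun setT (EFin \o h) by exact/measurable_EFinP.
rewrite fubini_tonelli1//.
rewrite -ge0_integralZr//; last 2 first.
- by move=> x _; rewrite lee_fin.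
- by apply: integral_ge0 => x _; rewrite lee_fin.
apply: ae_ge0_le_integral => //.
- by move=> x _; apply: integral_ge0 => y _; rewrite lee_fin.
- by apply: measurable_fun_fubini_tonelli_F => // z; rewrite /= lee_fin.
- move=> x _; rewrite mule_ge0 ?lee_fin//.
  by apply: integral_ge0 => y _; rewrite lee_fin.
- by apply: emeasurable_funM => //; exact: measurable_cst.
apply: (@ae_neq a) => x xa.
rewrite /fubini_F/= -ge0_integralZl ?lee_fin//; last by move=> y _; rewrite lee_fin.
apply: ae_ge0_le_integral => //.
- by move=> y _; rewrite lee_fin.
- by apply/measurable_EFinP; exact: measurable_section.
- by move=> y _; rewrite mule_ge0 ?lee_fin.
- by apply: emeasurable_funM => //; exact: measurable_cst.
by apply: (@ae_neq b) => y yb; rewrite -EFinM lee_fin fgh.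
Qed.

(** The product [wt t z.1 * wt t z.2] takes the place of a radial weight at infinity, so that
    weighted planar integrals separate into line integrals; [decay_powR_le] makes the passage. *)
Definition wt (t x : R) : R := (1 + `|x|) `^ (- t).

Lemma wt_ge0 t x : 0 <= wt t x. Proof. exact: powR_ge0. Qed.

Lemma wt_le1 t x : 0 <= t -> wt t x <= 1.
Proof.
move=> t0; rewrite /wt powRN invf_le1; last by rewrite powR_gt0 // ltr_pwDl.
rewrite -[leLHS](powRr0 (1 + `|x|)); apply: ler_powR => //.
by rewrite lerDl.
Qed.

Lemma measurable_wt t : measurable_fun setT (wt t).
Proof.
apply: measurable_powR_fun; apply: measurable_funD; first exact: measurable_cst.
exact: normr_measurable.
Qed.

Lemma integral_wt (t : R) : 1 < t ->
  exists2 C : R, 0 <= C & (\int[mu]_x (wt t x)%:E <= C%:E)%E.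
Proof.
move=> t1; exists (2 * (1 * (1 `^ (1 - 0) / (1 - 0)) + 1 * (1 `^ (1 - t) / (t - 1)))).
  by rewrite !powR1 !mul1r mulr_ge0// addr_ge0 ?invr_ge0 ?subr_ge0// ltW.
have -> : (fun x => (wt t x)%:E) = (fun x => (wt t `|x|)%:E).
  by apply/funext => x; rewrite /wt normr_id.
apply: integral_radial_le => //.
- exact: measurable_wt.
- by move=> x; exact: wt_ge0.
- move=> x _; rewrite oppr0 powRr0 mulr1 wt_le1//.
  by rewrite ltW// (lt_trans _ t1).
- move=> x x1; have x0 : 0 < x by apply: lt_trans x1.
  rewrite mul1r /wt gtr0_norm// !powRN lef_pV2 ?posrE ?powR_gt0// ?addr_gt0//.
  rewrite ge0_ler_powR ?nnegrE ?(ltW x0) ?addr_ge0// ?(ltW x0)// ?lerDr//.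
  by rewrite ltW// (lt_trans _ t1).
Qed.

Definition sing (s x : R) : R := if `|x| <= 1 then `|x| `^ (- s) else 0.

Lemma sing_ge0 s x : 0 <= sing s x.
Proof. by rewrite /sing; case: ifP => // _; exact: powR_ge0. Qed.

Lemma measurable_sing s : measurable_fun setT (sing s).
Proof.
apply: measurable_fun_ifT.
- apply: measurable_fun_ler; last exact: measurable_cst.
  exact: normr_measurable.
- by apply: measurable_powR_fun; exact: normr_measurable.
- exact: measurable_cst.
Qed.

Lemma integral_sing (s : R) : s < 1 ->
  exists2 C : R, 0 <= C & (\int[mu]_x (sing s x)%:E <= C%:E)%E.
Proof.
move=> s1; exists (2 * (1 * (1 `^ (1 - s) / (1 - s)) + 0 * (1 `^ (1 - 2) / (2 - 1)))).
  by rewrite !powR1 !mul1r mul0r addr0 mulr_ge0 ?invr_ge0 ?subr_ge0// ltW.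
have -> : (fun x => (sing s x)%:E) = (fun x => (sing s `|x|)%:E).
  by apply/funext => x; rewrite /sing normr_id.
apply: integral_radial_le => //.
- exact: measurable_sing.
- by move=> x; exact: sing_ge0.
- by lra.
- move=> x /andP[x0 x1]; rewrite mul1r /sing gtr0_norm// x1//.
- move=> x x1; by rewrite mul0r /sing gtr0_norm ?(lt_trans _ x1)// [x <= 1]leNgt x1.
Qed.

(** Up to a factor 2 the larger summand of the base wins: the power of [|x|] when [|x| <= 1], the
    constant 1 beyond. *)
Lemma singular_factor_le (s p x : R) : 0 <= s -> 0 <= p ->
  (1 + `|x| `^ (- s)) `^ p <= 2 `^ p * (1 + sing (s * p) x).
Proof.
move=> s0 p0; have p2 : (0 : R) <= 2 `^ p by exact: powR_ge0.
have [x1|x1] := leP `|x| 1; last first.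
  rewrite /sing [`|x| <= 1]leNgt x1/= addr0 mulr1 ge0_ler_powR ?nnegrE ?addr_ge0 ?powR_ge0//.
  rewrite -[leRHS]/(1 + 1) lerD2l powRN invf_le1; last exact/powR_gt0/(lt_trans _ x1).
  by rewrite -[leLHS](powRr0 `|x|) ler_powR// ltW.
rewrite /sing x1.
(* At 0 the conventional value of the power is 1 if [s = 0] and 0 otherwise; both are covered by the
   constant term on the right. *)
have [->|xn0] := eqVneq x 0.
  rewrite normr0; have [->|sn0] := eqVneq s 0.
    by rewrite oppr0 powRr0 ler_peMr// lerDl powR_ge0.
  rewrite powR0 ?oppr_eq0// addr0 powR1.
  rewrite (@le_trans _ _ (2 `^ p))//; last by rewrite ler_peMr// lerDl powR_ge0.
  by rewrite -[leLHS](powRr0 2) ler_powR// ler1n.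
have x0 : 0 < `|x| by rewrite normr_gt0.
have h : 1 <= `|x| `^ (- s).
  rewrite powRN invf_ge1 ?powR_gt0//.
  by rewrite -[leRHS](powRr0 `|x|) ger_powR// x0.
rewrite (@le_trans _ _ ((2 * `|x| `^ (- s)) `^ p))//.
  rewrite ge0_ler_powR ?nnegrE ?addr_ge0 ?mulr_ge0 ?powR_ge0//.
  by rewrite mulrDl !mul1r lerD2r.
rewrite powRM ?powR_ge0// ler_wpM2l// -powRrM mulNr.
by rewrite lerDr.
Qed.

(** Uniformity in [c]: the weight, being at most 1, is dropped on the singular part, whose integral
    is then translation invariant; the weight alone gives convergence at infinity. *)
Lemma integral_line_kernel (s p t : R) : 0 <= s -> 0 <= p -> s * p < 1 -> 1 < t ->
  exists2 C : R, 0 <= C & forall c : R,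
  (\int[mu]_x (wt t x * (1 + `|x - c| `^ (- s)) `^ p)%:E <= C%:E)%E.
Proof.
move=> s0 p0 sp t1.
have t0 : 0 <= t by rewrite ltW// (lt_trans _ t1).
have [C1 C10 hC1] := integral_wt t1; have [C2 C20 hC2] := integral_sing sp.
exists (2 `^ p * (C1 + C2)); first by rewrite mulr_ge0 ?addr_ge0 ?powR_ge0.
move=> c.
have mshift : measurable_fun setT (fun x : R => x - c).
  by apply: measurable_funB; [exact: measurable_id|exact: measurable_cst].
have msing : measurable_fun setT (fun x : R => sing (s * p) (x - c)).
  exact: (measurableT_comp (measurable_sing _) mshift).
apply: (@le_trans _ _ (\int[mu]_x ((2 `^ p)%:E * ((wt t x)%:E + (sing (s * p) (x - c))%:E)))%E).
  apply: ge0_le_integral => //.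
  - by move=> x _; rewrite lee_fin mulr_ge0 ?wt_ge0 ?powR_ge0.
  - apply/measurable_EFinP; apply: measurable_funM; first exact: measurable_wt.
    apply: measurable_powR_fun; apply: measurable_funD; first exact: measurable_cst.
    by apply: measurable_powR_fun; exact: measurableT_comp.
  - apply: emeasurable_funM; first exact: measurable_cst.
    apply: emeasurable_funD; apply/measurable_EFinP => //; exact: measurable_wt.
  - move=> x _; rewrite -EFinD -EFinM lee_fin.
    rewrite (le_trans (ler_wpM2l (wt_ge0 t x) (singular_factor_le (x - c) s0 p0)))//.
    rewrite mulrCA ler_wpM2l ?powR_ge0// mulrDr mulr1 lerD2l.
    by rewrite ler_piMl ?sing_ge0 ?wt_le1.
rewrite ge0_integralZl//; last 2 first.
- by apply: emeasurable_funD; apply/measurable_EFinP => //; exact: measurable_wt.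
- by move=> x _; rewrite adde_ge0 ?lee_fin ?wt_ge0 ?sing_ge0.
rewrite EFinM lee_wpmul2l ?lee_fin ?powR_ge0//.
rewrite ge0_integralD//; last 4 first.
- by move=> x _; rewrite lee_fin wt_ge0.
- by apply/measurable_EFinP; exact: measurable_wt.
- by move=> x _; rewrite lee_fin sing_ge0.
- exact/measurable_EFinP.
rewrite EFinD; apply: leeD; first exact: hC1.
rewrite (@integral_shift R (fun x => (sing (s * p) x)%:E))//.
- by apply/measurable_EFinP; exact: measurable_sing.
- by move=> x; rewrite lee_fin sing_ge0.
Qed.

(** Each coordinate difference is at most the distance, hence so is their geometric mean. This
    separates the variables at no loss in the range of exponents: a power p < 2 of 1 / |eta| becomes
    a power p / 2 < 1 on each axis. *)
Lemma inv_dist_le (z c : R * R) : z.1 != c.1 -> z.2 != c.2 ->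
  (dist z c)^-1 <= `|z.1 - c.1| `^ (- 2^-1) * `|z.2 - c.2| `^ (- 2^-1).
Proof.
move=> h1 h2.
have p1 : 0 < `|z.1 - c.1| by rewrite normr_gt0 subr_eq0.
have p2 : 0 < `|z.2 - c.2| by rewrite normr_gt0 subr_eq0.
have d0 : 0 < dist z c by rewrite (lt_le_trans p1)// abs1_le_dist.
rewrite -powRM// powRN lef_pV2 ?posrE ?powR_gt0 ?mulr_gt0//.
rewrite powR12_sqrt ?mulr_ge0// -(@ger0_norm _ (dist z c)) ?dist_ge0//.
rewrite -(sqrtr_sqr (dist z c)) ler_wsqrtr// expr2 ler_pM//.
- exact: abs1_le_dist.
- exact: abs2_le_dist.
Qed.

(** The summand 1 keeps the factor at least 1, so that arbitrary real powers of it multiply as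
    expected, and it absorbs bounded terms such as those of [inv_dist_le_jbr]. On the diagonal its
    value is 1, since [0^-1 = 0]. *)
Definition kap (z c : R * R) : R := 1 + (dist z c)^-1.

Lemma kap_ge1 z c : 1 <= kap z c.
Proof. by rewrite lerDl invr_ge0 dist_ge0. Qed.

Lemma kap_gt0 z c : 0 < kap z c.
Proof. exact: lt_le_trans (kap_ge1 z c). Qed.

Lemma kapC z c : kap z c = kap c z. Proof. by rewrite /kap distC. Qed.

Lemma measurable_dist d (T : measurableType d) (f g : T -> R * R) :
  measurable_fun setT f -> measurable_fun setT g ->
  measurable_fun setT (fun x => dist (f x) (g x)).
Proof.
move=> /measurable_fun_pairP[mf1 mf2] /measurable_fun_pairP[mg1 mg2].
rewrite /dist.
under eq_fun do rewrite -powR12_sqrt ?addr_ge0 ?sqr_ge0//.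
apply: measurable_powR_fun; apply: measurable_funD.
- by apply: measurable_funX; exact: measurable_funB.
- by apply: measurable_funX; exact: measurable_funB.
Qed.

Lemma measurable_inv_ge0 d (T : measurableType d) (f : T -> R) :
  (forall x, 0 <= f x) -> measurable_fun setT f ->
  measurable_fun setT (fun x => (f x)^-1).
Proof.
by move=> f0 mf; under eq_fun do rewrite -powR_inv1//; exact: measurable_powR_fun.
Qed.

Lemma measurable_kap d (T : measurableType d) (f g : T -> R * R) :
  measurable_fun setT f -> measurable_fun setT g ->
  measurable_fun setT (fun x => kap (f x) (g x)).
Proof.
move=> mf mg; apply: measurable_funD; first exact: measurable_cst.
apply: measurable_inv_ge0; first by move=> x; exact: dist_ge0.
exact: measurable_dist.
Qed.

Lemma integral_plane_kernel (p t : R) : 0 <= p -> p < 2 -> 1 < t ->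
  exists2 C : R, 0 <= C & forall c : R * R,
  (\int[mu2]_z (wt t z.1 * wt t z.2 * kap z c `^ p)%:E <= C%:E)%E.
Proof.
move=> p0 p2 t1.
have [||||C C0 hC] := @integral_line_kernel 2^-1 p t => //.
  by rewrite mulrC ltr_pdivrMr// mul1r.
exists (C * C); first exact: mulr_ge0.
move=> c; have m d : measurable_fun setT (fun x : R => wt t x * (1 + `|x - d| `^ (- 2^-1)) `^ p).
  apply: measurable_funM; first exact: measurable_wt.
  apply: measurable_powR_fun; apply: measurable_funD; first exact: measurable_cst.
  apply: measurable_powR_fun; apply: measurableT_comp; first exact: normr_measurable.
  by apply: measurable_funB; [exact: measurable_id|exact: measurable_cst].
apply: le_trans; last by rewrite EFinM; apply: lee_pmul (hC c.1) (hC c.2);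
  apply: integral_ge0 => x _; rewrite lee_fin mulr_ge0 ?wt_ge0 ?powR_ge0.
apply: (@integral_prod_le _ _ _ c.1 c.2) => //.
- apply: measurable_funM.
    by apply: measurable_funM; apply: (measurableT_comp (measurable_wt t));
      [exact: measurable_fst|exact: measurable_snd].
  by apply: measurable_powR_fun; apply: measurable_kap; [exact: measurable_id|exact: measurable_cst].
- by move=> z; rewrite !mulr_ge0 ?wt_ge0 ?powR_ge0.
- by move=> x; rewrite mulr_ge0 ?wt_ge0 ?powR_ge0.
- by move=> x; rewrite mulr_ge0 ?wt_ge0 ?powR_ge0.
move=> x y xc yc; rewrite /= mulrACA ler_wpM2l ?mulr_ge0 ?wt_ge0//.
rewrite -powRM ?addr_ge0 ?powR_ge0// ge0_ler_powR ?nnegrE ?mulr_ge0 ?addr_ge0 ?powR_ge0//.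
  by rewrite invr_ge0 dist_ge0.
have := @inv_dist_le (x, y) c xc yc; rewrite /kap /= => h.
rewrite mulrDl mul1r mulrDr mulr1 -addrA lerD2l.
by rewrite (le_trans h)// addrA lerDr addr_ge0 ?powR_ge0.
Qed.

(* The two axial factors come from |eta| >= sqrt |x y| and
   |eta|^2 + d^2 >= max (|x|, d) * max (|y|, d). *)
Lemma integral_scaled_kernel : exists2 C : R, 0 <= C & forall (c : R * R) (d : R), 0 < d ->
  (\int[mu2]_z ((dist z c)^-1 * (dist z c ^+ 2 + d ^+ 2)^-1)%:E <= (C / d)%:E)%E.
Proof.
(* Each axis contributes 8 d^(-1/2): the pieces below and above [d] are each 2 d^(-1/2), doubled by
   evenness. The product of the two axes is 64 / d. *)
exists 64 => // c d d0.
pose phi (x : R) : R := `|x| `^ (- 2^-1) * (Num.max `|x| d)^-1.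
have mx0 (x : R) : 0 < Num.max `|x| d by rewrite lt_max d0 orbT.
have phi0 x : 0 <= phi x by rewrite mulr_ge0 ?powR_ge0// invr_ge0 ltW.
have mphi : measurable_fun setT phi.
  apply: measurable_funM; first by apply: measurable_powR_fun; exact: normr_measurable.
  apply: measurable_inv_ge0; first by move=> x; exact: ltW.
  by apply: measurable_maxr; [exact: normr_measurable|exact: measurable_cst].
have iphi : (\int[mu]_x (phi x)%:E <= (8 * d `^ (- 2^-1))%:E)%E.
  have -> : (fun x => (phi x)%:E) = (fun x => (phi `|x|)%:E).
    by apply/funext => x; rewrite /phi normr_id.
  apply: le_trans.
    apply: (@integral_radial_le R phi 2^-1 (1 + 2^-1) d^-1 1 d) => //.
    - by lra.
    - by lra.
    - by rewrite invr_ge0 ltW.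
    - move=> x /andP[x0 xd]; rewrite /phi gtr0_norm// mulrC ler_wpM2r ?powR_ge0//.
      by rewrite lef_pV2 ?posrE ?lt_max ?d0 ?orbT// le_max lexx orbT.
    - move=> x dx; have x0 : 0 < x by apply: lt_trans dx.
      rewrite mul1r /phi gtr0_norm// opprD addrC powRD; last by rewrite (gt_eqF x0) implybT.
      rewrite ler_wpM2l ?powR_ge0// powR_inv1 ?(ltW x0)//.
      by rewrite lef_pV2 ?posrE ?lt_max ?d0 ?orbT// le_max lexx.
  have -> : d `^ (1 - 2^-1) = d * d `^ (- 2^-1).
    by rewrite powRD ?powRr1 ?ltW//; rewrite (gt_eqF d0) implybT.
  have -> : 1 - (1 + 2^-1) = - 2^-1 :> R by lra.
  rewrite lee_fin mul1r -mulrA mulKf ?gt_eqF//.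
  set e := d `^ _; have -> : 1 - 2^-1 = 2^-1 :> R by lra.
  have -> : 1 + 2^-1 - 1 = 2^-1 :> R by lra.
  by rewrite invrK; lra.
pose sh e (x : R) := phi (x - e).
have msh e : measurable_fun setT (sh e).
  apply: (measurableT_comp mphi).
  by apply: measurable_funB; [exact: measurable_id|exact: measurable_cst].
have ish e : (\int[mu]_x (sh e x)%:E <= (8 * d `^ (- 2^-1))%:E)%E.
  rewrite /sh (@integral_shift R (fun x => (phi x)%:E))//; first exact/measurable_EFinP.
apply: (@le_trans _ _ ((8 * d `^ (- 2^-1))%:E * (8 * d `^ (- 2^-1))%:E)%E); last first.
  rewrite -EFinM lee_fin mulrACA -powRD; last by rewrite (gt_eqF d0) implybT.
  rewrite (_ : - 2^-1 - 2^-1 = -1 :> R); last by lra.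
  by rewrite powR_inv1 ?(ltW d0)// ler_wpM2r ?invr_ge0 ?(ltW d0)//; lra.
apply: le_trans; last by apply: lee_pmul (ish c.1) (ish c.2);
  apply: integral_ge0 => x _; rewrite lee_fin; exact: phi0.
apply: (@integral_prod_le _ _ _ c.1 c.2) => //.
- have md : measurable_fun setT (fun z => dist z c).
    by apply: measurable_dist; [exact: measurable_id|exact: measurable_cst].
  apply: measurable_funM; apply: measurable_inv_ge0 => //.
  + by move=> z; exact: dist_ge0.
  + by move=> z; rewrite addr_ge0 ?sqr_ge0.
  + by apply: measurable_funD; [exact: measurable_funX|exact: measurable_cst].
- by move=> z; rewrite mulr_ge0 ?invr_ge0 ?dist_ge0 ?addr_ge0 ?sqr_ge0.
- by move=> x; exact: phi0.
- by move=> x; exact: phi0.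
move=> x y xc yc; rewrite /sh /phi mulrACA.
have D0 : 0 <= dist (x, y) c by exact: dist_ge0.
have h u : u <= dist (x, y) c -> Num.max u d <= Num.sqrt (dist (x, y) c ^+ 2 + d ^+ 2).
  move=> ud; rewrite ge_max; apply/andP; split.
    rewrite (le_trans ud)// -[leLHS]ger0_norm// -sqrtr_sqr ler_sqrt ?addr_ge0 ?sqr_ge0//.
    by rewrite lerDl sqr_ge0.
  rewrite -[leLHS](@ger0_norm _ d) ?(ltW d0)// -sqrtr_sqr ler_wsqrtr//.
  by rewrite lerDr sqr_ge0.
rewrite ler_pM ?invr_ge0 ?addr_ge0 ?sqr_ge0//; first exact: (@inv_dist_le (x, y) c).
rewrite -invfM lef_pV2 ?posrE ?mulr_gt0//; last by rewrite ltr_wpDl ?sqr_ge0 ?exprn_gt0.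
rewrite -(@sqr_sqrtr _ (_ + d ^+ 2)) ?addr_ge0 ?sqr_ge0// expr2.
rewrite ler_pM ?(ltW (mx0 _))//; apply: h.
- exact: (@abs1_le_dist (x, y) c).
- exact: (@abs2_le_dist (x, y) c).
Qed.

End PlaneIntegrals.

(** * Slices of convex sets *)

Section PlaneTopology.
Variable R : realType.
Local Notation mu := (@lebesgue_measure R).
Local Notation mu2 := (@leb2 R).

Lemma rat_itv_in_ball (u e : R) : 0 < e -> exists q : rat * rat,
  (ratr q.1 < u < ratr q.2) /\ (forall v : R, ratr q.1 < v < ratr q.2 -> ball u e v).
Proof.
move=> e0; have [|a /[!in_itv]/= /andP[a1 a2]] := @rat_in_itvoo R (u - e) u.
  by rewrite ltrBlDr ltrDl.
have [|b /[!in_itv]/= /andP[b1 b2]] := @rat_in_itvoo R u (u + e).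
  by rewrite ltrDl.
exists (a, b); split => /=; first by rewrite a2 b1.
move=> v /andP[v1 v2]; rewrite /ball/= ltr_norml; apply/andP.
by split; lra.
Qed.

(** The sigma-algebra on the plane is the product one, so an open set has to be exhibited as a
    countable union of boxes; rational end points provide them. *)
Lemma open_measurable_plane (U : set (R * R)) : open U -> measurable U.
Proof.
move=> oU.
pose box (p : (rat * rat) * (rat * rat)) : set (R * R) :=
  `]ratr p.1.1, ratr p.1.2[ `*` `]ratr p.2.1, ratr p.2.2[.
pose F p := if `[< box p `<=` U >] then box p else set0.
have -> : U = \bigcup_p F p.
  apply/seteqP; split => [[x y] Uxy|z [p _]]; last first.
    by rewrite /F; case: asboolP => // + ?; exact.
  have /nbhs_ballP[e /= e0 eU] : nbhs (x, y) U by exact: open_nbhs_nbhs.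
  have [q [xq hq]] := rat_itv_in_ball x e0; have [r [yr hr]] := rat_itv_in_ball y e0.
  exists (q, r) => //; rewrite /F asboolT; first by split; rewrite /= in_itv.
  move=> [u v] [/=]; rewrite !in_itv => uq vr.
  by apply: eU; split => /=; [exact: hq|exact: hr].
apply: countable_bigcupT_measurable; first exact: countableP.
move=> p; rewrite /F; case: asboolP => // _.
by apply: measurableX; exact: measurable_itv.
Qed.

Lemma continuous_measurable_plane (f : R * R -> R) : continuous f -> measurable_fun setT f.
Proof.
move=> cf; apply: (measurability _ (RGenOpens.measurableE R)) => _ [_ [a [b ->] <-]].
rewrite setTI; apply: open_measurable_plane.
by apply: open_comp; [move=> z _; exact: cf|exact: interval_open].
Qed.

Lemma continuous_bounded_box (f : R * R -> R) (M : R) : continuous f ->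
  exists2 B : R, 0 <= B & forall z, `|z.1| <= M -> `|z.2| <= M -> `|f z| <= B.
Proof.
move=> cf.
have : compact (f @` (`[- M, M] `*` `[- M, M])).
  apply: continuous_compact; first exact: continuous_subspaceT.
  by apply: compact_setX; exact: segment_compact.
move=> /compact_bounded[N [_ /(_ (`|N| + 1))]].
rewrite (le_lt_trans (ler_norm N)) ?ltrDl// => /(_ isT) h.
exists (`|N| + 1); first by rewrite addr_ge0.
by move=> z z1 z2; apply: h; exists z => //; split => /=; rewrite in_itv/= -ler_norml.
Qed.

Lemma continuous_pair1 (y : R) : continuous (fun x : R => (x, y)).
Proof. by move=> x; exact: (cvg_pair cvg_id (cvg_cst y)). Qed.

Lemma continuous_pair2 (x : R) : continuous (fun y : R => (x, y)).
Proof. by move=> y; exact: (cvg_pair (cvg_cst x) cvg_id). Qed.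

(** A nonempty slice has supremum above [c] exactly when it contains a point above [c], and the
    ordinates of such slices form an open set. *)
Lemma measurable_sup_slice (U : set (R * R)) (M : R) : open U ->
  (forall z, U z -> `|z.1| <= M) ->
  measurable_fun setT (fun y => sup [set x | U (x, y)]).
Proof.
move=> oU UM; apply: (measurability _ (RGenOInfty.measurableE R)) => _ [_ [c ->] <-].
rewrite setTI.
have mE : measurable [set y | exists2 x, c < x & U (x, y)].
  apply: open_measurable; rewrite openE => y /= [x cx Uxy].
  have Ux : nbhs y [set y' | U (x, y')].
    by apply: (@continuous_pair2 x y); exact: open_nbhs_nbhs.
  by apply: filterS Ux => y' /= ?; exists x.
have mN : measurable [set y | exists x, U (x, y)].
  apply: open_measurable; rewrite openE => y /= [x Uxy].
  have Ux : nbhs y [set y' | U (x, y')].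
    by apply: (@continuous_pair2 x y); exact: open_nbhs_nbhs.
  by apply: filterS Ux => y' /= ?; exists x.
(* The second set accounts for the empty slices, whose [sup] is 0 and therefore exceeds [c] exactly
   when [c < 0]. *)
have -> : (fun y => sup [set x | U (x, y)]) @^-1` `]c, +oo[ =
    [set y | exists2 x, c < x & U (x, y)] `|`
    (if c < 0 then ~` [set y | exists x, U (x, y)] else set0).
  apply/seteqP; split => y /=; rewrite in_itv/= andbT.
    have [ne cy|/set0P/negP/negPn/eqP E] := pselect ([set x | U (x, y)] !=set0).
      left; have [x Ux cx] : exists2 x, [set x | U (x, y)] x & c < x.
        apply: contrapT => h; move: cy; rewrite ltNge => /negP; apply.
        apply: ge_sup => // x Ux; rewrite leNgt; apply/negP => cx.
        by apply: h; exists x.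
      by exists x.
    rewrite E sup0 => c0; right; rewrite c0 => -[x Ux].
    by have : [set x | U (x, y)] x by []; rewrite E.
  move=> [[x cx Ux]|].
    apply: (lt_le_trans cx); apply: ub_le_sup => //.
    by exists M => u /UM; apply: le_trans; exact: ler_norm.
  case: ifP => // c0 h.
  suff -> : [set x | U (x, y)] = set0 by rewrite sup0.
  by apply/seteqP; split => // x Ux; apply: h; exists x.
by apply: measurableU => //; case: ifP => // _; exact: measurableC.
Qed.

Lemma measurable_inf_slice (U : set (R * R)) (M : R) : open U ->
  (forall z, U z -> `|z.1| <= M) ->
  measurable_fun setT (fun y => inf [set x | U (x, y)]).
Proof.
move=> oU UM.
have -> : (fun y => inf [set x | U (x, y)]) =
    (fun y => - sup [set x | [set z : R * R | U (- z.1, z.2)] (x, y)]).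
  apply/funext => y; rewrite /inf; congr (- sup _).
  by apply/seteqP; split => x /= => [[u Uu <-]|Ux]; [rewrite opprK|exists (- x); rewrite ?opprK].
apply: measurableT_comp => //; apply: (@measurable_sup_slice _ M).
  have -> : [set z : R * R | U (- z.1, z.2)] = (fun z : R * R => (- z.1, z.2)) @^-1` U by [].
  apply: open_comp => // z _.
  exact: (cvg_pair (cvgN cvg_fst) cvg_snd).
by move=> z /= /UM; rewrite normrN.
Qed.

(* [inf] and [sup] of the empty set are both 0, so the bound is trivial there. *)
Lemma integral_derivative_le (I : set R) (g g' : R -> R) : open I ->
  is_interval I -> has_lbound I -> has_ubound I ->
  (forall x : R, is_derive x 1 g (g' x)) -> continuous g' ->
  (`|\int[mu]_(x in I) (g' x)%:E| <= (`|g (inf I)| + `|g (sup I)|)%:E)%E.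
Proof.
move=> oI iI lI uI dg cg.
have cG : continuous g.
  move=> x; apply/differentiable_continuous/derivable1_diffP.
  by have [] := dg x.
have E : I = `]inf I, sup I[%classic.
  rewrite -[LHS](_ : I° = I); last exact/interior_id.
  by rewrite interval_bounded_interior.
have [ab|ba] := ltP (inf I) (sup I); last first.
  rewrite E set_itv_ge ?bnd_simp -?leNgt// integral_set0 abse0 lee_fin.
  by rewrite addr_ge0.
rewrite {1}E -(@integral_itv_bndoo _ _ _ _ true false); last first.
  apply/measurable_EFinP; apply: measurable_funTS; exact: continuous_measurable_fun.
rewrite (@continuous_FTC2 R g' g)//.
- rewrite -EFinB abse_EFin lee_fin (le_trans (ler_normB _ _))//.
  by rewrite addrC.
- exact: continuous_subspaceT.
- split.
  + by move=> x _; have [] := dg x.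
  + by apply: cvg_at_right_filter; exact: cG.
  + by apply: cvg_at_left_filter; exact: cG.
- by move=> x _; rewrite derive1E; have [] := dg x.
Qed.

End PlaneTopology.

(** * Integrating one partial derivative over a convex set, slice by slice *)

Section SliceGreen.
Variable R : realType.
Local Notation mu := (@lebesgue_measure R).
Local Notation mu2 := (@leb2 R).
Variables (Om : set (R * R)) (M : R).
Hypothesis oOm : open Om.
Hypothesis convOm : forall (z w : R * R) (t : R), Om z -> Om w -> 0 < t < 1 ->
  Om ((1 - t) *: z + t *: w).
Hypothesis bOm : forall z, Om z -> `|z.1| <= M /\ `|z.2| <= M.

Definition hslice (y : R) : set R := [set x | Om (x, y)].
Definition vslice (x : R) : set R := [set y | Om (x, y)].

(** The curves are defined for every [t]. Over an empty slice [inf] and [sup] are 0, so the end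
    point falls on a coordinate axis; this only adds nonnegative terms to the upper bounds below. *)
Definition left_end (t : R) : R * R := (inf (hslice t), t).
Definition right_end (t : R) : R * R := (sup (hslice t), t).
Definition bottom_end (t : R) : R * R := (t, inf (vslice t)).
Definition top_end (t : R) : R * R := (t, sup (vslice t)).

Lemma convex_between (a b u : R) : a < u < b ->
  exists2 t, 0 < t < 1 & (1 - t) * a + t * b = u.
Proof.
move=> /andP[au ub]; have ab : 0 < b - a by rewrite subr_gt0 (lt_trans au).
exists ((u - a) / (b - a)).
  apply/andP; split; first by rewrite divr_gt0// subr_gt0.
  by rewrite ltr_pdivrMr// mul1r ltrD2r.
by field; rewrite gt_eqF.
Qed.

Lemma is_interval_hslice y : is_interval (hslice y).
Proof.
move=> a b Ha Hb u /andP[]; rewrite le_eqVlt => /predU1P[<-//|au].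
rewrite le_eqVlt => /predU1P[->//|ub].
have [|t t01 tE] := @convex_between a b u; first by rewrite au.
have := convOm Ha Hb t01; rewrite /hslice/=.
suff -> : (1 - t) *: (a, y) + t *: (b, y) = (u, y) by [].
by congr (_, _) => //=; rewrite /GRing.scale/=; ring.
Qed.

Lemma is_interval_vslice x : is_interval (vslice x).
Proof.
move=> a b Ha Hb u /andP[]; rewrite le_eqVlt => /predU1P[<-//|au].
rewrite le_eqVlt => /predU1P[->//|ub].
have [|t t01 tE] := @convex_between a b u; first by rewrite au.
have := convOm Ha Hb t01; rewrite /vslice/=.
suff -> : (1 - t) *: (x, a) + t *: (x, b) = (x, u) by [].
by congr (_, _) => //=; rewrite /GRing.scale/=; ring.
Qed.

Lemma open_hslice y : open (hslice y).
Proof. by apply: (@open_comp _ _ (fun x => (x, y)) Om) => // x _; exact: continuous_pair1. Qed.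

Lemma open_vslice x : open (vslice x).
Proof. by apply: (@open_comp _ _ (fun y => (x, y)) Om) => // y _; exact: continuous_pair2. Qed.

Lemma has_lbound_hslice y : has_lbound (hslice y).
Proof. by exists (- M) => x /bOm[/= + _]; rewrite ler_norml => /andP[]. Qed.
Lemma has_ubound_hslice y : has_ubound (hslice y).
Proof. by exists M => x /bOm[/= + _]; rewrite ler_norml => /andP[]. Qed.
Lemma has_lbound_vslice x : has_lbound (vslice x).
Proof. by exists (- M) => y /bOm[/= _]; rewrite ler_norml => /andP[]. Qed.
Lemma has_ubound_vslice x : has_ubound (vslice x).
Proof. by exists M => y /bOm[/= _]; rewrite ler_norml => /andP[]. Qed.

Let swap_Om : set (R * R) := [set z | Om (z.2, z.1)].

Let open_swap : open swap_Om.
Proof.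
have -> : swap_Om = (fun z : R * R => (z.2, z.1)) @^-1` Om by [].
by apply: open_comp => // z _; exact: (cvg_pair cvg_snd cvg_fst).
Qed.

Lemma measurable_left_end : measurable_fun setT left_end.
Proof.
apply: measurable_fun_pair; last exact: measurable_id.
by apply: (@measurable_inf_slice R Om M) => // z /bOm[].
Qed.

Lemma measurable_right_end : measurable_fun setT right_end.
Proof.
apply: measurable_fun_pair; last exact: measurable_id.
by apply: (@measurable_sup_slice R Om M) => // z /bOm[].
Qed.

Lemma measurable_bottom_end : measurable_fun setT bottom_end.
Proof.
apply: measurable_fun_pair; first exact: measurable_id.
by apply: (@measurable_inf_slice R swap_Om M) => // z /bOm[].
Qed.

Lemma measurable_top_end : measurable_fun setT top_end.
Proof.
apply: measurable_fun_pair; first exact: measurable_id.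
by apply: (@measurable_sup_slice R swap_Om M) => // z /bOm[].
Qed.

Lemma measurable_Om : measurable Om. Proof. exact: open_measurable_plane. Qed.

Lemma Om_finite_measure : (mu2 Om < +oo)%E.
Proof.
apply: (@le_lt_trans _ _ (mu2 (`[(- M)%R, M]%classic `*` `[(- M)%R, M]%classic))).
  apply: le_measure; rewrite ?inE//; first exact: measurable_Om.
    by apply: measurableX; exact: measurable_itv.
  by move=> z /bOm[z1 z2]; split; rewrite /= in_itv/= -ler_norml.
rewrite /leb2 product_measure1E; [|exact: measurable_itv|exact: measurable_itv].
have L : (mu `[(- M)%R, M]%classic < +oo)%E.
  by rewrite lebesgue_measure_itv/=; case: ifP => _; rewrite ?ltry// -EFinB ltry.
by apply: lte_mul_pinfty => //; rewrite ge0_fin_numE.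
Qed.

Lemma continuous_integrable_Om (f : R * R -> R) : continuous f ->
  mu2.-integrable Om (EFin \o f).
Proof.
move=> cf; have [B B0 fB] := continuous_bounded_box M cf.
apply: measurable_bounded_integrable.
- exact: measurable_Om.
- exact: Om_finite_measure.
- by apply: measurable_funTS; exact: continuous_measurable_plane.
- exists B; split; first exact: num_real.
  move=> x Bx z /bOm[z1 z2]; rewrite /= (le_trans _ (ltW Bx))// fB//.
Qed.

(** Fubini, then the fundamental theorem of calculus on each horizontal slice. By convexity a slice
    is an interval, so it contributes only its two end points, and slices at height outside [-M, M]
    are empty. *)
Lemma integral_dx_le (f fx : R * R -> R) : continuous f -> continuous fx ->
  (forall x y : R, is_derive x 1 (fun s => f (s, y)) (fx (x, y))) ->
  (`|\int[mu2]_(z in Om) (fx z)%:E| <=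
   \int[mu]_(t in `[(- M)%R, M]) (`|f (left_end t)| + `|f (right_end t)|)%:E)%E.
Proof.
move=> cf cfx dfx.
have ifx : mu2.-integrable setT ((EFin \o fx) \_ Om).
  have mO : measurable (Om : set (measurableTypeR R * measurableTypeR R)).
    exact: measurable_Om.
  apply: (integrable_mkcond _ mO).1; exact: continuous_integrable_Om.
have mf := continuous_measurable_plane cf.
rewrite integral_mkcond -integral21_prod_meas1//.
have secE y : (fubini_G mu ((EFin \o fx) \_ Om) y =
    \int[mu]_(x in hslice y) (fx (x, y))%:E)%E.
  rewrite [RHS]integral_mkcond; apply: eq_integral => x _; rewrite !patchE.
  by have -> : ((x, y) \in Om) = (x \in hslice y) by apply/idP/idP; rewrite !inE.
have mG := @measurable_fubini_G _ _ _ _ _ mu mu _ ifx.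
apply: (le_trans (le_abse_integral _ measurableT mG)).
rewrite [leRHS]integral_mkcond; apply: ge0_le_integral => //.
- by apply: measurableT_comp.
- apply/(measurable_restrictT _ _).1; first exact: measurable_itv.
  apply/measurable_EFinP/measurable_funTS; apply: measurable_funD.
    apply: measurableT_comp; first exact: normr_measurable.
    exact: (measurableT_comp mf measurable_left_end).
  apply: measurableT_comp; first exact: normr_measurable.
  exact: (measurableT_comp mf measurable_right_end).
move=> y _; rewrite [leLHS](_ : _ = (`|\int[mu]_(x in hslice y) (fx (x, y))%:E|)%E);
  last by congr abse; exact: secE.
rewrite patchE; case: ifPn => [_|yM].
  apply: (@integral_derivative_le _ _ (fun s => f (s, y)) (fun s => fx (s, y))).
  - exact: open_hslice.
  - exact: is_interval_hslice.
  - exact: has_lbound_hslice.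
  - exact: has_ubound_hslice.
  - by move=> x; apply: (@continuous_comp _ _ _ (fun s => (s, y))); [exact: continuous_pair1|exact: cfx].
have -> : hslice y = set0.
  apply/seteqP; split => // x /bOm[/= _ yM']; move: yM.
  by rewrite notin_setE; apply; rewrite /= in_itv/= -ler_norml.
by rewrite integral_set0 abse0.
Qed.

Lemma integral_dy_le (f fy : R * R -> R) : continuous f -> continuous fy ->
  (forall x y : R, is_derive y 1 (fun s => f (x, s)) (fy (x, y))) ->
  (`|\int[mu2]_(z in Om) (fy z)%:E| <=
   \int[mu]_(t in `[(- M)%R, M]) (`|f (bottom_end t)| + `|f (top_end t)|)%:E)%E.
Proof.
move=> cf cfy dfy.
have ify : mu2.-integrable setT ((EFin \o fy) \_ Om).
  have mO : measurable (Om : set (measurableTypeR R * measurableTypeR R)).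
    exact: measurable_Om.
  apply: (integrable_mkcond _ mO).1; exact: continuous_integrable_Om.
have mf := continuous_measurable_plane cf.
rewrite integral_mkcond -integral12_prod_meas1//.
have secE x : (fubini_F mu ((EFin \o fy) \_ Om) x =
    \int[mu]_(y in vslice x) (fy (x, y))%:E)%E.
  rewrite [RHS]integral_mkcond; apply: eq_integral => y _; rewrite !patchE.
  by have -> : ((x, y) \in Om) = (y \in vslice x) by apply/idP/idP; rewrite !inE.
have mF := @measurable_fubini_F _ _ _ _ _ mu mu _ ify.
apply: (le_trans (le_abse_integral _ measurableT mF)).
rewrite [leRHS]integral_mkcond; apply: ge0_le_integral => //.
- by apply: measurableT_comp.
- apply/(measurable_restrictT _ _).1; first exact: measurable_itv.
  apply/measurable_EFinP/measurable_funTS; apply: measurable_funD.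
    apply: measurableT_comp; first exact: normr_measurable.
    exact: (measurableT_comp mf measurable_bottom_end).
  apply: measurableT_comp; first exact: normr_measurable.
  exact: (measurableT_comp mf measurable_top_end).
move=> x _; rewrite [leLHS](_ : _ = (`|\int[mu]_(y in vslice x) (fy (x, y))%:E|)%E);
  last by congr abse; exact: secE.
rewrite patchE; case: ifPn => [_|xM].
  apply: (@integral_derivative_le _ _ (fun s => f (x, s)) (fun s => fy (x, s))).
  - exact: open_vslice.
  - exact: is_interval_vslice.
  - exact: has_lbound_vslice.
  - exact: has_ubound_vslice.
  - by move=> y; apply: (@continuous_comp _ _ _ (fun s => (x, s))); [exact: continuous_pair2|exact: cfy].
have -> : vslice x = set0.
  apply/seteqP; split => // y /bOm[/= xM' _]; move: xM.
  by rewrite notin_setE; apply; rewrite /= in_itv/= -ler_norml.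
by rewrite integral_set0 abse0.
Qed.

End SliceGreen.

(** * Complex calculus and Green's formula *)

Section ComplexModulus.
Variable R : realType.
Implicit Types x y : R[i].
Local Notation Re := complex.Re.
Local Notation Im := complex.Im.

Lemma cabsE x : cabs x = ComplexField.Normc.normc x. Proof. by case: x. Qed.

Lemma cabs_ge0 x : 0 <= cabs x. Proof. exact: sqrtr_ge0. Qed.

Lemma cabsM x y : cabs (x * y) = cabs x * cabs y.
Proof. by rewrite !cabsE ComplexField.Normc.normcM. Qed.

Lemma cabsV x : cabs x^-1 = (cabs x)^-1.
Proof. by rewrite !cabsE ComplexField.Normc.normcV. Qed.

Lemma cabsD x y : cabs (x + y) <= cabs x + cabs y.
Proof. by rewrite !cabsE le_normcD. Qed.

Lemma cabsN x : cabs (- x) = cabs x.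
Proof. by rewrite !cabsE normcN. Qed.

Lemma cabsB x y : cabs (x - y) <= cabs x + cabs y.
Proof. by rewrite -(cabsN y) cabsD. Qed.

Lemma cabs_conj x : cabs (conjc x) = cabs x.
Proof. by case: x => a b; rewrite /cabs/= sqrrN. Qed.

Lemma cabs_real (r : R) : cabs r%:C%C = `|r|.
Proof. by rewrite /cabs/= expr0n/= addr0 sqrtr_sqr. Qed.

Lemma Re_le_cabs x : `|Re x| <= cabs x.
Proof. by rewrite -sqrtr_sqr ler_wsqrtr// lerDl sqr_ge0. Qed.

Lemma Im_le_cabs x : `|Im x| <= cabs x.
Proof. by rewrite -sqrtr_sqr ler_wsqrtr// lerDr sqr_ge0. Qed.

Lemma cabs_le_ReIm x : cabs x <= `|Re x| + `|Im x|.
Proof.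
rewrite -[leRHS]ger0_norm ?addr_ge0// -sqrtr_sqr ler_wsqrtr//.
by rewrite sqrrD !real_normK ?num_real// lerD2r lerDl mulrn_wge0 ?mulr_ge0.
Qed.

Lemma ReM x y : Re (x * y) = Re x * Re y - Im x * Im y.
Proof. by case: x => a b; case: y => c d. Qed.

Lemma ImM x y : Im (x * y) = Re x * Im y + Im x * Re y.
Proof. by case: x => a b; case: y => c d. Qed.

Lemma ReD x y : Re (x + y) = Re x + Re y.
Proof. by case: x => a b; case: y => c d. Qed.

Lemma ImD x y : Im (x + y) = Im x + Im y.
Proof. by case: x => a b; case: y => c d. Qed.

Lemma ReN x : Re (- x) = - Re x. Proof. by case: x. Qed.
Lemma ImN x : Im (- x) = - Im x. Proof. by case: x. Qed.

Lemma ReV x : Re x^-1 = Re x * (Re x ^+ 2 + Im x ^+ 2)^-1. Proof. by case: x. Qed.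
Lemma ImV x : Im x^-1 = - Im x * (Re x ^+ 2 + Im x ^+ 2)^-1.
Proof. by case: x => a b; rewrite mulNr. Qed.

Lemma cabs_toCB (z w : R * R) : cabs (toC z - toC w) = dist z w.
Proof. by []. Qed.

Lemma conjc_toCB (z w : R * R) : conjc (toC z - toC w) = conjc (toC z) - conjc (toC w).
Proof. by rewrite rmorphB. Qed.

Lemma cabs_eq0 x : (cabs x == 0) = (x == 0).
Proof.
case: x => a b; rewrite /cabs/= sqrtr_eq0 eq_complex/=.
rewrite le_eqVlt ltNge addr_ge0 ?sqr_ge0//= orbF paddr_eq0 ?sqr_ge0//.
by rewrite !sqrf_eq0.
Qed.

Lemma dist_triangle (a b c : R * R) : dist a c <= dist a b + dist b c.
Proof. by rewrite -!cabs_toCB (le_trans _ (cabsD _ _))// addrA subrK. Qed.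

Lemma cabs_cexp_opp x : cabs (cexp (- x + conjc x)) = 1.
Proof.
case: x => a b; rewrite /cabs /cexp /= addNr expR0 !mul1r.
by rewrite cos2Dsin2 sqrtr1.
Qed.

End ComplexModulus.

(** * Calculus of the d-bar operator *)

Section Wirtinger.
Variable R : realType.
Local Notation Re := complex.Re.
Local Notation Im := complex.Im.

(** The partial derivatives are carried as data, so that the product, inverse and chain rules yield
    the explicit formulas that Green's formula and its error terms require. *)
Definition C1 (f fx fy : R * R -> R) : Prop :=
  [/\ continuous f, continuous fx, continuous fy,
      (forall x y : R, is_derive x 1 (fun s => f (s, y)) (fx (x, y))) &
      (forall x y : R, is_derive y 1 (fun s => f (x, s)) (fy (x, y)))].

Lemma C1_eq (f fx fy f' fx' fy' : R * R -> R) : C1 f fx fy ->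
  f =1 f' -> fx =1 fx' -> fy =1 fy' -> C1 f' fx' fy'.
Proof. by move=> h /funext <- /funext <- /funext <-. Qed.

Lemma C1cst (c : R) : C1 (fun=> c) (fun=> 0) (fun=> 0).
Proof. by split; try (move=> x y; exact: is_derive_cst); move=> x; exact: cvg_cst. Qed.

Lemma C1fst : C1 (fun z => z.1) (fun=> 1) (fun=> 0).
Proof.
split.
- by move=> z; exact: cvg_fst.
- by move=> z; exact: cvg_cst.
- by move=> z; exact: cvg_cst.
- by move=> x y; exact: is_derive_id.
- by move=> x y; exact: is_derive_cst.
Qed.

Lemma C1snd : C1 (fun z => z.2) (fun=> 0) (fun=> 1).
Proof.
split.
- by move=> z; exact: cvg_snd.
- by move=> z; exact: cvg_cst.
- by move=> z; exact: cvg_cst.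
- by move=> x y; exact: is_derive_cst.
- by move=> x y; exact: is_derive_id.
Qed.

Lemma C1D (f fx fy g gx gy : R * R -> R) : C1 f fx fy -> C1 g gx gy ->
  C1 (fun z => f z + g z) (fun z => fx z + gx z) (fun z => fy z + gy z).
Proof.
move=> [cf cfx cfy dfx dfy] [cg cgx cgy dgx dgy]; split.
- by move=> z; apply: cvgD; [exact: cf|exact: cg].
- by move=> z; apply: cvgD; [exact: cfx|exact: cgx].
- by move=> z; apply: cvgD; [exact: cfy|exact: cgy].
- by move=> x y; exact: is_deriveD.
- by move=> x y; exact: is_deriveD.
Qed.

Lemma C1M (f fx fy g gx gy : R * R -> R) : C1 f fx fy -> C1 g gx gy ->
  C1 (fun z => f z * g z) (fun z => fx z * g z + f z * gx z)
     (fun z => fy z * g z + f z * gy z).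
Proof.
move=> [cf cfx cfy dfx dfy] [cg cgx cgy dgx dgy]; split.
- by move=> z; apply: cvgM; [exact: cf|exact: cg].
- move=> z; apply: cvgD; apply: cvgM;
    by [exact: cf|exact: cg|exact: cfx|exact: cgx].
- move=> z; apply: cvgD; apply: cvgM;
    by [exact: cf|exact: cg|exact: cfy|exact: cgy].
- move=> x y; have := is_deriveM (dfx x y) (dgx x y).
  by rewrite /GRing.scale/= addrC [g _ * _]mulrC.
- move=> x y; have := is_deriveM (dfy x y) (dgy x y).
  by rewrite /GRing.scale/= addrC [g _ * _]mulrC.
Qed.

Lemma C1N (f fx fy : R * R -> R) : C1 f fx fy ->
  C1 (fun z => - f z) (fun z => - fx z) (fun z => - fy z).
Proof.
move=> h; apply: (C1_eq (C1M (C1cst (-1)) h)) => z.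
- by rewrite mulN1r.
- by rewrite mul0r add0r mulN1r.
- by rewrite mul0r add0r mulN1r.
Qed.

Lemma C1V (f fx fy : R * R -> R) : C1 f fx fy -> (forall z, f z != 0) ->
  C1 (fun z => (f z)^-1) (fun z => - fx z * (f z)^-1 ^+ 2) (fun z => - fy z * (f z)^-1 ^+ 2).
Proof.
move=> [cf cfx cfy dfx dfy] f0.
have cV : continuous (fun z => (f z)^-1).
  by move=> z; apply: cvgV; [exact: f0|exact: cf].
split => //.
- move=> z; apply: cvgM; first by apply: cvgN; exact: cfx.
  by apply: cvgM; exact: cV.
- move=> z; apply: cvgM; first by apply: cvgN; exact: cfy.
  by apply: cvgM; exact: cV.
- move=> x y; have := is_deriveV (f := fun s => f (s, y)) (f0 (x, y)) (dfx x y).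
  by rewrite /GRing.scale/= mulNr mulrC -exprVn mulNr.
- move=> x y; have := is_deriveV (f := fun s => f (x, s)) (f0 (x, y)) (dfy x y).
  by rewrite /GRing.scale/= mulNr mulrC -exprVn mulNr.
Qed.

Lemma C1comp (phi dphi : R -> R) (f fx fy : R * R -> R) :
  (forall x : R, is_derive x 1 phi (dphi x)) -> continuous phi -> continuous dphi ->
  C1 f fx fy ->
  C1 (fun z => phi (f z)) (fun z => fx z * dphi (f z)) (fun z => fy z * dphi (f z)).
Proof.
move=> dp cp cdp [cf cfx cfy dfx dfy].
have c1 : continuous (fun z => dphi (f z)).
  by move=> z; apply: continuous_comp; [exact: cf|exact: cdp].
split.
- by move=> z; apply: continuous_comp; [exact: cf|exact: cp].
- by move=> z; apply: cvgM; [exact: cfx|exact: c1].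
- by move=> z; apply: cvgM; [exact: cfy|exact: c1].
- move=> x y; have h := dp (f (x, y)); have h2 := dfx x y.
  by have := @is_derive1_comp _ phi (fun s => f (s, y)) _ _ _ h h2; rewrite mulrC.
- move=> x y; have h := dp (f (x, y)); have h2 := dfy x y.
  by have := @is_derive1_comp _ phi (fun s => f (x, s)) _ _ _ h h2; rewrite mulrC.
Qed.

(* [dbar f h] means that f is C^1 with (d/dx + i d/dy) f = h, i.e. h is twice the
   Wirtinger derivative of f with respect to the conjugate variable. *)
Definition dbar (f h : R * R -> R[i]) : Prop :=
  exists ax ay bx b_y, [/\ C1 (fun z => Re (f z)) ax ay, C1 (fun z => Im (f z)) bx b_y &
    forall z, h z = (ax z - b_y z) +i* (bx z + ay z)]%C.

Lemma dbar_eq (f h h' : R * R -> R[i]) : dbar f h -> h =1 h' -> dbar f h'.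
Proof. by move=> hf /funext <-. Qed.

Lemma dbarM (f h g l : R * R -> R[i]) : dbar f h -> dbar g l ->
  dbar (fun z => f z * g z) (fun z => h z * g z + f z * l z).
Proof.
move=> [ax [ay [bx [b_y [Ca Cb hE]]]]] [cx [cy [dx [dy [Cc Cd lE]]]]].
have CRe := C1D (C1M Ca Cc) (C1N (C1M Cb Cd)).
have CIm := C1D (C1M Ca Cd) (C1M Cb Cc).
do 4!eexists; split.
- by apply: (C1_eq CRe) => // z; rewrite ReM.
- by apply: (C1_eq CIm) => // z; rewrite ImM.
move=> z; rewrite hE lE; case: (f z) => a b; case: (g z) => c d /=.
by apply/eqP; rewrite eq_complex /=; apply/andP; split; apply/eqP; ring.
Qed.

Lemma dbar_real (f fx fy : R * R -> R) : C1 f fx fy ->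
  dbar (fun z => (f z)%:C%C) (fun z => fx z +i* fy z)%C.
Proof.
move=> h; exists fx, fy, (fun=> 0), (fun=> 0); split => //; first exact: C1cst.
by move=> z; rewrite subr0 add0r.
Qed.

Lemma C1_coord1B (c : R) : C1 (fun z => z.1 - c) (fun=> 1) (fun=> 0).
Proof. by apply: (C1_eq (C1D C1fst (C1cst (- c)))) => z //; rewrite addr0. Qed.

Lemma C1_coord2B (c : R) : C1 (fun z => z.2 - c) (fun=> 0) (fun=> 1).
Proof. by apply: (C1_eq (C1D C1snd (C1cst (- c)))) => z //; rewrite addr0. Qed.

Lemma dbar_toCB (w : R * R) : dbar (fun z => toC z - toC w) (fun=> 0).
Proof.
exists (fun=> 1), (fun=> 0), (fun=> 0), (fun=> 1); split.
- exact: C1_coord1B.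
- exact: C1_coord2B.
- by move=> z; rewrite subrr addr0.
Qed.

Lemma dbar_conj_toCB (w : R * R) : dbar (fun z => conjc (toC w - toC z)) (fun=> -2).
Proof.
exists (fun=> -1), (fun=> 0), (fun=> 0), (fun=> 1); split.
- by apply: (C1_eq (C1N (C1_coord1B w.1))) => z //=; rewrite ?oppr0// opprB.
- by apply: (C1_eq (C1_coord2B w.2)) => z //=; rewrite opprB.
- move=> z; apply/eqP; rewrite eq_complex/= !addr0 oppr0 eqxx andbT.
  by apply/eqP; ring.
Qed.

Lemma C1_sqr_dist (c : R * R) : C1 (fun z => dist z c ^+ 2)
  (fun z => 2 * (z.1 - c.1)) (fun z => 2 * (z.2 - c.2)).
Proof.
have h1 := C1_coord1B c.1; have h2 := C1_coord2B c.2.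
apply: (C1_eq (C1D (C1M h1 h1) (C1M h2 h2))) => z.
- by rewrite sqr_dist !expr2.
- by ring.
- by ring.
Qed.

Definition osc (k : R[i]) (z : R * R) : R[i] := cexp (- (k * toC z) + conjc (k * toC z)).

(** The factor e^{-ku} is holomorphic and is annihilated; e^{conj(ku)} yields conj k, doubled
    because [dbar] is twice the Wirtinger derivative. *)
Lemma dbar_osc (k : R[i]) : dbar (osc k) (fun z => 2%:R * conjc k * osc k z).
Proof.
(* The exponent is purely imaginary, equal to i times [th] with [th] = -2 Im(k z), so real cosine
   and sine suffice. *)
pose th (z : R * R) : R := -2 * (Im k * z.1 + Re k * z.2).
have Cth : C1 th (fun=> -2 * Im k) (fun=> -2 * Re k).
  apply: (C1_eq (C1M (C1cst (-2)) (C1D (C1M (C1cst (Im k)) C1fst)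
    (C1M (C1cst (Re k)) C1snd)))) => z //; ring.
have oscE z : osc k z = (cos (th z) +i* sin (th z))%C.
  rewrite /osc /cexp /th; case: k {th Cth} => a b /=; rewrite addNr expR0 !mul1r.
  by congr (cos _ +i* sin _)%C; ring.
have Cc := C1comp (@is_derive_cos R) (@continuous_cos R) _ Cth.
have Cs := C1comp (@is_derive_sin R) (@continuous_sin R) (@continuous_cos R) Cth.
exists (fun z => -2 * Im k * - sin (th z)), (fun z => -2 * Re k * - sin (th z)),
  (fun z => -2 * Im k * cos (th z)), (fun z => -2 * Re k * cos (th z)); split.
- apply: (C1_eq (Cc _)) => //; last by move=> z; rewrite oscE.
  by move=> x; apply: cvgN; exact: continuous_sin.
- by apply: (C1_eq Cs) => // z; rewrite oscE.
move=> z; rewrite oscE; case: k {Cth oscE Cc Cs} @th => a b th /=.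
by apply/eqP; rewrite eq_complex /=; apply/andP; split; apply/eqP; ring.
Qed.

End Wirtinger.

(** * Measurability and integrals of complex-valued functions *)

Section ComplexIntegrals.
Variable R : realType.
Local Notation mu := (@lebesgue_measure R).
Local Notation mu2 := (@leb2 R).
Local Notation Re := complex.Re.
Local Notation Im := complex.Im.

Definition cmeas d (T : measurableType d) (f : T -> R[i]) : Prop :=
  measurable_fun setT (fun x => Re (f x)) /\ measurable_fun setT (fun x => Im (f x)).

Section Measurability.
Context d (T : measurableType d).
Implicit Types f g : T -> R[i].

Lemma cmeasD f g : cmeas f -> cmeas g -> cmeas (fun x => f x + g x).
Proof.
move=> [f1 f2] [g1 g2]; split.
- by under eq_fun do rewrite ReD; exact: measurable_funD.
- by under eq_fun do rewrite ImD; exact: measurable_funD.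
Qed.

Lemma cmeasN f : cmeas f -> cmeas (fun x => - f x).
Proof.
move=> [f1 f2]; split.
- by under eq_fun do rewrite ReN; exact: measurableT_comp.
- by under eq_fun do rewrite ImN; exact: measurableT_comp.
Qed.

Lemma cmeasM f g : cmeas f -> cmeas g -> cmeas (fun x => f x * g x).
Proof.
move=> [f1 f2] [g1 g2]; split.
- under eq_fun do rewrite ReM.
  by apply: measurable_funB; exact: measurable_funM.
- under eq_fun do rewrite ImM.
  by apply: measurable_funD; exact: measurable_funM.
Qed.

Lemma cmeasV f : cmeas f -> cmeas (fun x => (f x)^-1).
Proof.
move=> [f1 f2].
have m : measurable_fun setT (fun x => (Re (f x) ^+ 2 + Im (f x) ^+ 2)^-1).
  apply: measurable_inv_ge0; first by move=> x; rewrite addr_ge0 ?sqr_ge0.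
  by apply: measurable_funD; exact: measurable_funX.
split.
- by under eq_fun do rewrite ReV; exact: measurable_funM.
- by under eq_fun do rewrite ImV; apply: measurable_funM => //; exact: measurableT_comp.
Qed.

Lemma cmeas_cst (c : R[i]) : cmeas (fun _ : T => c).
Proof. by split; exact: measurable_cst. Qed.

Lemma cmeas_conj f : cmeas f -> cmeas (fun x => conjc (f x)).
Proof.
move=> [f1 f2]; split.
- rewrite (_ : (fun _ => _) = (fun x => Re (f x)))//.
  by apply/funext => x; case: (f x).
- rewrite (_ : (fun _ => _) = (fun x => - Im (f x))); first exact: measurableT_comp.
  by apply/funext => x; case: (f x).
Qed.

Lemma cmeas_real (f : T -> R) : measurable_fun setT f -> cmeas (fun x => (f x)%:C%C).
Proof. by move=> mf; split => //; exact: measurable_cst. Qed.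

Lemma cmeas_toC (f : T -> R * R) : measurable_fun setT f -> cmeas (fun x => toC (f x)).
Proof. by move=> /measurable_fun_pairP[f1 f2]; split. Qed.

Lemma measurable_cabs f : cmeas f -> measurable_fun setT (fun x => cabs (f x)).
Proof.
move=> [f1 f2]; rewrite /cabs.
under eq_fun do rewrite -powR12_sqrt ?addr_ge0 ?sqr_ge0//.
by apply: measurable_powR_fun; apply: measurable_funD; exact: measurable_funX.
Qed.

Lemma cmeas_cexp f : cmeas f -> cmeas (fun x => cexp (f x)).
Proof.
move=> [f1 f2].
have me : measurable_fun setT (fun x => expR (Re (f x))).
  by apply: measurableT_comp => //; exact: measurable_expR.
split; apply: measurable_funM => //; apply: measurableT_comp => //;
  apply: continuous_measurable_fun.
- exact: continuous_cos.
- exact: continuous_sin.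
Qed.

Lemma cmeas_osc (k : R[i]) (f : T -> R * R) : measurable_fun setT f ->
  cmeas (fun x => osc k (f x)).
Proof.
move=> mf; apply: cmeas_cexp.
have mk : cmeas (fun x => k * toC (f x)).
  by apply: cmeasM; [exact: cmeas_cst|exact: cmeas_toC].
by apply: cmeasD; [exact: cmeasN|exact: cmeas_conj].
Qed.

End Measurability.

Definition cint (D : set (R * R)) (f : R * R -> R[i]) : Prop :=
  mu2.-integrable D (EFin \o (fun z => Re (f z))) /\
  mu2.-integrable D (EFin \o (fun z => Im (f z))).

Lemma cint_le (D : set (R * R)) (f : R * R -> R[i]) : measurable D -> cmeas f ->
  (\int[mu2]_(z in D) (cabs (f z))%:E < +oo)%E -> cint D f.
Proof.
move=> mD mf foo; have [f1 f2] := mf.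
have mc : measurable_fun D (fun z => (cabs (f z))%:E).
  by apply/measurable_EFinP; apply: measurable_funTS; exact: measurable_cabs.
split; apply/integrableP; split;
  try (by apply/measurable_EFinP; exact: measurable_funTS);
  apply: (le_lt_trans _ foo); apply: ge0_le_integral => //.
- by apply/measurable_EFinP; apply: measurableT_comp => //; exact: measurable_funTS.
- by move=> z _; rewrite lee_fin Re_le_cabs.
- by apply/measurable_EFinP; apply: measurableT_comp => //; exact: measurable_funTS.
- by move=> z _; rewrite lee_fin Im_le_cabs.
Qed.

Lemma abs_fine_le (x : \bar R) : ((`|fine x|)%:E <= `|x|)%E.
Proof. by case: x => [r||] /=; rewrite ?normr0 ?leey. Qed.

(** The factor 2 is the price of estimating real and imaginary parts separately. An infinite
    integral is covered too: [fine] sends it to 0. *)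
Lemma cintegral_le (D : set (R * R)) (f : R * R -> R[i]) : measurable D -> cmeas f ->
  ((cabs (cintegral D f))%:E <= 2%:E * \int[mu2]_(z in D) (cabs (f z))%:E)%E.
Proof.
move=> mD mf; have [f1 f2] := mf.
have mD' : measurable (D : set (measurableTypeR R * measurableTypeR R)) by [].
have mc : measurable_fun D (fun z => (cabs (f z))%:E).
  by apply/measurable_EFinP; apply: measurable_funTS; exact: measurable_cabs.
apply: (@le_trans _ _ (`|Rintegral mu2 D (fun w => Re (f w))| +
    `|Rintegral mu2 D (fun w => Im (f w))|)%:E).
  by rewrite lee_fin (le_trans (cabs_le_ReIm _)).
rewrite EFinD mule_natl mule2n; apply: leeD; apply: (le_trans (abs_fine_le _)).
- apply: (le_trans (le_abse_integral _ mD' _)).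
    by apply/measurable_EFinP; exact: measurable_funTS.
  apply: ge0_le_integral => //.
  + by apply/measurable_EFinP; apply: measurableT_comp => //; exact: measurable_funTS.
  + by move=> z _; rewrite lee_fin Re_le_cabs.
- apply: (le_trans (le_abse_integral _ mD' _)).
    by apply/measurable_EFinP; exact: measurable_funTS.
  apply: ge0_le_integral => //.
  + by apply/measurable_EFinP; apply: measurableT_comp => //; exact: measurable_funTS.
  + by move=> z _; rewrite lee_fin Im_le_cabs.
Qed.

Lemma cintegralD (D : set (R * R)) (f g : R * R -> R[i]) : measurable D ->
  cint D f -> cint D g ->
  cintegral D (fun z => f z + g z) = cintegral D f + cintegral D g.
Proof.
move=> mD [f1 f2] [g1 g2]; rewrite /cintegral.
under eq_Rintegral do rewrite ReD; rewrite RintegralD//.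
by under [X in (_ +i* X)%C]eq_Rintegral do rewrite ImD; rewrite RintegralD.
Qed.

Lemma cintegralZ (D : set (R * R)) (c : R[i]) (f : R * R -> R[i]) : measurable D ->
  cint D f -> cintegral D (fun z => c * f z) = c * cintegral D f.
Proof.
move=> mD [f1 f2]; rewrite /cintegral.
have mD' : measurable (D : set (measurableTypeR R * measurableTypeR R)) by [].
have iZ (r : R) (h : R * R -> R) : mu2.-integrable D (EFin \o h) ->
    mu2.-integrable D (EFin \o (fun z => r * h z)).
  by move=> ih; have := integrableZl mD' r ih.
under eq_Rintegral do rewrite ReM.
under [X in (_ +i* X)%C]eq_Rintegral do rewrite ImM.
rewrite RintegralB ?RintegralD ?RintegralZl//; try exact: iZ.
by case: c.
Qed.

Lemma dbar_continuous (f h : R * R -> R[i]) : dbar f h ->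
  continuous (fun z => Re (h z)) /\ continuous (fun z => Im (h z)).
Proof.
move=> [ax [ay [bx [b_y [[_ cax cay _ _] [_ cbx cby _ _] hE]]]]].
split.
- rewrite (_ : (fun _ => _) = (fun z => ax z - b_y z)); last by apply/funext => z; rewrite hE.
  by move=> z; apply: cvgB; [exact: cax|exact: cby].
- rewrite (_ : (fun _ => _) = (fun z => bx z + ay z)); last by apply/funext => z; rewrite hE.
  by move=> z; apply: cvgD; [exact: cbx|exact: cay].
Qed.

Lemma dbar_cmeas (f h : R * R -> R[i]) : dbar f h -> cmeas f /\ cmeas h.
Proof.
move=> dfh; have [ch1 ch2] := dbar_continuous dfh.
split; last by split; exact: continuous_measurable_plane.
have [ax [ay [bx [b_y [[ca _ _ _ _] [cb _ _ _ _] _]]]]] := dfh.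
by split; exact: continuous_measurable_plane.
Qed.

End ComplexIntegrals.

(** * Green's formula for d-bar *)

Section GreenKernel.
Variable R : realType.
Local Notation mu := (@lebesgue_measure R).
Local Notation mu2 := (@leb2 R).
Local Notation Re := complex.Re.
Local Notation Im := complex.Im.
Variables (Om : set (R * R)) (M : R).
Hypothesis oOm : open Om.
Hypothesis convOm : forall (z w : R * R) (t : R), Om z -> Om w -> 0 < t < 1 ->
  Om ((1 - t) *: z + t *: w).
Hypothesis bOm : forall z, Om z -> `|z.1| <= M /\ `|z.2| <= M.

Definition boundary_curves : seq (R -> R * R) :=
  [:: left_end Om; right_end Om; bottom_end Om; top_end Om].

(** A substitute for the arc-length integral: each curve is a graph, parametrized by the coordinate
    that slicing leaves free. *)
Definition bd_integral (phi : R * R -> R) : \bar R :=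
  (\sum_(c <- boundary_curves) \int[mu]_(t in `[(- M)%R, M]) (phi (c t))%:E)%E.

Lemma measurable_curve c : List.In c boundary_curves -> measurable_fun setT c.
Proof.
move=> [<-|[<-|[<-|[<-|[]]]]].
- exact: (measurable_left_end oOm bOm).
- exact: (measurable_right_end oOm bOm).
- exact: (measurable_bottom_end oOm bOm).
- exact: (measurable_top_end oOm bOm).
Qed.

Lemma bd_integral_ge0 phi : (forall z, 0 <= phi z) -> (0 <= bd_integral phi)%E.
Proof.
move=> phi0; apply: sume_ge0 => c _; apply: integral_ge0 => t _.
by rewrite lee_fin.
Qed.

Lemma curve_integral_le (c : R -> R * R) (phi psi : R * R -> R) :
  measurable_fun setT c -> measurable_fun setT phi -> measurable_fun setT psi ->
  (forall z, 0 <= phi z) -> (forall z, phi z <= psi z) ->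
  (\int[mu]_(t in `[(- M)%R, M]) (phi (c t))%:E <=
   \int[mu]_(t in `[(- M)%R, M]) (psi (c t))%:E)%E.
Proof.
move=> mc mphi mpsi phi0 le; apply: ge0_le_integral => //.
- by move=> t _; rewrite lee_fin.
- by apply/measurable_EFinP; apply: measurable_funTS; exact: (measurableT_comp mphi mc).
- by apply/measurable_EFinP; apply: measurable_funTS; exact: (measurableT_comp mpsi mc).
- by move=> t _; rewrite lee_fin.
Qed.

Lemma bd_integral_le (phi psi : R * R -> R) :
  measurable_fun setT phi -> measurable_fun setT psi ->
  (forall z, 0 <= phi z) -> (forall z, phi z <= psi z) ->
  (bd_integral phi <= bd_integral psi)%E.
Proof.
move=> mphi mpsi phi0 le; rewrite /bd_integral !big_cons !big_nil.
have h c : List.In c boundary_curves ->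
    (\int[mu]_(t in `[(- M)%R, M]) (phi (c t))%:E <=
     \int[mu]_(t in `[(- M)%R, M]) (psi (c t))%:E)%E.
  by move=> /measurable_curve mc; exact: curve_integral_le.
by repeat (apply: leeD; [apply: h => /=; tauto|]).
Qed.

Lemma curve_integralD (c1 c2 : R -> R * R) (a phi : R * R -> R) :
  List.In c1 boundary_curves -> List.In c2 boundary_curves ->
  measurable_fun setT a -> measurable_fun setT phi ->
  (forall z, `|a z| <= phi z) ->
  (\int[mu]_(t in `[(- M)%R, M]) (`|a (c1 t)| + `|a (c2 t)|)%:E <=
   \int[mu]_(t in `[(- M)%R, M]) (phi (c1 t))%:E +
   \int[mu]_(t in `[(- M)%R, M]) (phi (c2 t))%:E)%E.
Proof.
move=> /measurable_curve m1 /measurable_curve m2 ma mphi le.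
have mabs c : measurable_fun setT c ->
    measurable_fun `[(- M)%R, M] (fun t : R => (`|a (c t)|)%:E).
  move=> mc; apply/measurable_EFinP; apply: measurable_funTS; apply: measurableT_comp => //.
  exact: (measurableT_comp ma mc).
under eq_integral do rewrite EFinD.
rewrite ge0_integralD//; [|exact: mabs|exact: mabs].
have mabs' : measurable_fun setT (fun z => `|a z|) by exact: measurableT_comp.
by apply: leeD; apply: (@curve_integral_le _ (fun z => `|a z|)).
Qed.

(** Each of Re H and Im H is a combination of one x-derivative and one y-derivative of Re F or Im F.
    The x-derivatives are paid for on the left and right curves, the y-derivatives on the bottom and
    top ones, so each part costs one full [bd_integral]; hence the 2. *)
Lemma green_dbar (F H : R * R -> R[i]) : dbar F H ->
  ((cabs (cintegral Om H))%:E <= 2%:E * bd_integral (fun z => cabs (F z)))%E.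
Proof.
move=> dFH; have [mF _] := dbar_cmeas dFH.
have mphi := measurable_cabs mF; have [ma mb] := mF.
have [ax [ay [bx [b_y [Ca Cb HE]]]]] := dFH.
have [ca cax cay dax day] := Ca; have [cb cbx cby dbx dby] := Cb.
have mOm := measurable_Om oOm.
have iOm (f : R * R -> R) : continuous f -> mu2.-integrable Om (EFin \o f).
  exact: (continuous_integrable_Om oOm bOm).
apply: (@le_trans _ _ (`|Rintegral mu2 Om (fun w => Re (H w))| +
    `|Rintegral mu2 Om (fun w => Im (H w))|)%:E).
  by rewrite lee_fin (le_trans (cabs_le_ReIm _)).
have X (f fx : R * R -> R) : continuous f -> continuous fx ->
    (forall x y : R, is_derive x 1 (fun s => f (s, y)) (fx (x, y))) ->
    (forall z, `|f z| <= cabs (F z)) ->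
    ((`|Rintegral mu2 Om fx|)%:E <=
     \int[mu]_(t in `[(- M)%R, M]) (cabs (F (left_end Om t)))%:E +
     \int[mu]_(t in `[(- M)%R, M]) (cabs (F (right_end Om t)))%:E)%E.
  move=> cf cfx dfx le; apply: (le_trans (abs_fine_le _)).
  apply: (le_trans (integral_dx_le oOm convOm bOm cf cfx dfx)).
  apply: (@curve_integralD _ _ f (fun z => cabs (F z))) => //=; try tauto.
  exact: continuous_measurable_plane.
have Y (f fy : R * R -> R) : continuous f -> continuous fy ->
    (forall x y : R, is_derive y 1 (fun s => f (x, s)) (fy (x, y))) ->
    (forall z, `|f z| <= cabs (F z)) ->
    ((`|Rintegral mu2 Om fy|)%:E <=
     \int[mu]_(t in `[(- M)%R, M]) (cabs (F (bottom_end Om t)))%:E +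
     \int[mu]_(t in `[(- M)%R, M]) (cabs (F (top_end Om t)))%:E)%E.
  move=> cf cfy dfy le; apply: (le_trans (abs_fine_le _)).
  apply: (le_trans (integral_dy_le oOm convOm bOm cf cfy dfy)).
  apply: (@curve_integralD _ _ f (fun z => cabs (F z))) => //=; try tauto.
  exact: continuous_measurable_plane.
rewrite (_ : (fun w => Re (H w)) = (fun w => ax w - b_y w)); last first.
  by apply/funext => z; rewrite HE.
rewrite (_ : (fun w => Im (H w)) = (fun w => bx w + ay w)); last first.
  by apply/funext => z; rewrite HE.
rewrite RintegralB ?RintegralD//; try exact: iOm.
apply: (@le_trans _ _ ((`|Rintegral mu2 Om ax|)%:E + (`|Rintegral mu2 Om b_y|)%:E +
   ((`|Rintegral mu2 Om bx|)%:E + (`|Rintegral mu2 Om ay|)%:E))%E).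
  by rewrite -!EFinD lee_fin lerD ?ler_normB ?ler_normD.
rewrite mule_natl mule2n; apply: leeD.
  rewrite /bd_integral !big_cons big_nil adde0 addeA.
  apply: leeD; first exact: (X _ _ ca cax dax (fun z => Re_le_cabs _)).
  exact: (Y _ _ cb cby dby (fun z => Im_le_cabs _)).
rewrite /bd_integral !big_cons big_nil adde0 addeA.
apply: leeD; first exact: (X _ _ cb cbx dbx (fun z => Im_le_cabs _)).
exact: (Y _ _ ca cay day (fun z => Re_le_cabs _)).
Qed.

End GreenKernel.

(** * The oscillatory kernel *)

Section KernelBound.
Variable R : realType.
Local Notation mu := (@lebesgue_measure R).
Local Notation mu2 := (@leb2 R).
Local Notation Re := complex.Re.
Local Notation Im := complex.Im.

(** The two lines through [c] are null by the product formula. They contain the point [c] itself,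
    where the kernel estimates break down because [0^-1 = 0]. *)
Lemma ae_off_axes (c : R * R) (P : R * R -> Prop) :
  (forall z, z.1 != c.1 -> z.2 != c.2 -> P z) -> {ae mu2, forall z, P z}.
Proof.
move=> h.
pose N1 : set (measurableTypeR R * measurableTypeR R) := [set c.1] `*` setT.
pose N2 : set (measurableTypeR R * measurableTypeR R) := setT `*` [set c.2].
have m1 : measurable N1.
  by apply: measurableX; [exact: measurable_set1|exact: measurableT].
have m2 : measurable N2.
  by apply: measurableX; [exact: measurableT|exact: measurable_set1].
have e1 : mu2 N1 = 0.
  rewrite /leb2 product_measure1E; [|exact: measurable_set1|exact: measurableT].
  by rewrite [X in (X * _)%E](lebesgue_measure_set1 c.1) mul0e.
have e2 : mu2 N2 = 0.
  rewrite /leb2 product_measure1E; [|exact: measurableT|exact: measurable_set1].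
  by rewrite [X in (_ * X)%E](lebesgue_measure_set1 c.2) mule0.
exists (N1 `|` N2); split; first exact: measurableU.
  apply/eqP; rewrite -measure_le0; apply: (le_trans (measureU2 _ m1 m2)).
  by rewrite [X in (X + _)%E]e1 [X in (_ + X)%E]e2 adde0.
move=> z /= nP; apply: contrapT => /not_orP[z1 z2]; apply: nP; apply: h.
  by apply/eqP => e; apply: z1.
by apply/eqP => e; apply: z2.
Qed.

(** Shape of the error left by integration by parts: one term lives at the scale |z - w|, the other
    at the mollification scale 1 / |k|. The constant comes first so that it serves all k, z and
    w. *)
Lemma integral_two_scales : exists2 C : R, 0 <= C &
  forall (D : set (R * R)) (f : R * R -> R) (c : R * R) (d e A B : R), measurable D ->
    0 < d -> 0 < e -> 0 <= A -> 0 <= B -> measurable_fun setT f -> (forall z, 0 <= f z) ->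
    (forall z, z.1 != c.1 -> z.2 != c.2 ->
      f z <= A * ((dist z c)^-1 * (dist z c ^+ 2 + d ^+ 2)^-1) +
             B * ((dist z c)^-1 * (dist z c ^+ 2 + e ^+ 2)^-1)) ->
    (\int[mu2]_(z in D) (f z)%:E <= (C * (A / d + B / e))%:E)%E.
Proof.
have [C C0 hC] := @integral_scaled_kernel R; exists C => //.
move=> D f c d e A B mD d0 e0 A0 B0 mf f0 hf.
pose kr s (z : R * R) := (dist z c)^-1 * (dist z c ^+ 2 + s ^+ 2)^-1.
have kr0 s z : 0 <= kr s z by rewrite mulr_ge0 ?invr_ge0 ?dist_ge0 ?addr_ge0 ?sqr_ge0.
have mkr s : measurable_fun setT (kr s).
  have md : measurable_fun setT (fun z => dist z c).
    by apply: measurable_dist; [exact: measurable_id|exact: measurable_cst].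
  apply: measurable_funM; apply: measurable_inv_ge0 => //.
  + by move=> z; exact: dist_ge0.
  + by move=> z; rewrite addr_ge0 ?sqr_ge0.
  + by apply: measurable_funD; [exact: measurable_funX|exact: measurable_cst].
have Ef : measurable_fun setT (EFin \o f) by exact/measurable_EFinP.
have Ekr s : measurable_fun setT (fun z => (kr s z)%:E) by exact/measurable_EFinP.
have Ek s a : measurable_fun setT (fun z => (a * kr s z)%:E).
  by apply/measurable_EFinP; apply: measurable_funM => //; exact: measurable_cst.
apply: (@le_trans _ _ (\int[mu2]_z (f z)%:E)%E).
  by apply: ge0_subset_integral => // z _; rewrite lee_fin.
apply: (@le_trans _ _ (\int[mu2]_z ((A * kr d z)%:E + (B * kr e z)%:E))%E).
  apply: ae_ge0_le_integral => //.
  - by move=> z _; rewrite lee_fin.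
  - by move=> z _; rewrite -EFinD lee_fin addr_ge0// mulr_ge0.
  - by apply: emeasurable_funD; exact: Ek.
  by apply: (@ae_off_axes c) => z z1 z2 _; rewrite -EFinD lee_fin hf.
have iE s a : 0 < s -> 0 <= a -> (\int[mu2]_z (a * kr s z)%:E <= (a * (C / s))%:E)%E.
  move=> s0 a0; under eq_integral do rewrite EFinM.
  rewrite ge0_integralZl//; last 2 first.
  - exact: Ekr.
  - by move=> z _; rewrite lee_fin.
  by rewrite EFinM lee_wpmul2l// hC.
rewrite ge0_integralD//; last 4 first.
- by move=> z _; rewrite lee_fin mulr_ge0.
- exact: Ek.
- by move=> z _; rewrite lee_fin mulr_ge0.
- exact: Ek.
have -> : C * (A / d + B / e) = A * (C / d) + B * (C / e) by ring.
by rewrite EFinD; apply: leeD; exact: iE.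
Qed.

Variables (Om : set (R * R)) (M : R).
Hypothesis oOm : open Om.
Hypothesis convOm : forall (z w : R * R) (t : R), Om z -> Om w -> 0 < t < 1 ->
  Om ((1 - t) *: z + t *: w).
Hypothesis bOm : forall z, Om z -> `|z.1| <= M /\ `|z.2| <= M.

(* One half of the splitting
     1 / ((z - u) conj (u - w)) = (u - w) / (S (z - u)) - conj (u - z) / (S conj (u - w)),
   where S = |u - z|^2 + |u - w|^2: this half is singular only at [u = z]. *)
Definition half_weight (z w u : R * R) : R[i] :=
  (toC u - toC w) * ((dist u z ^+ 2 + dist u w ^+ 2)^-1)%:C%C.

Definition half_kernel (k : R[i]) (z w u : R * R) : R[i] :=
  osc k u * half_weight z w u * (toC z - toC u)^-1.

(** * Integration by parts against the mollified pole *)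

Section Regularized.
Variables (k : R[i]) (z w : R * R).
Hypothesis zw : z != w.
Hypothesis k0 : 0 < cabs k.

Let del : R := (cabs k)^-1.
Let d : R := dist z w.
Let S (u : R * R) : R := dist u z ^+ 2 + dist u w ^+ 2.
Let N (u : R * R) : R := dist u z ^+ 2 + del ^+ 2.

Let del0 : 0 < del. Proof. by rewrite invr_gt0. Qed.
Let d0 : 0 < d. Proof. exact: dist_gt0. Qed.

Let d_le u : d <= dist u z + dist u w.
Proof. by rewrite /d (distC u z) dist_triangle. Qed.

Let S_gt0 u : 0 < S u.
Proof.
have r0 := dist_ge0 u z; have s0 := dist_ge0 u w.
rewrite /S lt_def addr_ge0 ?sqr_ge0// andbT paddr_eq0 ?sqr_ge0// !sqrf_eq0.
apply/negP => /andP[/eqP r /eqP s]; move: (d_le u); rewrite r s addr0.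
by rewrite leNgt d0.
Qed.

Let N_gt0 u : 0 < N u. Proof. by rewrite /N ltr_wpDl ?sqr_ge0// exprn_gt0. Qed.

(* [pole] is 1 / (z - u) mollified at scale 1 / |k|, and [delta_tail] its derivative,
   an approximate delta mass at [z]. *)
Let pole (u : R * R) : R[i] := conjc (toC z - toC u) * ((N u)^-1)%:C%C.
Let delta_tail (u : R * R) : R[i] := (- 2 * del ^+ 2 * (N u)^-1 ^+ 2)%:C%C.

(** The product rule gives -2 / N + 2 |u - z|^2 / N^2, and |u - z|^2 = N - del^2 leaves -2 del^2 /
    N^2. *)
Let dbar_pole : dbar pole delta_tail.
Proof.
have CN := C1D (C1_sqr_dist z) (C1cst (del ^+ 2)).
have CV := C1V CN (fun u => lt0r_neq0 (N_gt0 u)).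
apply: (dbar_eq (dbarM (dbar_conj_toCB z) (dbar_real CV))) => u.
rewrite /delta_tail -/(N u).
have nN : (N u)^-1 * N u = 1 by rewrite mulVf// gt_eqF.
move: nN; set n := (N u)^-1; rewrite /N sqr_dist => nN.
apply/eqP; rewrite eq_complex /=; apply/andP; split; apply/eqP; last by ring.
apply/eqP; rewrite -subr_eq0; apply/eqP.
transitivity (-2 * n * (1 - n * ((u.1 - z.1) ^+ 2 + (u.2 - z.2) ^+ 2 + del ^+ 2))).
  by ring.
by rewrite nN subrr mulr0.
Qed.

Let dweight (u : R * R) : R[i] :=
  (toC u - toC w) * (- 2%:R * ((toC u - toC z) + (toC u - toC w)) * ((S u)^-1 ^+ 2)%:C%C).

(** The factor u - w is holomorphic, so only the denominator is differentiated, with d-bar S = 2 (u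
    - z) + 2 (u - w). *)
Let dbar_weight : dbar (half_weight z w) dweight.
Proof.
have CS := C1D (C1_sqr_dist z) (C1_sqr_dist w).
have CV := C1V CS (fun u => lt0r_neq0 (S_gt0 u)).
apply: (dbar_eq (dbarM (dbar_toCB w) (dbar_real CV))) => u.
rewrite /dweight -/(S u) mul0r add0r; congr (_ * _).
by apply/eqP; rewrite eq_complex /=; apply/andP; split; apply/eqP; ring.
Qed.

Let F (u : R * R) : R[i] := osc k u * half_weight z w u * pole u.
Let H (u : R * R) : R[i] :=
  (2%:R * conjc k * osc k u * half_weight z w u + osc k u * dweight u) * pole u +
  osc k u * half_weight z w u * delta_tail u.

Let dbar_F : dbar F H.
Proof. exact: (dbarM (dbarM (dbar_osc k) dbar_weight) dbar_pole). Qed.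

(** Divided by 2 conj k, the leading term of [H] is the half kernel with its pole mollified. What
    remains is the mollification error and the two terms in which d-bar falls on the weight or on
    the pole. *)
Let rem (u : R * R) : R[i] := half_kernel k z w u - (2%:R * conjc k)^-1 * H u.

Let cabs2k : cabs (2%:R * conjc k)^-1 = del / 2.
Proof.
rewrite cabsV cabsM cabs_conj invfM /del mulrC; congr (_ * _^-1).
have -> : (2%:R : R[i]) = (2 : R)%:C%C by rewrite rmorph_nat.
by rewrite cabs_real ger0_norm.
Qed.

Let cabs_osc u : cabs (osc k u) = 1. Proof. exact: cabs_cexp_opp. Qed.

Let cabs_weight u : cabs (half_weight z w u) = dist u w / S u.
Proof. by rewrite cabsM cabs_real ger0_norm ?invr_ge0 ?(ltW (S_gt0 _)). Qed.

Let weight_le u : cabs (half_weight z w u) <= 2 / d.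
Proof.
rewrite cabs_weight ler_pdivrMr ?S_gt0// mulrAC ler_pdivlMr//.
have := d_le u; have := dist_ge0 u z; have := dist_ge0 u w; rewrite /S.
move=> s0 r0 le; apply: (le_trans (ler_wpM2l s0 le)).
by have := sqr_ge0 (dist u z - dist u w); have := sqr_ge0 (dist u z); nra.
Qed.

Let weight_le_inv u : cabs (half_weight z w u) <= (dist w u)^-1.
Proof.
rewrite cabs_weight (distC w u); have [->|s0] := eqVneq (dist u w) 0.
  by rewrite mul0r invr0.
have s1 : 0 < dist u w by rewrite lt_def s0 dist_ge0.
rewrite ler_pdivrMr ?S_gt0// mulrC ler_pdivlMr// -expr2 /S lerDr sqr_ge0//.
Qed.

Let cabs_pole u : cabs (pole u) = dist u z / N u.
Proof.
rewrite cabsM cabs_real cabs_conj ger0_norm ?invr_ge0 ?(ltW (N_gt0 _))//.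
by rewrite cabs_toCB distC.
Qed.

Let pole_le u : cabs (pole u) <= (dist u z)^-1.
Proof.
rewrite cabs_pole; have [->|r0] := eqVneq (dist u z) 0; first by rewrite mul0r invr0.
have r1 : 0 < dist u z by rewrite lt_def r0 dist_ge0.
by rewrite ler_pdivrMr ?N_gt0// mulrC ler_pdivlMr// -expr2 /N lerDl sqr_ge0.
Qed.

Let cabs2 : cabs (- 2%:R : R[i]) = 2.
Proof.
rewrite cabsN (_ : (2%:R : R[i]) = (2 : R)%:C%C); last by rewrite rmorph_nat.
by rewrite cabs_real ger0_norm.
Qed.

(** With r = |u - z|, s = |u - w| and S = r^2 + s^2, both s times 2 |(u - z) + (u - w)| and r^2 +
    d^2 are at most 3 S, the latter because d <= r + s; 9 is the product of the two constants. *)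
Let dweight_le u : cabs (dweight u) <= 9 * (dist u z ^+ 2 + d ^+ 2)^-1.
Proof.
rewrite !cabsM cabs_real cabs2 ger0_norm ?sqr_ge0// cabs_toCB.
have Sp := S_gt0 u; have := d_le u; have := dist_ge0 u z; have := dist_ge0 u w.
have := cabsD (toC u - toC z) (toC u - toC w); rewrite !cabs_toCB.
set e := cabs _; have e0 : 0 <= e by exact: cabs_ge0.
move: Sp; rewrite /S; set r := dist u z; set s := dist u w => Sp er s0 r0 dr.
have D0 : 0 < r ^+ 2 + d ^+ 2 by rewrite ltr_wpDl ?sqr_ge0// exprn_gt0.
rewrite exprVn ler_pdivlMr// mulrA mulrAC ler_pdivrMr ?exprn_gt0//.
have h1 : s * (2 * e) <= 3 * (r ^+ 2 + s ^+ 2).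
  have := ler_wpM2l s0 er; have := sqr_ge0 (r - s); have := sqr_ge0 r; nra.
have h2 : r ^+ 2 + d ^+ 2 <= 3 * (r ^+ 2 + s ^+ 2).
  have : d ^+ 2 <= (r + s) ^+ 2 by rewrite ler_sqr ?nnegrE ?addr_ge0// ltW.
  have := sqr_ge0 (r - s); have := sqr_ge0 r; nra.
have -> : 9 * (r ^+ 2 + s ^+ 2) ^+ 2 = (3 * (r ^+ 2 + s ^+ 2)) * (3 * (r ^+ 2 + s ^+ 2)).
  by ring.
by rewrite ler_pM// ?mulr_ge0// ltW.
Qed.

(** The first term is the derivative falling on the weight. The second gathers the mollification
    error and the derivative of the pole, both concentrated at distance 1 / |k| from z. *)
Let rem_le u : u.1 != z.1 -> u.2 != z.2 -> cabs (rem u) <=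
  9 / 2 * del * ((dist u z)^-1 * (dist u z ^+ 2 + d ^+ 2)^-1) +
  4 * del ^+ 2 / d * ((dist u z)^-1 * (dist u z ^+ 2 + del ^+ 2)^-1).
Proof.
move=> uz _; have uz' : u != z by apply: contra uz => /eqP->.
have r0 : 0 < dist u z by exact: dist_gt0.
have Nn : (N u)^-1 * (dist u z ^+ 2 + del ^+ 2) = 1 by rewrite mulVf// gt_eqF// N_gt0.
pose tail : R[i] := (toC z - toC u)^-1 - pole u.
have zu0 : toC z - toC u != 0 by rewrite -cabs_eq0 cabs_toCB distC gt_eqF.
have k2 : 2%:R * conjc k != 0 :> R[i].
  by rewrite -invr_eq0 -cabs_eq0 cabs2k gt_eqF// divr_gt0.
have remE : rem u = osc k u * half_weight z w u * tail -
    (2%:R * conjc k)^-1 * (osc k u * dweight u * pole u) -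
    (2%:R * conjc k)^-1 * (osc k u * half_weight z w u * delta_tail u).
  have aux (a E g q p h t : R[i]) : a != 0 ->
      E * g * q - a^-1 * ((a * E * g + E * h) * p + E * g * t) =
      E * g * (q - p) - a^-1 * (E * h * p) - a^-1 * (E * g * t).
    by move=> a0; field.
  exact: aux k2.
(* The mollified pole is 1 / (z - u) times |u - z|^2 / N, so the error carries the complementary
   factor del^2 / N. *)
have tailE : cabs tail = (dist u z)^-1 * (del ^+ 2 * (N u)^-1).
  have -> : tail = (toC z - toC u)^-1 * (del ^+ 2 * (N u)^-1)%:C%C.
    have -> : del ^+ 2 * (N u)^-1 = 1 - dist u z ^+ 2 * (N u)^-1.
      by rewrite -Nn; ring.
    rewrite rmorphB mulrBr mulr1 /tail; congr (_ - _).
    rewrite /pole rmorphM mulrA; congr (_ * _).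
    apply: (mulfI zu0); rewrite mulrA mulfV// mul1r.
    have -> : dist u z = dist z u by exact: distC.
    rewrite sqr_dist; case: (z) => a b; case: (u) => a' b'.
    by apply/eqP; rewrite eq_complex /=; apply/andP; split; apply/eqP; ring.
  by rewrite cabsM cabsV cabs_toCB (distC z) cabs_real ger0_norm// mulr_ge0 ?sqr_ge0 ?invr_ge0 ?ltW ?N_gt0.
rewrite remE; apply: (le_trans (cabsB _ _)).
apply: (le_trans (lerD (cabsB _ _) (lexx _))).
have -> : cabs (osc k u * half_weight z w u * tail) = cabs (half_weight z w u) * cabs tail.
  by rewrite cabsM cabsM cabs_osc mul1r.
have -> : cabs ((2%:R * conjc k)^-1 * (osc k u * dweight u * pole u)) =
    del / 2 * (cabs (dweight u) * cabs (pole u)).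
  by rewrite cabsM cabs2k cabsM cabsM cabs_osc mul1r.
have -> : cabs ((2%:R * conjc k)^-1 * (osc k u * half_weight z w u * delta_tail u)) =
    del / 2 * (cabs (half_weight z w u) * cabs (delta_tail u)).
  by rewrite cabsM cabs2k cabsM cabsM cabs_osc mul1r.
rewrite tailE.
(* By 2 del |u - z| <= N, one of the two factors 1 / N is exchanged for the singularity 1 / |u -
   z|. *)
have t2 : cabs (delta_tail u) <= del * ((dist u z)^-1 * (N u)^-1).
  have h : 2 * del * (N u)^-1 <= (dist u z)^-1.
    rewrite ler_pdivrMr ?N_gt0// [leRHS]mulrC ler_pdivlMr// /N.
    by have := sqr_ge0 (dist u z - del); nra.
  rewrite /delta_tail cabs_real.
  have -> : - 2 * del ^+ 2 * (N u)^-1 ^+ 2 = - (del * (N u)^-1 * (2 * del * (N u)^-1)) by ring.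
  have p0 : 0 <= del * (N u)^-1 by rewrite mulr_ge0 ?(ltW del0)// invr_ge0 ltW// N_gt0.
  rewrite normrN ger0_norm; last first.
    by rewrite mulr_ge0// mulr_ge0 ?mulr_ge0 ?(ltW del0)// invr_ge0 ltW// N_gt0.
  have -> : del * ((dist u z)^-1 * (N u)^-1) = del * (N u)^-1 * (dist u z)^-1 by ring.
  exact: ler_wpM2l.
rewrite -/(N u).
set n := (N u)^-1 in t2 *; set ri := (dist u z)^-1 in t2 *.
set m := (dist u z ^+ 2 + d ^+ 2)^-1.
have n0 : 0 <= n by rewrite invr_ge0 ltW// N_gt0.
have ri0 : 0 <= ri by rewrite invr_ge0 dist_ge0.
have m0 : 0 <= m by rewrite invr_ge0 addr_ge0 ?sqr_ge0.
have b1 : cabs (half_weight z w u) * (ri * (del ^+ 2 * n)) <= 2 / d * (ri * (del ^+ 2 * n)).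
  apply: ler_wpM2r; last exact: weight_le.
    by apply: mulr_ge0 => //; apply: mulr_ge0 => //; exact: sqr_ge0.
have del2 : 0 <= del / 2 by apply: divr_ge0 => //; exact: ltW.
have b2 : del / 2 * (cabs (dweight u) * cabs (pole u)) <= del / 2 * (9 * m * ri).
  apply: ler_wpM2l => //; apply: ler_pM;
    [exact: cabs_ge0|exact: cabs_ge0|exact: dweight_le|exact: pole_le].
have b3 : del / 2 * (cabs (half_weight z w u) * cabs (delta_tail u)) <=
    del / 2 * (2 / d * (del * (ri * n))).
  by rewrite ler_wpM2l ?divr_ge0 ?(ltW del0)// ler_pM ?cabs_ge0.
apply: (le_trans (lerD (lerD b1 b2) b3)).
have dr : 0 <= del ^+ 2 / d * (ri * n).
  apply: mulr_ge0; last exact: mulr_ge0.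
  by apply: divr_ge0; [exact: sqr_ge0|exact: ltW].
(* The mollification error counts 2 and the derivative of the pole counts 1; their sum 3 is rounded
   up to the 4 of the statement. *)
have -> : 2 / d * (ri * (del ^+ 2 * n)) + del / 2 * (9 * m * ri) +
    del / 2 * (2 / d * (del * (ri * n))) =
    9 / 2 * del * (ri * m) + 3 * (del ^+ 2 / d * (ri * n)) by field; rewrite gt_eqF.
have -> : 4 * del ^+ 2 / d * (ri * n) = 4 * (del ^+ 2 / d * (ri * n)) by rewrite !mulrA.
by rewrite lerD2l ler_wpM2r// ler_nat.
Qed.

Let cmeas_rem : cmeas rem.
Proof.
have [mF mH] := dbar_cmeas dbar_F; have [mg _] := dbar_cmeas dbar_weight.
apply: cmeasD; last by apply: cmeasN; apply: cmeasM => //; exact: cmeas_cst.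
apply: cmeasM; first by apply: cmeasM => //; apply: cmeas_osc; exact: measurable_id.
apply: cmeasV; apply: cmeasD; first exact: cmeas_cst.
by apply: cmeasN; apply: cmeas_toC; exact: measurable_id.
Qed.

Let cabsF_le u : cabs (F u) <= (dist z u)^-1 * (dist w u)^-1.
Proof.
rewrite /F cabsM cabsM cabs_osc mul1r mulrC ler_pM ?cabs_ge0//.
by rewrite (distC z); exact: pole_le.
Qed.

(** Green's formula bounds the main part by the boundary integral of |F| <= 1 / (|z - u| |w - u|),
    and [integral_two_scales], whose conclusion is passed as a hypothesis to fix one constant for
    both halves, bounds the remainder. Its mass is (9/2 + 4) C / (|k| d), doubled by [cintegral_le]:
    this is the 17. *)
Lemma half_kernel_le (C : R) : 0 <= C ->
  (forall (D : set (R * R)) (f : R * R -> R) (c : R * R) (d e A B : R), measurable D ->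
    0 < d -> 0 < e -> 0 <= A -> 0 <= B -> measurable_fun setT f -> (forall z, 0 <= f z) ->
    (forall z, z.1 != c.1 -> z.2 != c.2 ->
      f z <= A * ((dist z c)^-1 * (dist z c ^+ 2 + d ^+ 2)^-1) +
             B * ((dist z c)^-1 * (dist z c ^+ 2 + e ^+ 2)^-1)) ->
    (\int[mu2]_(z in D) (f z)%:E <= (C * (A / d + B / e))%:E)%E) ->
  ((cabs (cintegral Om (half_kernel k z w)))%:E <=
   ((1 + 17 * C) / cabs k)%:E *
     ((dist z w)^-1%:E + bd_integral Om M (fun u => ((dist z u)^-1 * (dist w u)^-1)%R)))%E.
Proof.
move=> C0 hC; have mOm := measurable_Om oOm.
have [mF mH] := dbar_cmeas dbar_F; have [cH1 cH2] := dbar_continuous dbar_F.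
have iH : cint Om H by split; exact: (continuous_integrable_Om oOm bOm).
have irem : (\int[mu2]_(u in Om) (cabs (rem u))%:E <= (C * (17 / 2 * del / d))%:E)%E.
  apply: le_trans; first apply: (hC Om (fun u => cabs (rem u)) z d del (9 / 2 * del) (4 * del ^+ 2 / d)) => //.
  - by rewrite mulr_ge0// ltW.
  - apply: divr_ge0; last exact: ltW.
    by apply: mulr_ge0; [exact: ler0n|exact: sqr_ge0].
  - exact: measurable_cabs.
  - by move=> u; exact: cabs_ge0.
  rewrite lee_fin ler_wpM2l// le_eqVlt; apply/orP; left; apply/eqP.
  by field; rewrite (gt_eqF d0) (gt_eqF del0).
have crem : cint Om rem by apply: cint_le => //; apply: le_lt_trans irem _; rewrite ltry.
have cZH : cint Om (fun u => (2%:R * conjc k)^-1 * H u).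
  apply: cint_le => //; first by apply: cmeasM => //; exact: cmeas_cst.
  under eq_integral do rewrite cabsM EFinM.
  have mcH := measurable_cabs mH.
  rewrite ge0_integralZl//; last 3 first.
  - by apply/measurable_EFinP; exact: measurable_funTS.
  - by move=> u _; rewrite lee_fin cabs_ge0.
  - by rewrite lee_fin cabs_ge0.
  apply: lte_mul_pinfty; rewrite ?lee_fin ?cabs_ge0//.
  have cc : continuous (fun u => `|Re (H u)| + `|Im (H u)|).
    by move=> u; apply: cvgD; apply: cvg_norm; [exact: cH1|exact: cH2].
  have /integrableP[_] := continuous_integrable_Om oOm bOm cc.
  apply: le_lt_trans; apply: ge0_le_integral => //.
  - by move=> u _; rewrite lee_fin cabs_ge0.
  - by apply/measurable_EFinP; exact: measurable_funTS.
  - apply/measurable_EFinP; apply: measurable_funTS; apply: measurableT_comp => //.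
    exact: continuous_measurable_plane.
  - move=> u _; rewrite /= lee_fin (le_trans (cabs_le_ReIm _))//.
    exact: ler_norm.
have E : cintegral Om (half_kernel k z w) =
    (2%:R * conjc k)^-1 * cintegral Om H + cintegral Om rem.
  rewrite -cintegralZ// -cintegralD//; congr cintegral; apply/funext => u.
  by rewrite /rem addrC subrK.
set Bd := bd_integral _ _ _.
have mdist (c : R * R) : measurable_fun setT (fun u => dist c u).
  by apply: measurable_dist; [exact: measurable_cst|exact: measurable_id].
have Bd0 : (0 <= Bd)%E.
  by apply: bd_integral_ge0 => u; rewrite mulr_ge0 ?invr_ge0 ?dist_ge0.
have hH : ((cabs (cintegral Om H))%:E <= 2%:E * Bd)%E.
  apply: (le_trans (green_dbar oOm convOm bOm dbar_F)); rewrite lee_wpmul2l//.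
  apply: (bd_integral_le oOm bOm).
  - exact: measurable_cabs.
  - by apply: measurable_funM; apply: measurable_inv_ge0; [move=> u; exact: dist_ge0|exact: mdist|move=> u; exact: dist_ge0|exact: mdist].
  - by move=> u; exact: cabs_ge0.
  - exact: cabsF_le.
have hR : ((cabs (cintegral Om rem))%:E <= (17 * C * del / d)%:E)%E.
  apply: (le_trans (cintegral_le mOm cmeas_rem)).
  apply: (@le_trans _ _ (2%:E * (C * (17 / 2 * del / d))%:E)%E).
    by rewrite lee_wpmul2l.
  by rewrite -EFinM lee_fin le_eqVlt; apply/orP; left; apply/eqP; field; rewrite gt_eqF.
rewrite E; apply: (@le_trans _ _ ((cabs (2%:R * conjc k)^-1)%:E * (cabs (cintegral Om H))%:E
    + (cabs (cintegral Om rem))%:E)%E).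
  by rewrite -EFinM -EFinD lee_fin -cabsM cabsD.
rewrite ge0_muleDr ?lee_fin ?invr_ge0 ?(ltW d0)// addeC; apply: leeD.
  apply: (le_trans hR); rewrite -EFinM lee_fin -/d -/del ler_wpM2r ?invr_ge0 ?(ltW d0)//.
  by rewrite ler_wpM2r ?(ltW del0)// lerDr.
rewrite cabs2k; apply: (@le_trans _ _ ((del / 2)%:E * (2%:E * Bd))%E).
  by rewrite lee_wpmul2l// lee_fin divr_ge0// ltW.
rewrite muleA -EFinM mulfVK//; rewrite lee_wpmul2r// lee_fin -/del.
by rewrite mulrDl mul1r lerDl !mulr_ge0// ltW.
Qed.

Lemma half_kernel_abs_le u : cabs (half_kernel k z w u) <= 2 / dist z w * (dist u z)^-1.
Proof.
rewrite /half_kernel cabsM cabsM cabs_osc mul1r cabsV cabs_toCB (distC z u).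
by rewrite ler_wpM2r ?invr_ge0 ?dist_ge0.
Qed.

Lemma cmeas_half_kernel : cmeas (half_kernel k z w).
Proof.
have [mg _] := dbar_cmeas dbar_weight.
apply: cmeasM; first by apply: cmeasM => //; apply: cmeas_osc; exact: measurable_id.
apply: cmeasV; apply: cmeasD; first exact: cmeas_cst.
by apply: cmeasN; apply: cmeas_toC; exact: measurable_id.
Qed.

End Regularized.

Definition full_kernel (k : R[i]) (z w u : R * R) : R[i] :=
  osc k u * (toC z - toC u)^-1 * (conjc (toC u) - conjc (toC w))^-1.

Lemma oscN_conj (k : R[i]) u : conjc (osc (- k) u) = osc k u.
Proof.
rewrite /osc; case: k => a b; case: u => x y; rewrite /cexp /=.
rewrite (_ : - (- a * y + - b * x) - (- a * y + - b * x) =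
  - (- (a * y + b * x) - (a * y + b * x))); last by ring.
rewrite cosN sinN mulrN opprK.
by congr (expR _ * _ +i* (expR _ * _))%C; ring.
Qed.

Lemma conjcM (x y : R[i]) : conjc (x * y) = conjc x * conjc y.
Proof. exact: rmorphM. Qed.

(* With [a = u - z] and [b = u - w]; the implications cover the junk value 1 / 0 = 0. *)
Lemma kernel_partial_fractions (E a ac b bc s : R[i]) :
  s = a * ac + b * bc -> s != 0 -> (a = 0 -> ac = 0) -> (bc = 0 -> b = 0) ->
  E * (- a)^-1 * bc^-1 = E * (b * s^-1) * (- a)^-1 + E * (ac * s^-1) * (- bc)^-1.
Proof.
move=> sE s0 ha hb; have [a0|a0] := eqVneq a 0.
  by rewrite a0 (ha a0) oppr0 invr0 !(mulr0, mul0r) addr0.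
have [bc0|bc0] := eqVneq bc 0.
  by rewrite bc0 (hb bc0) oppr0 invr0 !(mulr0, mul0r) addr0.
have -> : E * (b * s^-1) * (- a)^-1 + E * (ac * s^-1) * (- bc)^-1 =
    - E * (a * ac + b * bc) * s^-1 * a^-1 * bc^-1 by field; rewrite s0 a0 bc0.
rewrite -sE -(mulrA (- E)) mulfV// mulr1 invrN; ring.
Qed.

Lemma sqr_dist_conj (v c : R * R) :
  (dist v c ^+ 2)%:C%C = (toC v - toC c) * conjc (toC v - toC c).
Proof.
rewrite sqr_dist; case: v => a b; case: c => a' b'.
by apply/eqP; rewrite eq_complex /=; apply/andP; split; apply/eqP; ring.
Qed.

(** In the half singular at w the pole is antiholomorphic. Conjugation makes it holomorphic and
    turns k into -k, so that [half_kernel_le] with z and w exchanged covers it. *)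
Lemma full_kernel_split (k : R[i]) (z w u : R * R) : z != w ->
  full_kernel k z w u = half_kernel k z w u + conjc (half_kernel (- k) w z u).
Proof.
move=> zw; rewrite /full_kernel /half_kernel /half_weight !conjcM oscN_conj.
rewrite [dist u w ^+ 2 + _]addrC conjc_real conjc_inv -!conjc_toCB.
set S := dist u z ^+ 2 + dist u w ^+ 2.
have S0 : S%:C%C != 0 :> R[i].
  rewrite eq_complex /= eqxx andbT /S paddr_eq0 ?sqr_ge0// !sqrf_eq0 !dist_eq0.
  by apply: contra zw => /andP[/eqP <- /eqP <-].
have -> : (S^-1)%:C%C = (S%:C%C)^-1 :> R[i] by rewrite fmorphV.
have -> : toC z - toC u = - (toC u - toC z) by rewrite opprB.
have -> : conjc (toC w - toC u) = - conjc (toC u - toC w).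
  by rewrite -rmorphN opprB.
apply: kernel_partial_fractions => //.
- transitivity ((dist u z ^+ 2)%:C%C + (dist u w ^+ 2)%:C%C); first exact: rmorphD.
  by rewrite !sqr_dist_conj.
- by move=> ->; rewrite conjc0.
- by move/eqP; rewrite conjc_eq0 => /eqP.
Qed.

Lemma wt_lower (t x : R) : 0 <= t -> `|x| <= M -> wt t M <= wt t x.
Proof.
move=> t0 xM; rewrite /wt !powRN lef_pV2 ?posrE ?powR_gt0 ?ltr_pwDl//.
rewrite ge0_ler_powR ?nnegrE ?addr_ge0// lerD2l (le_trans xM)//.
exact: ler_norm.
Qed.

(** On a bounded set the product weight is bounded below by [wt 2 M ^+ 2], so the weighted estimate
    on the plane applies after dividing by it. *)
Lemma integral_kap_Om (p : R) : 0 <= p -> p < 2 -> exists2 C : R, 0 <= C &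
  forall c : R * R, (\int[mu2]_(u in Om) (kap u c `^ p)%:E <= C%:E)%E.
Proof.
move=> p0 p2; have [C C0 hC] := @integral_plane_kernel R p 2 p0 p2 (ltr1n _ 2).
have w0 : 0 < wt 2 M by rewrite powR_gt0// ltr_pwDl.
exists ((wt 2 M ^+ 2)^-1 * C); first by rewrite mulr_ge0// invr_ge0 sqr_ge0.
move=> c; have mOm := measurable_Om oOm.
have mk : measurable_fun setT (fun u => kap u c `^ p).
  by apply: measurable_powR_fun; apply: measurable_kap; [exact: measurable_id|exact: measurable_cst].
have mw : measurable_fun setT (fun u : R * R => wt 2 u.1 * wt 2 u.2 * kap u c `^ p).
  apply: measurable_funM => //; apply: measurable_funM;
    apply: (measurableT_comp (measurable_wt 2)); [exact: measurable_fst|exact: measurable_snd].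
pose g (u : R * R) := (wt 2 u.1 * wt 2 u.2 * kap u c `^ p)%:E.
have g0 u : (0 <= g u)%E by rewrite lee_fin !mulr_ge0 ?wt_ge0 ?powR_ge0.
have mg : measurable_fun setT g by exact/measurable_EFinP.
apply: (@le_trans _ _ (\int[mu2]_(u in Om) (((wt 2 M ^+ 2)^-1)%:E * g u))%E).
  apply: ge0_le_integral => //.
  - by move=> u _; rewrite lee_fin powR_ge0.
  - by apply/measurable_EFinP; exact: measurable_funTS.
  - by apply: measurable_funTS; apply: emeasurable_funM => //; exact: measurable_cst.
  - move=> u /bOm[u1 u2]; rewrite /g -EFinM lee_fin mulrA ler_peMl ?powR_ge0//.
    rewrite mulrC ler_pdivlMr ?exprn_gt0// mul1r expr2.
    by rewrite ler_pM ?wt_ge0 ?wt_lower.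
rewrite ge0_integralZl//; last 2 first.
- exact: measurable_funTS.
- by rewrite lee_fin invr_ge0 sqr_ge0.
rewrite EFinM lee_wpmul2l ?lee_fin ?invr_ge0 ?sqr_ge0//.
by apply: le_trans (hC c); apply: ge0_subset_integral.
Qed.

Lemma cintegral_conj (D : set (R * R)) (f : R * R -> R[i]) : measurable D -> cint D f ->
  cintegral D (fun z => conjc (f z)) = conjc (cintegral D f).
Proof.
move=> mD [f1 f2]; rewrite /cintegral /=; congr (_ +i* _)%C.
  by congr Rintegral; apply/funext => z; case: (f z).
have mD' : measurable (D : set (measurableTypeR R * measurableTypeR R)) by [].
rewrite -mulN1r -(RintegralZl (-1) mD' f2); congr Rintegral; apply/funext => z.
by case: (f z) => a b /=; rewrite mulN1r.
Qed.

Lemma cint_conj (D : set (R * R)) (f : R * R -> R[i]) : measurable D -> cint D f ->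
  cint D (fun z => conjc (f z)).
Proof.
move=> mD [f1 f2]; split.
  by rewrite (_ : (fun _ => _) = (fun z => Re (f z)))//; apply/funext => z; case: (f z).
have mD' : measurable (D : set (measurableTypeR R * measurableTypeR R)) by [].
have := integrableN f2; congr integrable; apply/funext => z /=.
by case: (f z).
Qed.

Lemma cint_half_kernel (k : R[i]) (z w : R * R) : z != w -> 0 < cabs k ->
  cint Om (half_kernel k z w).
Proof.
move=> zw k0; have mOm := measurable_Om oOm.
have mh : cmeas (half_kernel k z w) by exact: cmeas_half_kernel.
apply: cint_le => //.
have [C C0 hC] := integral_kap_Om ler01 (ltr1n _ 2).
have d0 : 0 < dist z w by exact: dist_gt0.
have mk : measurable_fun setT (fun u => kap u z `^ 1).
  by apply: measurable_powR_fun; apply: measurable_kap; [exact: measurable_id|exact: measurable_cst].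
apply: (@le_lt_trans _ _ (\int[mu2]_(u in Om) ((2 / dist z w)%:E * (kap u z `^ 1)%:E))%E).
  apply: ge0_le_integral => //.
  - by move=> u _; rewrite lee_fin cabs_ge0.
  - by apply/measurable_EFinP; apply: measurable_funTS; exact: measurable_cabs.
  - apply: emeasurable_funM; first exact: measurable_cst.
    by apply/measurable_EFinP; exact: measurable_funTS.
  - move=> u _; rewrite -EFinM lee_fin (le_trans (half_kernel_abs_le k zw u))//.
    rewrite ler_wpM2l ?divr_ge0 ?(ltW d0)// powRr1 ?(ltW (kap_gt0 _ _))//.
    by rewrite /kap lerDr.
rewrite ge0_integralZl//; last 3 first.
- by apply/measurable_EFinP; exact: measurable_funTS.
- by move=> u _; rewrite lee_fin powR_ge0.
- by rewrite lee_fin divr_ge0// ltW.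
apply: lte_mul_pinfty => //; first by rewrite lee_fin divr_ge0// ltW.
by apply: le_lt_trans (hC z) _; rewrite ltry.
Qed.

Lemma full_kernel_le : exists2 C : R, 0 <= C & forall (k : R[i]) (z w : R * R),
  0 < cabs k -> z != w ->
  ((cabs (cintegral Om (full_kernel k z w)))%:E <= (C / cabs k)%:E *
     ((dist z w)^-1%:E + bd_integral Om M (fun u => ((dist z u)^-1 * (dist w u)^-1)%R)))%E.
Proof.
have [C C0 hC] := integral_two_scales; exists (2 * (1 + 17 * C)).
  by rewrite mulr_ge0// addr_ge0// mulr_ge0.
move=> k z w k0 zw; have wz : w != z by rewrite eq_sym.
have k0' : 0 < cabs (- k) by rewrite cabsN.
have mOm := measurable_Om oOm.
have i1 := cint_half_kernel zw k0; have i2 := cint_half_kernel wz k0'.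
have -> : cintegral Om (full_kernel k z w) = cintegral Om (half_kernel k z w) +
    conjc (cintegral Om (half_kernel (- k) w z)).
  rewrite -cintegral_conj// -cintegralD//; last exact: cint_conj.
  by congr cintegral; apply/funext => u; exact: full_kernel_split.
have h1 := half_kernel_le zw k0 C0 hC; have h2 := half_kernel_le wz k0' C0 hC.
apply: (@le_trans _ _ ((cabs (cintegral Om (half_kernel k z w)))%:E +
    (cabs (cintegral Om (half_kernel (- k) w z)))%:E)%E).
  by rewrite -EFinD lee_fin (le_trans (cabsD _ _))// cabs_conj.
apply: (le_trans (leeD h1 h2)); rewrite cabsN (distC w z).
have -> : (fun u => (dist w u)^-1 * (dist z u)^-1) = (fun u => (dist z u)^-1 * (dist w u)^-1).
  by apply/funext => u; rewrite mulrC.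
have -> : 2 * (1 + 17 * C) / cabs k = 2 * ((1 + 17 * C) / cabs k) by rewrite mulrA.
by rewrite [X in (_ <= X * _)%E]EFinM -muleA mule_natl mule2n.
Qed.

End KernelBound.

(** * Schur's test and weighted bounds *)

Section SchurHoelder.
Local Open Scope ereal_scope.
Context d1 d2 (T1 : measurableType d1) (T2 : measurableType d2) (R : realType).
Variable m1 : {sigma_finite_measure set T1 -> \bar R}.
Variable m2 : {sigma_finite_measure set T2 -> \bar R}.

Lemma measurable_poweR_fun d (T : measurableType d) (f : T -> \bar R) (r : R) :
  measurable_fun setT f -> measurable_fun setT (fun x => f x `^ r).
Proof. by move=> mf; apply: (measurableT_comp (measurable_poweR r) mf). Qed.

Lemma measurable_curry d d' d3 (S : measurableType d) (S' : measurableType d')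
    (V : measurableType d3) (f : S * S' -> V) (x : S) :
  measurable_fun setT f -> measurable_fun setT (fun y => f (x, y)).
Proof. by move=> mf; exact: (measurableT_comp mf (measurable_pair1 x)). Qed.

(** Hoelder in y pairs a f in L^q with b in L^p; the row bound on b comes out as C^(q/p), and
    Tonelli lets the remaining q-th powers be integrated in x first. The spaces are abstract so that
    y can include a boundary parameter. *)
Lemma schur_hoelder (a b : T1 * T2 -> R) (f : T2 -> R) (p q C : R) :
  measurable_fun setT a -> measurable_fun setT b -> measurable_fun setT f ->
  (forall x, 0 <= a x)%R -> (forall x, 0 <= b x)%R -> (forall y, 0 <= f y)%R ->
  (0 < p)%R -> (0 < q)%R -> (q^-1 + p^-1 = 1)%R -> (0 <= C)%R ->
  (forall x, \int[m2]_y (b (x, y) `^ p)%:E <= C%:E) ->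
  \int[m1]_x ((\int[m2]_y (a (x, y) * b (x, y) * f y)%:E) `^ q) <=
  (C `^ (q / p))%:E * \int[m2]_y ((f y `^ q)%:E * \int[m1]_x (a (x, y) `^ q)%:E).
Proof.
move=> ma mb mf a0 b0 f0 p0 q0 pq C0 hb.
have mf2 : measurable_fun setT (fun z : T1 * T2 => f z.2).
  exact: (measurableT_comp mf measurable_snd).
have mabf : measurable_fun setT (fun z : T1 * T2 => (a z * b z * f z.2)%:E).
  by apply/measurable_EFinP; apply: measurable_funM => //; exact: measurable_funM.
have mG : measurable_fun setT (fun x => \int[m2]_y (a (x, y) * b (x, y) * f y)%:E).
  apply: (measurable_fun_fubini_tonelli_F (fun z : T1 * T2 => (a z * b z * f z.2)%:E)) => //.
  by move=> z; rewrite lee_fin !mulr_ge0.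
pose h (z : T1 * T2) := ((a z * f z.2) `^ q)%:E.
have h0 z : 0 <= h z by rewrite lee_fin powR_ge0.
have mh : measurable_fun setT h.
  by apply/measurable_EFinP; apply: measurable_powR_fun; exact: measurable_funM.
have sec (g : T1 * T2 -> R) x : measurable_fun setT g -> measurable_fun setT (fun y => g (x, y)).
  by move=> mg; exact: (measurableT_comp mg (measurable_pair1 x)).
have pt x : (\int[m2]_y (a (x, y) * b (x, y) * f y)%:E) `^ q <=
    (C `^ (q / p))%:E * \int[m2]_y h (x, y).
  pose F y := (a (x, y) * f y)%R; pose B y := b (x, y).
  have mF : measurable_fun setT F by apply: measurable_funM => //; exact: sec.
  have mB : measurable_fun setT B by exact: sec.
  have H := hoelder m2 mF mB q0 p0 pq.
  have E : \int[m2]_y (a (x, y) * b (x, y) * f y)%:E = Lnorm m2 1 (EFin \o (F \* B)%R).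
    rewrite Lnorm1; apply: eq_integral => y _ /=; congr EFin.
    by rewrite /F /B ger0_norm ?mulr_ge0//; ring.
  rewrite E.
  have LB : Lnorm m2 p%:E (EFin \o B) `^ q <= (C `^ (q / p))%:E.
    have qE : q = (p * (q / p))%R by rewrite mulrC mulfVK// gt_eqF.
    rewrite {1}qE poweRrM poweR_Lnorm ?gt_eqF//.
    rewrite -poweR_EFin; apply: gt0_ler_poweR.
    - by rewrite divr_ge0 // ltW.
    - by rewrite in_itv/= leey integral_ge0// => y _; exact: poweR_ge0.
    - by rewrite in_itv/= leey lee_fin C0.
    apply: le_trans (hb x); rewrite le_eqVlt; apply/orP; left; apply/eqP.
    by apply: eq_integral => y _; rewrite /= ger0_norm ?b0.
  have LF : Lnorm m2 q%:E (EFin \o F) `^ q = \int[m2]_y h (x, y).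
    rewrite poweR_Lnorm; last by rewrite gt_eqF.
    apply: eq_integral => y _.
    by rewrite /= ger0_norm// mulr_ge0.
  apply: (@le_trans _ _ ((Lnorm m2 q%:E (EFin \o F) * Lnorm m2 p%:E (EFin \o B)) `^ q)).
    apply: gt0_ler_poweR => //; first exact: ltW.
    - by rewrite in_itv/= leey Lnorm_ge0.
    - by rewrite in_itv/= leey mule_ge0 ?Lnorm_ge0.
  rewrite poweRM ?Lnorm_ge0// LF muleC lee_wpmul2r//.
  by apply: integral_ge0.
apply: (@le_trans _ _ (\int[m1]_x ((C `^ (q / p))%:E * \int[m2]_y h (x, y)))).
  apply: ge0_le_integral => //.
  - by move=> x _; exact: poweR_ge0.
  - exact: measurable_poweR_fun.
  - apply: emeasurable_funM; first exact: measurable_cst.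
    by apply: (measurable_fun_fubini_tonelli_F h).
rewrite ge0_integralZl ?lee_fin ?powR_ge0//; last 2 first.
- by apply: (measurable_fun_fubini_tonelli_F h).
- by move=> x _; exact: integral_ge0.
rewrite lee_wpmul2l ?lee_fin ?powR_ge0//.
have e1 : \int[m1 \x m2]_z h z = \int[m1]_x fubini_F m2 h x by exact: fubini_tonelli1.
have e2 : \int[m1 \x m2]_z h z = \int[m2]_y fubini_G m1 h y by exact: fubini_tonelli2.
rewrite -/(fubini_F m2 h) -[leLHS]e1 e2 le_eqVlt; apply/orP; left; apply/eqP.
apply: eq_integral => y _; rewrite /fubini_G /h /=.
under eq_integral do rewrite powRM// EFinM muleC.
rewrite ge0_integralZl ?lee_fin ?powR_ge0//; last first.
  by move=> x _; rewrite lee_fin powR_ge0.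
apply/measurable_EFinP; apply: measurable_powR_fun.
exact: (measurableT_comp ma (measurable_pair2 y)).
Qed.

End SchurHoelder.

(* Integrals of nonnegative functions are suprema over simple minorants, so no
   measurability is needed here. *)
Lemma ge0_integral_mono d (T : measurableType d) (R : realType)
    (m : {measure set T -> \bar R}) (D : set T) (f g : T -> \bar R) :
  (forall x, D x -> (0 <= f x)%E) -> (forall x, D x -> (f x <= g x)%E) ->
  (\int[m]_(x in D) f x <= \int[m]_(x in D) g x)%E.
Proof.
move=> f0 fg; rewrite [leLHS]integral_mkcond [leRHS]integral_mkcond.
have le x : ((f \_ D) x <= (g \_ D) x)%E.
  by rewrite !patchE; case: ifPn => // /set_mem; exact: fg.
have ge x : (0 <= (f \_ D) x)%E by rewrite patchE; case: ifPn => // /set_mem; exact: f0.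
rewrite !ge0_integralTE//; last by move=> x; exact: le_trans (ge x) (le x).
by apply: ge_ereal_sup => _ /= [h hf <-]; apply: ereal_sup_ubound; exists h => // x;
  apply: le_trans (hf x) (le x).
Qed.

(** * Sigma-finiteness of the plane measure, for Tonelli on pairs of points *)

Section ProductSigmaFinite.
Context d1 d2 (T1 : measurableType d1) (T2 : measurableType d2) (R : realType).
Variable m1 : {sigma_finite_measure set T1 -> \bar R}.
Variable m2 : {sigma_finite_measure set T2 -> \bar R}.

Lemma product_measure_sigma_finite : sigma_finite setT (m1 \x m2)%E.
Proof.
have /sigma_finiteP[F [TF ndF Foo]] := sigma_finiteT m1.
have /sigma_finiteP[G [TG ndG Goo]] := sigma_finiteT m2.
exists (fun n => F n `*` G n).
  rewrite -setXTT TF TG predeqE => -[x y]; split.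
    move=> [/= [n _ Fnx] [k _ Gky]]; exists (maxn n k) => //; split.
    - by move: x Fnx; exact/subsetPset/ndF/leq_maxl.
    - by move: y Gky; exact/subsetPset/ndG/leq_maxr.
  by move=> [n _ []/= ? ?]; split; exists n.
move=> k; have [? ?] := Foo k; have [? ?] := Goo k; split; first exact: measurableX.
by rewrite product_measure1E// lte_mul_pinfty// ge0_fin_numE.
Qed.

Let product_isSigmaFinite :=
  Measure_isSigmaFinite.Build _ _ _ (m1 \x m2)%E product_measure_sigma_finite.

(* The library infers sigma-finiteness of product measures only for
   subprobabilities, so the instance is packed by hand. *)
Definition sigma_finite_product : {sigma_finite_measure set (T1 * T2)%type -> \bar R} :=
  HB.pack (Measure.sort (m1 \x m2)%E) product_isSigmaFinite.

End ProductSigmaFinite.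

Section PlaneMeasure.
Variable R : realType.
Local Notation mu := (@lebesgue_measure R).
Local Notation mu2 := (@leb2 R).
Local Notation plane := (measurableTypeR R * measurableTypeR R)%type.
Local Open Scope ereal_scope.

Definition sigma_finite_leb2 : {sigma_finite_measure set plane -> \bar R} :=
  sigma_finite_product mu mu.

Lemma measurable_integral_section (F : (R * R) * (R * R) -> \bar R) :
  measurable_fun setT F -> (forall x, 0 <= F x) ->
  measurable_fun setT (fun z => \int[mu2]_w F (z, w)).
Proof.
move=> mF F0.
exact: (@measurable_fun_fubini_tonelli_F _ _ plane _ R sigma_finite_leb2 F mF F0).
Qed.

Lemma tonelli_plane (F : (R * R) * (R * R) -> \bar R) :
  measurable_fun setT F -> (forall x, 0 <= F x) ->
  \int[mu2]_z \int[mu2]_w F (z, w) = \int[mu2]_w \int[mu2]_z F (z, w).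
Proof.
move=> mF F0.
exact: (@fubini_tonelli _ _ _ _ R sigma_finite_leb2 sigma_finite_leb2 F mF F0).
Qed.

End PlaneMeasure.

(** * Weighted L^q bounds for the majorant kernel *)

Section WeightedBounds.
Variable R : realType.
Local Notation mu := (@lebesgue_measure R).
Local Notation mu2 := (@leb2 R).

Lemma jbr_ge1 (z : R * R) : 1 <= jbr z.
Proof. by rewrite -[leLHS]sqrtr1 /jbr ler_wsqrtr// lerDl sqr_ge0. Qed.

Lemma jbr_gt0 (z : R * R) : 0 < jbr z.
Proof. exact: lt_le_trans (jbr_ge1 z). Qed.

Lemma sqr_jbr (z : R * R) : jbr z ^+ 2 = 1 + z.1 ^+ 2 + z.2 ^+ 2.
Proof.
rewrite /jbr sqr_sqrtr ?addr_ge0 ?sqr_ge0// /cabs sqr_sqrtr ?addr_ge0 ?sqr_ge0//.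
by rewrite addrA.
Qed.

Lemma measurable_jbr : measurable_fun setT (@jbr R).
Proof.
rewrite /jbr; under eq_fun do rewrite -powR12_sqrt ?addr_ge0 ?sqr_ge0//.
apply: measurable_powR_fun; apply: measurable_funD; first exact: measurable_cst.
apply: measurable_funX; apply: measurable_cabs; apply: cmeas_toC; exact: measurable_id.
Qed.

(** Divide jbr z <= 1 + 2 B + |z - v| by |z - v|. One inequality thus covers z near the set and z
    far away: the pole is traded for a factor 1 / jbr z at the cost of [kap]. *)
Lemma inv_dist_le_jbr (z v : R * R) (B : R) : 0 <= B -> `|v.1| <= B -> `|v.2| <= B ->
  (dist z v)^-1 <= (1 + 2 * B) * (jbr z)^-1 * kap z v.
Proof.
move=> B0 v1 v2; have j0 := jbr_gt0 z; have d0 := dist_ge0 z v.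
have jle : jbr z <= 1 + 2 * B + dist z v.
  have hv : cabs (toC v) <= 2 * B.
    by rewrite (le_trans (cabs_le_ReIm _))// mulr_natl mulr2n lerD.
  have hz : cabs (toC z) <= dist z v + cabs (toC v).
    by rewrite -cabs_toCB (le_trans _ (cabsD _ _))// subrK.
  have hj : jbr z <= 1 + cabs (toC z).
    rewrite /jbr -[leRHS]ger0_norm ?addr_ge0 ?cabs_ge0// -sqrtr_sqr ler_wsqrtr//.
    rewrite sqrrD expr1n mul1r lerD2r lerDl mulrn_wge0// cabs_ge0//.
  by lra.
have [->|dn0] := eqVneq (dist z v) 0.
  by rewrite invr0 !mulr_ge0 ?invr_ge0 ?(ltW j0) ?(ltW (kap_gt0 _ _))// addr_ge0// mulr_ge0.
have dp : 0 < dist z v by rewrite lt_def dn0.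
have i0 : 0 <= (dist z v)^-1 by rewrite invr_ge0.
rewrite /kap mulrAC ler_pdivlMr//; apply: (le_trans (ler_wpM2l i0 jle)).
by rewrite mulrDr mulVf//; nra.
Qed.

(** One power of 1 / jbr z comes from the kernel of AB, the power eps from the norm of the target
    space. *)
Definition decay (eps : R) (z : R * R) : R := jbr z `^ (- (1 + eps)).

Lemma decay_ge0 eps z : 0 <= decay eps z. Proof. exact: powR_ge0. Qed.

Lemma measurable_decay eps : measurable_fun setT (decay eps).
Proof. by apply: measurable_powR_fun; exact: measurable_jbr. Qed.

(** From (1 + |x|) (1 + |y|) <= 2 (1 + x^2 + y^2), raised to the power t = (1 + eps) q / 2. The
    product weight is integrable for t > 1, which is the condition (1 + eps) q > 2. *)
Lemma decay_powR_le (eps q : R) (z : R * R) : 0 <= (1 + eps) * q / 2 ->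
  decay eps z `^ q <=
  2 `^ ((1 + eps) * q / 2) * (wt ((1 + eps) * q / 2) z.1 * wt ((1 + eps) * q / 2) z.2).
Proof.
set t := (1 + eps) * q / 2 => t0.
have h : (1 + `|z.1|) * (1 + `|z.2|) <= 2 * jbr z ^+ 2.
  rewrite sqr_jbr -(real_normK (num_real z.1)) -(real_normK (num_real z.2)).
  have := sqr_ge0 (1 - `|z.1|); have := sqr_ge0 (1 - `|z.2|).
  by have := sqr_ge0 (`|z.1| - `|z.2|); nra.
have p0 : 0 < (1 + `|z.1|) * (1 + `|z.2|) by rewrite mulr_gt0// ltr_pwDl.
have j0 : 0 < jbr z ^+ 2 by rewrite exprn_gt0// jbr_gt0.
have -> : decay eps z `^ q = (jbr z ^+ 2) `^ (- t).
  rewrite /decay -powRrM -powR_mulrn ?(ltW (jbr_gt0 z))// -powRrM.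
  by congr (_ `^ _); rewrite /t; field.
rewrite /wt -powRM ?addr_ge0// !powRN -lef_pV2 ?posrE ?mulr_gt0 ?invr_gt0 ?powR_gt0//.
rewrite invfM !invrK mulrC ler_pdivrMr ?powR_gt0// mulrC -powRM// ?(ltW j0)//.
rewrite [X in X `^ _ <= _]mulrC [X in _ <= X `^ _]mulrC.
apply: ge0_ler_powR => //; rewrite nnegrE; first exact: ltW.
by apply: mulr_ge0 => //; exact: ltW.
Qed.

Lemma integral_decay_kap (eps q p : R) : 0 <= p -> p < 2 -> 2 < (1 + eps) * q ->
  exists2 C : R, 0 <= C & forall c : R * R,
  (\int[mu2]_z (decay eps z `^ q * kap z c `^ p)%:E <= C%:E)%E.
Proof.
move=> p0 p2 eq2; set t := (1 + eps) * q / 2.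
have t1 : 1 < t by rewrite /t ltr_pdivlMr// mul1r.
have [C C0 hC] := integral_plane_kernel p0 p2 t1.
exists (2 `^ t * C); first by rewrite mulr_ge0 ?powR_ge0.
move=> c.
have mk : measurable_fun setT (fun u => kap u c `^ p).
  by apply: measurable_powR_fun; apply: measurable_kap; [exact: measurable_id|exact: measurable_cst].
have mw : measurable_fun setT (fun u : R * R => (wt t u.1 * wt t u.2 * kap u c `^ p)%:E).
  apply/measurable_EFinP; apply: measurable_funM => //; apply: measurable_funM;
    apply: (measurableT_comp (measurable_wt t)); [exact: measurable_fst|exact: measurable_snd].
apply: (@le_trans _ _ (\int[mu2]_z ((2 `^ t)%:E * (wt t z.1 * wt t z.2 * kap z c `^ p)%:E))%E).
  apply: ge0_le_integral => //.
  - by move=> z _; rewrite lee_fin mulr_ge0 ?powR_ge0.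
  - apply/measurable_EFinP; apply: measurable_funM => //.
    by apply: measurable_powR_fun; exact: measurable_decay.
  - by apply: emeasurable_funM => //; exact: measurable_cst.
  - move=> z _; rewrite -EFinM lee_fin mulrA ler_wpM2r ?powR_ge0// decay_powR_le//.
    by rewrite ltW// (lt_trans _ t1).
rewrite ge0_integralZl//; last by move=> z _; rewrite lee_fin !mulr_ge0 ?wt_ge0 ?powR_ge0.
by rewrite EFinM lee_wpmul2l ?lee_fin ?powR_ge0.
Qed.

Variables (Om : set (R * R)) (M : R).
Hypothesis oOm : open Om.
Hypothesis convOm : forall (z w : R * R) (t : R), Om z -> Om w -> 0 < t < 1 ->
  Om ((1 - t) *: z + t *: w).
Hypothesis bOm : forall z, Om z -> `|z.1| <= M /\ `|z.2| <= M.

Lemma curve_coordinate c : List.In c (boundary_curves Om) ->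
  (forall t, (c t).1 = t) \/ (forall t, (c t).2 = t).
Proof. by move=> [<-|[<-|[<-|[<-|[]]]]]; [right|right|left|left]. Qed.

(** The bound is [|M|] and not [M]: an empty slice has both ends at 0, and [M] may be negative when
    [Om] is empty. *)
Lemma inf_sup_bounded (E : set R) : (forall x, E x -> `|x| <= M) ->
  `|inf E| <= `|M| /\ `|sup E| <= `|M|.
Proof.
move=> EM; have [->|/set0P[x Ex]] := eqVneq E set0.
  by rewrite inf0 sup0 normr0.
have ub : has_ubound E by exists M => y /EM; apply: le_trans; exact: ler_norm.
have lb : has_lbound E by exists (- M) => y /EM; rewrite ler_norml => /andP[].
have := EM _ Ex; rewrite ler_norml => /andP[xl xu].
have M0 : M <= `|M| := ler_norm M.
have s1 : sup E <= M by apply: ge_sup; [exists x|move=> y /EM; apply: le_trans; exact: ler_norm].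
have s2 : x <= sup E by exact: ub_le_sup.
have i1 : - M <= inf E.
  by apply: lb_le_inf; [exists x|move=> y /EM; rewrite ler_norml => /andP[]].
have i2 : inf E <= x by exact: ge_inf.
by split; rewrite ler_norml; apply/andP; split; lra.
Qed.

Lemma curve_bounded c t : List.In c (boundary_curves Om) -> - M <= t <= M ->
  `|(c t).1| <= `|M| /\ `|(c t).2| <= `|M|.
Proof.
move=> hc; rewrite -ler_norml => tM.
have tM' : `|t| <= `|M| by rewrite (le_trans tM)// ler_norm.
have hh y : `|inf (hslice Om y)| <= `|M| /\ `|sup (hslice Om y)| <= `|M|.
  by apply: inf_sup_bounded => x /bOm[].
have hv y : `|inf (vslice Om y)| <= `|M| /\ `|sup (vslice Om y)| <= `|M|.
  by apply: inf_sup_bounded => x /bOm[].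
by move: hc => [<-|[<-|[<-|[<-|[]]]]]; split => //=; have [] := hh t; have [] := hv t.
Qed.

(** One coordinate of the curve is the parameter itself, so its distance to z is at least |t - b|
    with b the same coordinate of z. The bound reduces to the line kernel, uniformly in z, for
    exponents below 1. *)
Lemma integral_curve_kap c (s : R) : List.In c (boundary_curves Om) -> 0 <= s -> s < 1 ->
  exists2 C : R, 0 <= C & forall z : R * R,
  (\int[mu]_(t in `[(- M)%R, M]) (kap z (c t) `^ s)%:E <= C%:E)%E.
Proof.
move=> hc s0 s1; have mc := measurable_curve oOm bOm hc.
have [||||C C0 hC] := @integral_line_kernel R 1 s 2 => //; first by rewrite mul1r.
  by rewrite ltr1n.
have w0 : 0 < wt 2 M by rewrite powR_gt0// ltr_pwDl.
exists ((wt 2 M)^-1 * C); first by rewrite mulr_ge0// invr_ge0 ltW.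
move=> z.
have [b hb] : exists b : R, forall t, t != b -> kap z (c t) <= 1 + `|t - b| `^ (- 1).
  have aux (a x y : R) : 0 <= y -> `|x| <= y -> 0 < `|x| -> 1 + y^-1 <= 1 + `|x| `^ (- 1).
    move=> y0 xy x0; rewrite lerD2l powR_inv1 ?normr_ge0// lef_pV2 ?posrE//.
    exact: lt_le_trans xy.
  have [h|h] := curve_coordinate hc.
    exists z.1 => t tb; apply: aux => //; first exact: dist_ge0.
      by have := abs1_le_dist z (c t); rewrite h distrC.
    by rewrite normr_gt0 subr_eq0.
  exists z.2 => t tb; apply: aux => //; first exact: dist_ge0.
    by have := abs2_le_dist z (c t); rewrite h distrC.
  by rewrite normr_gt0 subr_eq0.
pose g (t : R) := (wt 2 t * (1 + `|t - b| `^ (- 1)) `^ s)%:E.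
have g0 t : (0 <= g t)%E by rewrite lee_fin mulr_ge0 ?wt_ge0 ?powR_ge0.
have mg : measurable_fun setT g.
  apply/measurable_EFinP; apply: measurable_funM; first exact: measurable_wt.
  apply: measurable_powR_fun; apply: measurable_funD; first exact: measurable_cst.
  apply: measurable_powR_fun; apply: measurableT_comp; first exact: normr_measurable.
  by apply: measurable_funB; [exact: measurable_id|exact: measurable_cst].
apply: (@le_trans _ _ (\int[mu]_(t in `[(- M)%R, M]) (((wt 2 M)^-1)%:E * g t))%E).
  apply: ae_ge0_le_integral => //.
  - by move=> t _; rewrite lee_fin powR_ge0.
  - apply/measurable_EFinP; apply: measurable_funTS; apply: measurable_powR_fun.
    by apply: measurable_kap => //; exact: measurable_cst.
  - by move=> t _; rewrite mule_ge0// lee_fin invr_ge0 ltW.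
  - by apply: measurable_funTS; apply: emeasurable_funM => //; exact: measurable_cst.
  have := @ae_neq R b (fun t => t \in `[(- M)%R, M] ->
    (kap z (c t) `^ s)%:E <= ((wt 2 M)^-1)%:E * g t)%E.
  case=> [t tb|N [mN N0 sub]].
    rewrite in_itv/= -ler_norml => tM; rewrite /g -EFinM lee_fin mulrA.
    rewrite (@le_trans _ _ ((1 + `|t - b| `^ (- 1)) `^ s))//.
      apply: ge0_ler_powR => //; rewrite ?nnegrE;
        [exact/ltW/kap_gt0|by rewrite addr_ge0 ?powR_ge0|exact: hb].
    by rewrite ler_peMl ?powR_ge0// mulrC ler_pdivlMr// mul1r wt_lower.
  exists N; split => // t /= nt; apply: sub => /= h; apply: nt => Dt; exact: h.
rewrite ge0_integralZl//; last 2 first.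
- exact: measurable_funTS.
- by rewrite lee_fin invr_ge0 ltW.
rewrite EFinM lee_wpmul2l ?lee_fin ?invr_ge0 ?(ltW w0)//.
by apply: le_trans (hC b); apply: ge0_subset_integral.
Qed.

Variables (eps q : R).
Hypothesis q1 : 1 < q.
Hypothesis epsq : 2 < (1 + eps) * q.

Local Open Scope ereal_scope.

(** Kernels take extended real values because a boundary integral may diverge when z lies on one of
    the curves. *)
Definition weighted_bound (k : (R * R) * (R * R) -> \bar R) : Prop :=
  [/\ measurable_fun setT k, (forall x, 0 <= k x) &
  exists2 C : R, (0 <= C)%R & forall U : R * R -> R, measurable_fun setT U ->
    (forall w, 0 <= U w)%R ->
    \int[mu2]_z (((decay eps z)%:E * \int[mu2]_(w in Om) ((U w)%:E * k (z, w))) `^ q)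
    <= C%:E * \int[mu2]_w ((U w `^ q)%:E)].

Let q0 : (0 < q)%R. Proof. by rewrite (lt_trans _ q1). Qed.

Lemma poweRD_le (x y : \bar R) : 0 <= x -> 0 <= y ->
  (x + y) `^ q <= (2 `^ q)%:E * (x `^ q + y `^ q).
Proof.
move=> x0 y0; wlog xy : x y x0 y0 / x <= y.
  move=> h; have [/h|/ltW/h] := leP x y; first exact.
  by rewrite addeC [X in _ <= _ * X]addeC; exact.
apply: (@le_trans _ _ ((2%:E * y) `^ q)).
  apply: gt0_ler_poweR; rewrite ?(ltW q0)//.
  - by rewrite in_itv/= leey adde_ge0.
  - by rewrite in_itv/= leey mule_ge0.
  - by rewrite mule_natl mule2n leeD2r.
rewrite poweRM// poweR_EFin lee_wpmul2l ?lee_fin ?powR_ge0//.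
by rewrite leeDr ?poweR_ge0.
Qed.

Let mOm : measurable Om. Proof. exact: measurable_Om. Qed.

Lemma measurable_apply (k : (R * R) * (R * R) -> \bar R) (U : R * R -> R) :
  measurable_fun setT k -> (forall x, 0 <= k x) -> measurable_fun setT U ->
  (forall w, 0 <= U w)%R ->
  measurable_fun setT (fun z => \int[mu2]_(w in Om) ((U w)%:E * k (z, w))).
Proof.
move=> mk k0 mU U0.
pose F (x : (R * R) * (R * R)) := (U x.2 * \1_Om x.2)%:E * k x.
have mF : measurable_fun setT F.
  apply: emeasurable_funM => //; apply/measurable_EFinP.
  have m : measurable_fun setT (fun w => (U w * \1_Om w)%R).
    by apply: measurable_funM => //; exact: measurable_indic.
  exact: (measurableT_comp m measurable_snd).
have F0 x : 0 <= F x by rewrite mule_ge0// lee_fin mulr_ge0.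
have := measurable_integral_section mF F0.
congr measurable_fun; apply/funext => z; rewrite [RHS]integral_mkcond.
apply: eq_integral => w _; rewrite patchE /F /= indicE.
by case: ifPn => wO; rewrite ?mulr1// mulr0 mul0e.
Qed.

Lemma weighted_boundD k1 k2 : weighted_bound k1 -> weighted_bound k2 ->
  weighted_bound (fun x => k1 x + k2 x).
Proof.
move=> [m1 k10 [C1 C10 h1]] [m2 k20 [C2 C20 h2]]; split.
- exact: emeasurable_funD.
- by move=> x; rewrite adde_ge0.
exists (2 `^ q * (C1 + C2))%R; first by rewrite mulr_ge0 ?powR_ge0 ?addr_ge0.
move=> U mU U0; have M1 := measurable_apply m1 k10 mU U0; have M2 := measurable_apply m2 k20 mU U0.
pose G (k : (R * R) * (R * R) -> \bar R) z :=
  (decay eps z)%:E * \int[mu2]_(w in Om) ((U w)%:E * k (z, w)).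
have G0 k z : (forall x, 0 <= k x) -> 0 <= G k z.
  move=> k0; rewrite mule_ge0 ?lee_fin ?decay_ge0//.
  by apply: integral_ge0 => w _; rewrite mule_ge0 ?lee_fin.
have mG k : measurable_fun setT (fun z => \int[mu2]_(w in Om) ((U w)%:E * k (z, w))) ->
    measurable_fun setT (fun z => G k z `^ q).
  move=> m; apply: measurable_poweR_fun; apply: emeasurable_funM => //.
  by apply/measurable_EFinP; exact: measurable_decay.
have msec (k : (R * R) * (R * R) -> \bar R) (z : R * R) : measurable_fun setT k -> measurable_fun Om (fun w => (U w)%:E * k (z, w)).
  move=> mk; apply: measurable_funTS; apply: emeasurable_funM; first exact/measurable_EFinP.
  exact: measurable_curry.
have E z : (decay eps z)%:E * (\int[mu2]_(w in Om) ((U w)%:E * (k1 (z, w) + k2 (z, w)))) =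
    G k1 z + G k2 z.
  rewrite /G -ge0_muleDr; last 2 first.
  - by apply: integral_ge0 => w _; rewrite mule_ge0 ?lee_fin.
  - by apply: integral_ge0 => w _; rewrite mule_ge0 ?lee_fin.
  congr (_ * _); rewrite -ge0_integralD//; last 4 first.
  - by move=> w _; rewrite mule_ge0 ?lee_fin.
  - exact: msec.
  - by move=> w _; rewrite mule_ge0 ?lee_fin.
  - exact: msec.
  by apply: eq_integral => w _; rewrite ge0_muleDr.
under eq_integral do rewrite E.
apply: (@le_trans _ _ (\int[mu2]_z ((2 `^ q)%:E * (G k1 z `^ q + G k2 z `^ q)))).
  apply: ge0_le_integral => //.
  - by move=> z _; exact: poweR_ge0.
  - apply: measurable_poweR_fun; apply: emeasurable_funD; apply: emeasurable_funM => //;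
      by apply/measurable_EFinP; exact: measurable_decay.
  - apply: emeasurable_funM; first exact: measurable_cst.
    by apply: emeasurable_funD; exact: mG.
  - by move=> z _; apply: poweRD_le; exact: G0.
rewrite ge0_integralZl ?lee_fin ?powR_ge0//; last 2 first.
- by apply: emeasurable_funD; exact: mG.
- by move=> z _; rewrite adde_ge0 ?poweR_ge0.
rewrite EFinM -muleA lee_wpmul2l ?lee_fin ?powR_ge0//.
rewrite ge0_integralD//; last 4 first.
- by move=> z _; exact: poweR_ge0.
- exact: mG.
- by move=> z _; exact: poweR_ge0.
- exact: mG.
rewrite EFinD ge0_muleDl ?lee_fin//.
by apply: leeD; [exact: h1|exact: h2].
Qed.

(** * Schur's test for superpositions of product kernels *)

Section SchurKernel.
Context d (S : measurableType d).
Variable nu : {sigma_finite_measure set S -> \bar R}.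

(** The parameter t joins w as a variable of integration in Hoelder's inequality, so a single
    application of [schur_hoelder] treats the whole superposition. *)
Lemma weighted_bound_schur (al be : (R * R) * (S * (R * R)) -> R) (p C1 C2 : R) :
  measurable_fun setT al -> measurable_fun setT be ->
  (forall x, 0 <= al x)%R -> (forall x, 0 <= be x)%R ->
  (0 < p)%R -> (q^-1 + p^-1 = 1)%R -> (0 <= C1)%R -> (0 <= C2)%R ->
  (forall z, \int[nu]_t \int[mu2]_(w in Om) (be (z, (t, w)) `^ p)%:E <= C1%:E) ->
  (forall w, Om w ->
    \int[nu]_t \int[mu2]_z ((decay eps z * al (z, (t, w))) `^ q)%:E <= C2%:E) ->
  weighted_bound (fun x => \int[nu]_t (al (x.1, (t, x.2)) * be (x.1, (t, x.2)))%:E).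
Proof.
move=> mal mbe al0 be0 p0 pq C10 C20 hbe hal.
pose F (x : ((R * R) * (R * R)) * S) := (al (x.1.1, (x.2, x.1.2)) * be (x.1.1, (x.2, x.1.2)))%:E.
have mperm : measurable_fun [set: ((R * R) * (R * R)) * S]
    (fun x : ((R * R) * (R * R)) * S => (x.1.1, (x.2, x.1.2))).
  apply/measurable_fun_pairP; split => /=.
    exact: (measurableT_comp measurable_fst measurable_fst).
  apply/measurable_fun_pairP; split; first exact: measurable_snd.
  exact: (measurableT_comp measurable_snd measurable_fst).
have mF : measurable_fun setT F.
  by apply/measurable_EFinP; apply: measurable_funM;
    [exact: (measurableT_comp mal mperm)|exact: (measurableT_comp mbe mperm)].
have F0 x : 0 <= F x by rewrite lee_fin mulr_ge0.
have mk := measurable_fun_fubini_tonelli_F (m2 := nu) F mF F0.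
have k0 x : 0 <= fubini_F nu F x by exact: integral_ge0.
split => //.
pose X2 := sigma_finite_product nu (@sigma_finite_leb2 R).
pose a (x : (R * R) * (S * (R * R))) := (decay eps x.1 * al x)%R.
(* The indicator of [Om] enters twice: here it confines the row bound to [Om], and in [f] it
   confines the column bound to w in [Om]. *)
pose b (x : (R * R) * (S * (R * R))) := (be x * \1_Om x.2.2)%R.
have m22 : measurable_fun [set: (R * R) * (S * (R * R))] (fun x : (R * R) * (S * (R * R)) => x.2.2).
  exact: (measurableT_comp measurable_snd measurable_snd).
have ma : measurable_fun setT a.
  apply: measurable_funM => //; exact: (measurableT_comp (measurable_decay eps) measurable_fst).
have mb : measurable_fun setT b.
  apply: measurable_funM => //.
  have mI : measurable_fun setT (\1_Om : R * R -> R) by exact: measurable_indic.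
  exact: (measurableT_comp mI m22).
have a0 x : (0 <= a x)%R by rewrite mulr_ge0 ?decay_ge0.
have b0 x : (0 <= b x)%R by rewrite mulr_ge0.
exists (C1 `^ (q / p) * C2)%R; first by rewrite mulr_ge0 ?powR_ge0.
move=> U mU U0.
pose f (y : S * (R * R)) := (U y.2 * \1_Om y.2)%R.
have mf : measurable_fun setT f.
  apply: (@measurableT_comp _ _ _ _ _ _ (fun w => U w * \1_Om w)%R); last exact: measurable_snd.
  by apply: measurable_funM => //; exact: measurable_indic.
have f0 y : (0 <= f y)%R by rewrite mulr_ge0.
have hb x : \int[X2]_y (b (x, y) `^ p)%:E <= C1%:E.
  rewrite [leLHS](fubini_tonelli1 (m1 := nu) (m2 := @sigma_finite_leb2 R) (fun y => (b (x, y) `^ p)%:E)); last 2 first.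
  - apply/measurable_EFinP; apply: measurable_powR_fun; exact: measurable_curry.
  - by move=> y; rewrite lee_fin powR_ge0.
  apply: le_trans (hbe x); rewrite le_eqVlt; apply/orP; left; apply/eqP.
  apply: eq_integral => t _; rewrite /fubini_F [RHS]integral_mkcond.
  apply: eq_integral => w _; rewrite patchE /b /= indicE.
  by case: ifPn => _; rewrite ?mulr1// mulr0 powR0// gt_eqF.
have := schur_hoelder (@sigma_finite_leb2 R) (m2 := X2) ma mb mf a0 b0 f0 p0 q0 pq C10 hb.
set L := (X in X <= _ -> _); set L' := (X in _ -> X <= _).
have -> : L = L'.
  apply: eq_integral => z _; congr (_ `^ q).
  have mabf : measurable_fun setT (fun y => (a (z, y) * b (z, y) * f y)%:E).
    apply/measurable_EFinP; apply: measurable_funM => //.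
    by apply: measurable_funM; exact: measurable_curry.
  rewrite [LHS](fubini_tonelli2 (m1 := nu) (m2 := @sigma_finite_leb2 R) (fun y => (a (z, y) * b (z, y) * f y)%:E)) //; last first.
    by move=> y; rewrite lee_fin; apply: mulr_ge0 => //; exact: mulr_ge0.
  pose K (w : R * R) := (U w)%:E * fubini_F nu F (z, w).
  have K0 w : 0 <= K w by rewrite mule_ge0 ?lee_fin//; exact: (k0 (z, w)).
  have mK : measurable_fun setT K.
    apply: emeasurable_funM; first exact/measurable_EFinP.
    exact: (measurable_curry (f := fubini_F nu F)).
  have -> : \int[mu2]_(w in Om) ((U w)%:E *
      \int[nu]_t (al ((z, w).1, (t, (z, w).2)) * be ((z, w).1, (t, (z, w).2)))%:E) =
      \int[mu2]_w (K \_ Om) w by rewrite integral_mkcond.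
  rewrite -ge0_integralZl ?lee_fin ?decay_ge0//; last 2 first.
  - by apply/(measurable_restrictT _ mOm); exact: measurable_funTS.
  - by move=> w _; rewrite patchE; case: ifPn.
  apply: eq_integral => w _; rewrite patchE /fubini_G /=.
  case: ifPn => wO; last first.
    rewrite mule0; apply: integral0_eq => t _.
    by rewrite /b /f /= indicE (negbTE wO) !mulr0.
  rewrite /K muleA -EFinM -ge0_integralZl //; last 2 first.
  - exact: (measurable_curry (f := F) (z, w) mF).
  - by rewrite lee_fin mulr_ge0 ?decay_ge0.
  apply: eq_integral => t _; rewrite -EFinM /a /b /f /= indicE wO /=; congr EFin; ring.
move=> /le_trans; apply; rewrite EFinM -muleA lee_wpmul2l ?lee_fin ?powR_ge0//.
pose G := fubini_G (@sigma_finite_leb2 R) (fun x => (a x `^ q)%:E).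
have maq : measurable_fun setT (fun x => (a x `^ q)%:E).
  by apply/measurable_EFinP; exact: measurable_powR_fun.
have mG : measurable_fun setT G.
  by apply: measurable_fun_fubini_tonelli_G => // x; rewrite lee_fin powR_ge0.
have G0 y : 0 <= G y by apply: integral_ge0 => z _; rewrite lee_fin powR_ge0.
have mfq : measurable_fun setT (fun y => (f y `^ q)%:E).
  by apply/measurable_EFinP; exact: measurable_powR_fun.
have mfG : measurable_fun setT (fun y => (f y `^ q)%:E * G y) by exact: emeasurable_funM.
rewrite -/G [leLHS](fubini_tonelli2 (m1 := nu) (m2 := @sigma_finite_leb2 R) (fun y => (f y `^ q)%:E * G y)) //; last first.
  by move=> y; rewrite mule_ge0// lee_fin powR_ge0.
rewrite -ge0_integralZl //; last 2 first.
- by apply/measurable_EFinP; exact: measurable_powR_fun.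
- by move=> w _; rewrite lee_fin powR_ge0.
apply: ge0_le_integral => //.
- by move=> w _; apply: integral_ge0 => t _; rewrite mule_ge0 ?lee_fin ?powR_ge0.
- apply: (@measurable_fun_fubini_tonelli_G _ _ _ _ _ nu (fun y => (f y `^ q)%:E * G y)) => //.
  by move=> y; rewrite mule_ge0// lee_fin powR_ge0.
- by apply: emeasurable_funM => //; apply/measurable_EFinP; exact: measurable_powR_fun.
move=> w _; rewrite /fubini_G /f /=.
have [wO|wO] := pselect (Om w); last first.
  rewrite integral0_eq; first by rewrite mule_ge0 ?lee_fin ?powR_ge0.
  by move=> t _; rewrite indicE memNset// mulr0 powR0 ?mul0e// gt_eqF.
rewrite ge0_integralZl //; last 2 first.
- exact: (measurableT_comp mG (measurable_pair2 w)).
- by rewrite lee_fin powR_ge0.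
rewrite indicE mem_set// mulr1 muleC lee_wpmul2r ?lee_fin ?powR_ge0//.
exact: hal.
Qed.

End SchurKernel.

(** With the split into powers 1 / q and 1 - 1 / q, rows and columns both see [kap] to the power 1,
    which is below the planar threshold 2. The Dirac mass makes the superposition trivial. *)
Lemma weighted_bound_kap : weighted_bound (fun x => (kap x.1 x.2)%:E).
Proof.
have p1 : (0 < 1 - q^-1)%R by rewrite subr_gt0 invf_lt1.
have pq : (q^-1 + ((1 - q^-1)^-1)^-1 = 1)%R by rewrite invrK; ring.
have mkap (s : R) : measurable_fun setT
    (fun x : (R * R) * (unit * (R * R)) => kap x.1 x.2.2 `^ s)%R.
  apply: measurable_powR_fun; apply: measurable_kap; first exact: measurable_fst.
  exact: (measurableT_comp measurable_snd measurable_snd).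
have [C1 C10 h1] := integral_kap_Om oOm bOm ler01 (ltr1n _ 2).
have [C2 C20 h2] := integral_decay_kap ler01 (ltr1n _ 2) epsq.
have := @weighted_bound_schur _ unit (dirac tt)
  (fun x => kap x.1 x.2.2 `^ q^-1)%R (fun x => kap x.1 x.2.2 `^ (1 - q^-1))%R
  (1 - q^-1)^-1%R C1 C2 (mkap _) (mkap _).
have -> : (fun x : (R * R) * (R * R) => \int[dirac tt]_t
    (kap (x.1, (t, x.2)).1 (x.1, (t, x.2)).2.2 `^ q^-1 *
     kap (x.1, (t, x.2)).1 (x.1, (t, x.2)).2.2 `^ (1 - q^-1))%:E) =
    (fun x => (kap x.1 x.2)%:E).
  apply/funext => x; rewrite integral_dirac// diracT mul1e -powRD; last first.
    by rewrite (gt_eqF (kap_gt0 _ _)) implybT.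
  by rewrite addrC subrK powRr1// ltW// kap_gt0.
apply => //.
- by move=> x; exact: powR_ge0.
- by move=> x; exact: powR_ge0.
- by rewrite invr_gt0.
- move=> z; rewrite integral_dirac// diracT mul1e; apply: le_trans (h1 z).
  rewrite le_eqVlt; apply/orP; left; apply/eqP; apply: eq_integral => w _ /=.
  by rewrite -powRrM mulfV ?gt_eqF// kapC.
- move=> w _; rewrite integral_dirac// diracT mul1e; apply: le_trans (h2 w).
  rewrite le_eqVlt; apply/orP; left; apply/eqP; apply: eq_integral => z _ /=.
  by rewrite powRM ?powR_ge0// -powRrM mulVf ?gt_eqF.
Qed.

(** The symmetric split would leave [kap] to the power 1 on the curve, beyond the reach of
    [integral_curve_kap]. Shifting the exponents by g moves singularity from the curve to the plane:
    rows see 1 - p g / q on the curve and 1 + p g / q on the plane, columns 1 - g and 1 + g, against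
    the thresholds 1 and 2. *)
Lemma weighted_bound_curve c : List.In c (boundary_curves Om) ->
  weighted_bound (fun x => \int[mu]_(t in `[(- M)%R, M]) (kap x.1 (c t) * kap x.2 (c t))%:E).
Proof.
move=> hc; have mc := measurable_curve oOm bOm hc.
(* The bound 1 / 2 gives 1 + g < 2; since p g / q = g / (q - 1), the bound (q - 1) / 2 gives p g / q
   <= 1 / 2. *)
pose p := (1 - q^-1)^-1%R; pose g := Num.min (1 / 2)%R ((q - 1) / 2)%R.
have qV : (0 < q^-1 < 1)%R by rewrite invr_gt0 q0 invf_lt1.
have p0 : (0 < p)%R by rewrite invr_gt0; lra.
have pq : (q^-1 + p^-1 = 1)%R by rewrite invrK; ring.
have qq : (q * q^-1 = 1)%R by rewrite mulfV// gt_eqF.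
have pV : (p * (1 - q^-1) = 1)%R by rewrite mulVf// gt_eqF//; lra.
have g0 : (0 < g)%R by rewrite lt_min !divr_gt0// subr_gt0.
have g1 : (g <= 1 / 2)%R by rewrite ge_min lexx.
have g2 : (g <= (q - 1) / 2)%R by rewrite ge_min lexx orbT.
have gpq : (p * (g * q^-1) <= 1 / 2)%R.
  have -> : (1 / 2 = p * ((1 - q^-1) / 2))%R by rewrite mulrA pV.
  rewrite ler_pM2l//.
  have -> : ((1 - q^-1) / 2 = (q - 1) / 2 * q^-1)%R by field; exact: lt0r_neq0.
  by rewrite ler_pM2r//; case/andP: qV.
have gpq0 : (0 < p * (g * q^-1))%R by rewrite !mulr_gt0// invr_gt0.
set T := `[(- M)%R, M].
have mT : measurable [set` T] by exact: measurable_itv.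
have mI : measurable_fun setT (\1_[set` T] : R -> R) by exact: measurable_indic.
have mt1 : measurable_fun setT (fun x : (R * R) * (R * (R * R)) => x.2.1).
  exact: (measurableT_comp measurable_fst measurable_snd).
have mkap (s r : R) : measurable_fun setT (fun x : (R * R) * (R * (R * R)) =>
    \1_[set` T] x.2.1 * (kap x.1 (c x.2.1) `^ s * kap x.2.2 (c x.2.1) `^ r))%R.
  have mct : measurable_fun setT (fun x : (R * R) * (R * (R * R)) => c x.2.1).
    exact: (measurableT_comp mc mt1).
  apply: measurable_funM; first exact: (measurableT_comp mI mt1).
  apply: measurable_funM; apply: measurable_powR_fun; apply: measurable_kap => //.
  exact: (measurableT_comp measurable_snd measurable_snd).
have k0 (s r : R) (x : (R * R) * (R * (R * R))) :
    (0 <= \1_[set` T] x.2.1 * (kap x.1 (c x.2.1) `^ s * kap x.2.2 (c x.2.1) `^ r))%R.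
  by rewrite !mulr_ge0 ?powR_ge0.
have [||A1 A10 a1] := @integral_curve_kap c (1 - p * (g * q^-1)) hc; [lra|lra|].
have [||A2 A20 a2] := @integral_kap_Om R Om M oOm bOm (1 + p * (g * q^-1)); [lra|lra|].
have [||A3 A30 a3] := @integral_curve_kap c (1 - g) hc; [lra|lra|].
have [|||A4 A40 a4] := @integral_decay_kap eps q (1 + g); [lra|lra|exact: epsq|].
have := @weighted_bound_schur _ (measurableTypeR R) mu
  (fun x => \1_[set` T] x.2.1 * (kap x.1 (c x.2.1) `^ ((1 + g) * q^-1) *
     kap x.2.2 (c x.2.1) `^ ((1 - g) * q^-1)))%R
  (fun x => \1_[set` T] x.2.1 * (kap x.1 (c x.2.1) `^ (1 - (1 + g) * q^-1) *
     kap x.2.2 (c x.2.1) `^ (1 - (1 - g) * q^-1)))%R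
  p (A1 * A2)%R (A4 * A3)%R (mkap _ _) (mkap _ _) (k0 _ _) (k0 _ _).
have -> : (fun x : (R * R) * (R * R) => \int[mu]_t
    (\1_[set` T] (x.1, (t, x.2)).2.1 *
       (kap (x.1, (t, x.2)).1 (c (x.1, (t, x.2)).2.1) `^ ((1 + g) * q^-1) *
        kap (x.1, (t, x.2)).2.2 (c (x.1, (t, x.2)).2.1) `^ ((1 - g) * q^-1)) *
     (\1_[set` T] (x.1, (t, x.2)).2.1 *
       (kap (x.1, (t, x.2)).1 (c (x.1, (t, x.2)).2.1) `^ (1 - (1 + g) * q^-1) *
        kap (x.1, (t, x.2)).2.2 (c (x.1, (t, x.2)).2.1) `^ (1 - (1 - g) * q^-1))))%:E) =
    (fun x => \int[mu]_(t in [set` T]) (kap x.1 (c t) * kap x.2 (c t))%:E).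
  apply/funext => x; rewrite [RHS]integral_mkcond; apply: eq_integral => t _ /=.
  rewrite patchE indicE; case: ifPn => _; last by rewrite !mul0r.
  have pw (y s : R) : (0 < y)%R -> (y = y `^ s * y `^ (1 - s))%R.
    by move=> y0; rewrite -powRD ?(gt_eqF y0) ?implybT// addrC subrK powRr1// ltW.
  rewrite [in RHS](pw _ ((1 + g) * q^-1)%R (kap_gt0 x.1 (c t))).
  rewrite [X in (_ = (_ * X)%:E)](pw _ ((1 - g) * q^-1)%R (kap_gt0 x.2 (c t))).
  by congr EFin; rewrite /= !mul1r; ring.
(* The planar integral is bounded uniformly in the point of the curve, so it factors out of the
   integral over t. *)
have split_le (h : R -> R) (I : R -> \bar R) (B B' : R) : (forall t, 0 <= h t)%R ->
    measurable_fun setT h -> (0 <= B)%R -> (forall t, I t <= B%:E) ->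
    \int[mu]_(t in [set` T]) (h t)%:E <= B'%:E -> (forall t, 0 <= I t) ->
    \int[mu]_(t in [set` T]) ((h t)%:E * I t) <= (B' * B)%:E.
  move=> h0 mh B0 IB hB' I0.
  apply: (@le_trans _ _ (\int[mu]_(t in [set` T]) ((h t)%:E * B%:E))).
    apply: ge0_integral_mono => t _; first by rewrite mule_ge0 ?lee_fin.
    by rewrite lee_wpmul2l ?lee_fin.
  rewrite ge0_integralZr ?lee_fin//; last 2 first.
  - by apply/measurable_EFinP; exact: measurable_funTS.
  - by move=> t _; rewrite lee_fin.
  by rewrite EFinM lee_wpmul2r ?lee_fin.
have indM (t x y r : R) : r != 0%R -> (0 <= x)%R -> (0 <= y)%R ->
    ((\1_[set` T] t * (x * y)) `^ r)%:E = if t \in [set` T] then (x `^ r * y `^ r)%:E else 0.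
  move=> r0 x0 y0; rewrite indicE; case: ifPn => _; first by rewrite mul1r powRM.
  by rewrite mul0r powR0.
apply => //; [exact: mulr_ge0|exact: mulr_ge0| |].
- move=> z; have := split_le (fun t => kap z (c t) `^ (1 - p * (g * q^-1)))%R
    (fun t => \int[mu2]_(w in Om) (kap w (c t) `^ (1 + p * (g * q^-1)))%:E) A2 A1.
  move=> h; apply: le_trans (h _ _ A20 (fun t => a2 (c t)) (a1 z) _).
  + rewrite [leRHS]integral_mkcond; apply: ge0_integral_mono => t _.
      by apply: integral_ge0 => w _; rewrite lee_fin powR_ge0.
    rewrite patchE /=; under eq_integral do rewrite indM ?powR_ge0 ?gt_eqF//.
    case: ifPn => tT; last by rewrite integral0.
    rewrite -ge0_integralZl ?lee_fin ?powR_ge0//.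
    * apply: ge0_integral_mono => w _; first by rewrite lee_fin mulr_ge0 ?powR_ge0.
      rewrite -EFinM lee_fin -!powRrM !(mulrC _ p).
      have -> : (p * (1 - (1 + g) * q^-1) = 1 - p * (g * q^-1))%R.
        by transitivity (p * (1 - q^-1) - p * (g * q^-1))%R; [ring|rewrite pV].
      have -> // : (p * (1 - (1 - g) * q^-1) = 1 + p * (g * q^-1))%R.
      by transitivity (p * (1 - q^-1) + p * (g * q^-1))%R; [ring|rewrite pV].
    * apply/measurable_EFinP; apply: measurable_funTS; apply: measurable_powR_fun.
      by apply: measurable_kap; [exact: measurable_id|exact: measurable_cst].
    * by move=> w _; rewrite lee_fin powR_ge0.
  + by move=> t; exact: powR_ge0.
  + apply: measurable_powR_fun; apply: measurable_kap => //; exact: measurable_cst.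
  + by move=> t; apply: integral_ge0 => w _; rewrite lee_fin powR_ge0.
- move=> w _; rewrite (mulrC A4); have := split_le (fun t => kap w (c t) `^ (1 - g))%R
    (fun t => \int[mu2]_z (decay eps z `^ q * kap z (c t) `^ (1 + g))%:E) A4 A3.
  move=> h; apply: le_trans (h _ _ A40 (fun t => a4 (c t)) (a3 w) _).
  + rewrite [leRHS]integral_mkcond; apply: ge0_integral_mono => t _.
      by apply: integral_ge0 => z _; rewrite lee_fin powR_ge0.
    rewrite patchE /=.
    have E z : ((decay eps z * (\1_[set` T] t * (kap z (c t) `^ ((1 + g) * q^-1) *
        kap w (c t) `^ ((1 - g) * q^-1)))) `^ q)%:E = if t \in [set` T] then
        (kap w (c t) `^ (1 - g) * (decay eps z `^ q * kap z (c t) `^ (1 + g)))%:E else 0.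
      rewrite powRM ?decay_ge0 ?mulr_ge0 ?powR_ge0// EFinM indM ?powR_ge0 ?gt_eqF//.
      case: ifPn => _; last by rewrite mule0.
      rewrite -EFinM -!powRrM -!mulrA [(q^-1 * q)%R]mulrC qq !mulr1.
      by congr EFin; ring.
    under eq_integral do rewrite E.
    case: ifPn => tT; last by rewrite integral0.
    rewrite -ge0_integralZl ?lee_fin ?powR_ge0//.
    * apply/measurable_EFinP; apply: measurable_funM.
        by apply: measurable_powR_fun; exact: measurable_decay.
      apply: measurable_powR_fun.
      by apply: measurable_kap; [exact: measurable_id|exact: measurable_cst].
    * by move=> z _; rewrite lee_fin mulr_ge0 ?powR_ge0.
  + by move=> t; exact: powR_ge0.
  + apply: measurable_powR_fun; apply: measurable_kap => //; exact: measurable_cst.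
  + by move=> t; apply: integral_ge0 => z _; rewrite lee_fin mulr_ge0 ?powR_ge0.
Qed.

Definition kernel (x : (R * R) * (R * R)) : \bar R :=
  (kap x.1 x.2)%:E + bd_integral Om M (fun u => (kap x.1 u * kap x.2 u)%R).

Lemma weighted_bound_kernel : weighted_bound kernel.
Proof.
have := weighted_boundD weighted_bound_kap
  (weighted_boundD (weighted_bound_curve (or_introl erefl))
  (weighted_boundD (weighted_bound_curve (or_intror (or_introl erefl)))
  (weighted_boundD (weighted_bound_curve (or_intror (or_intror (or_introl erefl))))
    (weighted_bound_curve (or_intror (or_intror (or_intror (or_introl erefl)))))))).
congr weighted_bound; apply/funext => x.
by rewrite /kernel /bd_integral /boundary_curves !big_cons big_nil adde0.
Qed.

End WeightedBounds.

(** * The kernel of AB *)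

Section ComplexFubini.
Variable R : realType.
Local Notation mu2 := (@leb2 R).
Local Notation Re := complex.Re.
Local Notation Im := complex.Im.
Implicit Types (D : set (R * R)) (f g : R * R -> R[i]) (Psi : (R * R) * (R * R) -> R[i]).

(** Carrying domains as indicators lets Fubini be stated on the whole plane only. *)
Lemma cintegral_indic D f :
  cintegral D f = cintegral setT (fun z => (\1_D z)%:C%C * f z).
Proof.
rewrite /cintegral; congr (_ +i* _)%C; rewrite [LHS]Rintegral_mkcond;
  congr Rintegral; apply/funext => z; rewrite patchE indicE;
  case: ifPn => _; rewrite ?ReM ?ImM /= ?mul1r ?mul0r ?subr0 ?addr0 //; case: (f z) => a b /=; ring.
Qed.

Lemma cintegral_ae_eq D f g : measurable D -> cmeas f -> cmeas g ->
  {ae mu2, forall z, f z = g z} -> cintegral D f = cintegral D g.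
Proof.
move=> mD [f1 f2] [g1 g2] [N [mN N0 sub]]; rewrite /cintegral /Rintegral.
have mD' : measurable (D : set (measurableTypeR R * measurableTypeR R)) by [].
have aeE (h : R[i] -> R) : measurable_fun setT (fun z => h (f z)) ->
    measurable_fun setT (fun z => h (g z)) ->
    (\int[mu2]_(z in D) (h (f z))%:E = \int[mu2]_(z in D) (h (g z))%:E)%E.
  move=> hf hg; apply: ae_eq_integral => //.
  - by apply/measurable_EFinP; exact: measurable_funTS.
  - by apply/measurable_EFinP; exact: measurable_funTS.
  by exists N; split => // z /= nz; apply: sub => /= fg; apply: nz => _; rewrite fg.
congr (fine _ +i* fine _)%C; [exact: (aeE (fun x => Re x))|exact: (aeE (fun x => Im x))].
Qed.

Lemma measurable_Rintegral_section (f : (R * R) * (R * R) -> R) : measurable_fun setT f ->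
  measurable_fun setT (fun z => Rintegral mu2 setT (fun w => f (z, w))).
Proof.
move=> mf; apply: (measurableT_comp (@fine_measurable R setT _)) => //.
have mE : measurable_fun setT (EFin \o f) by exact/measurable_EFinP.
rewrite (_ : (fun _ => _) = (fun z => \int[mu2]_w (EFin \o f)^\+ (z, w) -
    \int[mu2]_w (EFin \o f)^\- (z, w))%E); last first.
  apply/funext => z; rewrite [LHS]integralE; congr (_ - _)%E; apply: eq_integral => w _.
    by rewrite !funeposE.
  by rewrite !funenegE.
by apply: emeasurable_funB; apply: measurable_integral_section => //;
  [exact: measurable_funepos|exact: measurable_funeneg].
Qed.

Lemma cmeas_section Psi : cmeas Psi ->
  cmeas (fun z => cintegral setT (fun w => Psi (z, w))).
Proof. by move=> [P1 P2]; split;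
  [exact: (measurable_Rintegral_section P1)|exact: (measurable_Rintegral_section P2)]. Qed.

Let sf := @sigma_finite_leb2 R.

Lemma plane_integrable (f : (R * R) * (R * R) -> R) : measurable_fun setT f ->
  (\int[mu2]_z \int[mu2]_w `|f (z, w)|%:E < +oo)%E ->
  (sf \x sf)%E.-integrable setT (EFin \o f).
Proof.
move=> mf foo; have mE : measurable_fun setT (EFin \o f) by exact/measurable_EFinP.
by apply/(integrable12ltyP sf sf mE).
Qed.

(** [Rintegral] replaces an infinite inner integral by 0. Almost every section is integrable, so
    this alters the inner function on a null set only. *)
Lemma Rintegral_fubini (f : (R * R) * (R * R) -> R) : measurable_fun setT f ->
  (\int[mu2]_z \int[mu2]_w `|f (z, w)|%:E < +oo)%E ->
  Rintegral mu2 setT (fun z => Rintegral mu2 setT (fun w => f (z, w))) =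
  Rintegral mu2 setT (fun w => Rintegral mu2 setT (fun z => f (z, w))).
Proof.
move=> mf foo; have fi := plane_integrable mf foo.
have mfT : measurable_fun setT (fun x : (R * R) * (R * R) => f (x.2, x.1)).
  by apply: (measurableT_comp mf); apply/measurable_fun_pairP; split;
    [exact: measurable_snd|exact: measurable_fst].
have a1 := ae_integrable1 fi.
have a2 := ae_integrable2 fi.
have E1 : (\int[mu2]_z (Rintegral mu2 setT (fun w => f (z, w)))%:E =
    \int[mu2]_z \int[mu2]_w (f (z, w))%:E)%E.
  apply: ae_eq_integral => //.
  - by apply/measurable_EFinP; exact: measurable_Rintegral_section.
  - exact: (measurable_fubini_F fi).
  case: a1 => N [mN N0 sub]; exists N; split => // z /= nz; apply: sub => /= h; apply: nz => _.
  by rewrite /Rintegral fineK// (integrable_fin_num _ h).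
have E2 : (\int[mu2]_w (Rintegral mu2 setT (fun z => f (z, w)))%:E =
    \int[mu2]_w \int[mu2]_z (f (z, w))%:E)%E.
  apply: ae_eq_integral => //.
  - by apply/measurable_EFinP; exact: (measurable_Rintegral_section mfT).
  - exact: (measurable_fubini_G fi).
  case: a2 => N [mN N0 sub]; exists N; split => // z /= nz; apply: sub => /= h; apply: nz => _.
  by rewrite /Rintegral fineK// (integrable_fin_num _ h).
rewrite {1}/Rintegral E1 [RHS]/Rintegral E2; congr fine.
exact: (Fubini fi).
Qed.

Lemma integral_abs_Re_Im_lty Psi : cmeas Psi ->
  (\int[mu2]_z \int[mu2]_w (cabs (Psi (z, w)))%:E < +oo)%E ->
  (\int[mu2]_z \int[mu2]_w `|Re (Psi (z, w))|%:E < +oo)%E /\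
  (\int[mu2]_z \int[mu2]_w `|Im (Psi (z, w))|%:E < +oo)%E.
Proof.
move=> mP Poo; split; apply: le_lt_trans Poo.
- apply: ge0_integral_mono => z _; first by apply: integral_ge0 => w _; rewrite lee_fin.
  by apply: ge0_integral_mono => w _; rewrite lee_fin ?Re_le_cabs.
- apply: ge0_integral_mono => z _; first by apply: integral_ge0 => w _; rewrite lee_fin.
  by apply: ge0_integral_mono => w _; rewrite lee_fin ?Im_le_cabs.
Qed.

Lemma cintegral_fubini Psi : cmeas Psi ->
  (\int[mu2]_z \int[mu2]_w (cabs (Psi (z, w)))%:E < +oo)%E ->
  cintegral setT (fun z => cintegral setT (fun w => Psi (z, w))) =
  cintegral setT (fun w => cintegral setT (fun z => Psi (z, w))).
Proof.
move=> mP Poo; have [h1 h2] := integral_abs_Re_Im_lty mP Poo.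
case: mP => P1 P2.
by rewrite /cintegral /= (Rintegral_fubini P1 h1) (Rintegral_fubini P2 h2).
Qed.

Lemma ae_cint_section Psi : cmeas Psi ->
  (\int[mu2]_z \int[mu2]_w (cabs (Psi (z, w)))%:E < +oo)%E ->
  {ae mu2, forall z, cint setT (fun w => Psi (z, w))}.
Proof.
move=> mP Poo; have [h1 h2] := integral_abs_Re_Im_lty mP Poo.
have [P1 P2] := mP.
have a1 := ae_integrable1 (plane_integrable P1 h1).
have a2 := ae_integrable1 (plane_integrable P2 h2).
apply: filterS2 a1 a2 => z; exact: conj.
Qed.

End ComplexFubini.

(** * Pointwise bound for AB *)

Section OperatorBound.
Variable R : realType.
Local Notation mu2 := (@leb2 R).
Local Notation Re := complex.Re.
Local Notation Im := complex.Im.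
Variables (Om : set (R * R)) (M : R).
Hypothesis oOm : open Om.
Hypothesis convOm : forall (z w : R * R) (t : R), Om z -> Om w -> 0 < t < 1 ->
  Om ((1 - t) *: z + t *: w).
Hypothesis bOm : forall z, Om z -> `|z.1| <= M /\ `|z.2| <= M.

Let mOm : measurable Om. Proof. exact: measurable_Om. Qed.

Lemma integral_indicM (D : set (R * R)) (f : R * R -> R) :
  (\int[mu2]_z (\1_D z * f z)%:E = \int[mu2]_(z in D) (f z)%:E)%E.
Proof.
rewrite [RHS]integral_mkcond; apply: eq_integral => z _; rewrite patchE indicE.
by case: ifPn => _; rewrite ?mul1r ?mul0r.
Qed.

Lemma cintegral0 (D : set (R * R)) : cintegral D (fun=> 0) = 0 :> R[i].
Proof. by rewrite /cintegral /Rintegral integral0. Qed.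

Lemma measurable_kernel : measurable_fun setT (kernel Om M).
Proof.
(* Measurability is one component of [weighted_bound]; the exponents eps = q = 2 are just an
   admissible choice. *)
have [||//] := @weighted_bound_kernel R Om M oOm bOm 2 2; first by rewrite ltr1n.
by rewrite mulrDl mul1r ltrDl.
Qed.

Lemma kernel_ge_kap z w : ((kap z w)%:E <= kernel Om M (z, w))%E.
Proof.
rewrite /kernel /= leeDl// bd_integral_ge0// => u.
by rewrite mulr_ge0 // ltW// kap_gt0.
Qed.

Lemma kernel_ge0 x : (0 <= kernel Om M x)%E.
Proof. by case: x => z w; rewrite (le_trans _ (kernel_ge_kap z w))// lee_fin ltW// kap_gt0. Qed.

(** By |z - w| <= |z - u| + |u - w|, a product of two poles is at most the sum of the poles divided
    by |z - w|. This bound has no gain in k; it serves to justify Fubini. *)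
Lemma integral_two_poles : exists2 C : R, 0 <= C & forall z w, z != w ->
  (\int[mu2]_(u in Om) ((dist z u)^-1 * (dist u w)^-1)%:E <= (C * (dist z w)^-1)%:E)%E.
Proof.
have [C C0 hC] := integral_kap_Om oOm bOm ler01 (ltr1n _ 2).
exists (2 * C); first by rewrite mulr_ge0.
move=> z w zw; have d0 : 0 < dist z w by exact: dist_gt0.
have mk c : measurable_fun Om (fun u => (kap u c `^ 1)%:E).
  apply/measurable_EFinP; apply: measurable_funTS; apply: measurable_powR_fun.
  by apply: measurable_kap; [exact: measurable_id|exact: measurable_cst].
apply: (@le_trans _ _ (\int[mu2]_(u in Om)
    ((dist z w)^-1%:E * ((kap u z `^ 1)%:E + (kap u w `^ 1)%:E)))%E).
  apply: ge0_integral_mono => u _; first by rewrite lee_fin mulr_ge0 ?invr_ge0 ?dist_ge0.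
  rewrite -EFinD -EFinM lee_fin !powRr1 ?(ltW (kap_gt0 _ _))//.
  have tri := dist_triangle z u w; rewrite /kap (distC u z).
  have [->|a0] := eqVneq (dist z u) 0.
    by rewrite invr0 mul0r mulr_ge0 ?invr_ge0 ?addr_ge0 ?dist_ge0 ?invr_ge0 ?dist_ge0.
  have [->|b0] := eqVneq (dist u w) 0.
    by rewrite invr0 mulr0 mulr_ge0 ?invr_ge0 ?addr_ge0 ?dist_ge0 ?invr_ge0 ?dist_ge0.
  have ap : 0 < dist z u by rewrite lt_def a0 dist_ge0.
  have bp : 0 < dist u w by rewrite lt_def b0 dist_ge0.
  rewrite [leRHS]mulrC ler_pdivlMr//.
  have iab : 0 < (dist z u)^-1 * (dist u w)^-1 by rewrite mulr_gt0 ?invr_gt0.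
  apply: (le_trans (ler_wpM2l (ltW iab) tri)).
  rewrite [leLHS](_ : _ = (dist u w)^-1 + (dist z u)^-1); last by field; rewrite a0 b0.
  by lra.
rewrite ge0_integralZl//; last 3 first.
- exact: (emeasurable_funD (mk z) (mk w)).
- by move=> u _; rewrite adde_ge0 ?lee_fin ?powR_ge0.
- by rewrite lee_fin invr_ge0 ltW.
rewrite ge0_integralD//; last 4 first.
- by move=> u _; rewrite lee_fin powR_ge0.
- exact: mk.
- by move=> u _; rewrite lee_fin powR_ge0.
- exact: mk.
rewrite mulrC EFinM lee_wpmul2l ?lee_fin ?invr_ge0 ?(ltW d0)//.
by rewrite mulrDl !mul1r EFinD leeD.
Qed.

Lemma cabs_full_kernel (k : R[i]) z w u :
  cabs (full_kernel k z w u) = (dist z u)^-1 * (dist u w)^-1.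
Proof.
by rewrite /full_kernel !cabsM cabs_cexp_opp mul1r !cabsV cabs_toCB -conjc_toCB cabs_conj cabs_toCB.
Qed.

Lemma cmeas_full_kernel (k : R[i]) z d (T : measurableType d) (f g : T -> R * R) :
  measurable_fun setT f -> measurable_fun setT g ->
  cmeas (fun x => full_kernel k z (f x) (g x)).
Proof.
move=> mf mg; apply: cmeasM; first apply: cmeasM.
- exact: cmeas_osc.
- by apply: cmeasV; apply: cmeasD; [exact: cmeas_cst|apply: cmeasN; exact: cmeas_toC].
- apply: cmeasV; apply: cmeasD; first by apply: cmeas_conj; exact: cmeas_toC.
  by apply: cmeasN; apply: cmeas_conj; exact: cmeas_toC.
Qed.

Lemma cint_full_kernel (k : R[i]) z w : z != w -> cint Om (full_kernel k z w).
Proof.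
move=> zw; have [C C0 hC] := integral_two_poles; apply: cint_le => //.
  by apply: (cmeas_full_kernel k z (f := fun=> w) (g := id)).
under eq_integral do rewrite cabs_full_kernel.
by apply: le_lt_trans (hC _ _ zw) _; rewrite ltry.
Qed.

(** Both w in [Om] and the boundary points have coordinates bounded by [|M|], so [inv_dist_le_jbr]
    extracts 1 / jbr z from the term 1 / |z - w| and from the pole at z in each boundary
    integral. *)
Lemma full_kernel_le_kernel : exists2 C : R, 0 <= C & forall (k : R[i]) z w,
  0 < cabs k -> z != w -> Om w ->
  ((cabs (cintegral Om (full_kernel k z w)))%:E <=
   (C / cabs k)%:E * ((jbr z)^-1%:E * kernel Om M (z, w)))%E.
Proof.
have [C C0 hC] := full_kernel_le oOm convOm bOm.
pose B := 1 + 2 * `|M|; have B0 : 0 <= B by rewrite addr_ge0// mulr_ge0.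
exists (C * B); first exact: mulr_ge0.
move=> k z w k0 zw Ow; apply: le_trans (hC k z w k0 zw) _.
have j0 : 0 <= (jbr z)^-1 by rewrite invr_ge0 ltW// jbr_gt0.
rewrite [C * B / _]mulrAC [(_ * B)%:E]EFinM -muleA lee_wpmul2l ?lee_fin ?divr_ge0 ?(ltW k0)//.
rewrite muleA -EFinM /kernel /= ge0_muleDr ?lee_fin ?(ltW (kap_gt0 _ _))//; last first.
  by apply: bd_integral_ge0 => u; rewrite mulr_ge0 // ltW// kap_gt0.
have bnd v : `|v.1| <= `|M| -> `|v.2| <= `|M| -> (dist z v)^-1 <= B * (jbr z)^-1 * kap z v.
  by move=> v1 v2; apply: inv_dist_le_jbr.
apply: leeD.
  have [w1 w2] := bOm Ow; rewrite -EFinM lee_fin.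
  by apply: bnd; [apply: le_trans w1 _|apply: le_trans w2 _]; exact: ler_norm.
rewrite /bd_integral ge0_sume_distrr; last first.
  by move=> c _; apply: integral_ge0 => t _; rewrite lee_fin mulr_ge0 // ltW// kap_gt0.
have hcurve c : List.In c (boundary_curves Om) ->
    (\int[lebesgue_measure]_(t in `[(- M)%R, M]) ((dist z (c t))^-1 * (dist w (c t))^-1)%:E <=
     (B * (jbr z)^-1)%:E *
       \int[lebesgue_measure]_(t in `[(- M)%R, M]) (kap z (c t) * kap w (c t))%:E)%E.
  move=> hc; have mc := measurable_curve oOm bOm hc.
  rewrite -ge0_integralZl//; last 3 first.
  - apply/measurable_EFinP; apply: measurable_funTS.
    by apply: measurable_funM; apply: measurable_kap => //; exact: measurable_cst.
  - by move=> t _; rewrite lee_fin mulr_ge0// ltW// kap_gt0.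
  - by rewrite lee_fin mulr_ge0.
  apply: ge0_integral_mono => t /=; rewrite in_itv /= => tM.
    by rewrite lee_fin mulr_ge0 ?invr_ge0 ?dist_ge0.
  have [c1 c2] := curve_bounded bOm hc tM.
  rewrite -EFinM lee_fin mulrA ler_pM ?invr_ge0 ?dist_ge0 ?bnd//.
  by rewrite /kap lerDr.
rewrite /boundary_curves !big_cons !big_nil !adde0.
apply: leeD; first by apply: hcurve; left.
apply: leeD; first by apply: hcurve; right; left.
apply: leeD; first by apply: hcurve; right; right; left.
by apply: hcurve; right; right; right; left.
Qed.

(* Fubini turns [AB u z] into the integral over [w] of [u w] against the
   oscillatory integral of [full_kernel k z w]. *)
Lemma opAB_le : exists2 C : R, 0 < C & forall (k : R[i]) (sigma : R) u z,
  0 < cabs k -> `|sigma| = 1 -> cmeas u ->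
  ((cabs (opAB k Om sigma u z))%:E <= (C / cabs k)%:E * ((jbr z)^-1%:E *
     \int[mu2]_(w in Om) ((cabs (u w))%:E * kernel Om M (z, w))))%E.
Proof.
have [C C0 hC] := full_kernel_le_kernel.
have [Cp Cp0 hCp] := integral_two_poles.
have [C1 C10 hC1] := integral_kap_Om oOm bOm ler01 (ltr1n _ 2).
(* The 2 is that of [cintegral_le]; the added 1 makes the constant positive, so that the bound is
   +oo when the majorant diverges. *)
exists (2 * C + 1); first by rewrite ltr_wpDl// mulr_ge0.
move=> k sigma u z k0 sig mu.
have j0 : 0 < (jbr z)^-1 by rewrite invr_gt0 jbr_gt0.
pose H w := ((\1_Om w * cabs (u w))%:E * kernel Om M (z, w))%E.
have H0 w : (0 <= H w)%E by rewrite mule_ge0 ?kernel_ge0// lee_fin mulr_ge0 ?cabs_ge0.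
have mI : measurable_fun setT (\1_Om : R * R -> R) by exact: measurable_indic.
have mcu : measurable_fun setT (fun w => \1_Om w * cabs (u w)).
  by apply: measurable_funM => //; exact: measurable_cabs.
have mH : measurable_fun setT H.
  apply: emeasurable_funM; first exact/measurable_EFinP.
  exact: (measurable_curry z measurable_kernel).
have -> : (\int[mu2]_(w in Om) ((cabs (u w))%:E * kernel Om M (z, w)) = \int[mu2]_w H w)%E.
  rewrite [LHS]integral_mkcond; apply: eq_integral => w _; rewrite /H patchE indicE.
  by case: ifPn => _; rewrite ?mul1r// mul0r mul0e.
(* If the majorant is infinite at z the claim is trivial. Otherwise its finiteness gives the
   absolute integrability below. *)
have [Joo|] := ltP (\int[mu2]_w H w)%E +oo%E; last first.
  rewrite leye_eq => /eqP ->; rewrite gt0_muley ?lte_fin// gt0_muley ?leey// lte_fin.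
  by rewrite divr_gt0// ltr_wpDl// mulr_ge0.
have Hk w : ((\1_Om w * cabs (u w) * kap z w)%:E <= H w)%E.
  by rewrite EFinM lee_wpmul2l ?kernel_ge_kap// lee_fin mulr_ge0 ?cabs_ge0.
pose c1 : R[i] := ((2 * pi)^-1)%:C%C; pose c2 : R[i] := (sigma / (2 * pi))%:C%C.
have p2 : (2 * pi : R)^-1 <= 1.
  rewrite invf_le1 ?mulr_gt0 ?pi_gt0//; have := pi_ge2 R; lra.
have p20 : 0 <= (2 * pi : R)^-1 by rewrite invr_ge0 mulr_ge0 ?pi_ge0.
have c1l : cabs c1 <= 1 by rewrite cabs_real ger0_norm.
have c2l : cabs c2 <= 1 by rewrite cabs_real normrM sig mul1r ger0_norm.
pose g (x : (R * R) * (R * R)) : R[i] := (\1_Om x.2)%:C%C *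
  (osc (- k) x.2 * (conjc (toC x.1) - conjc (toC x.2))^-1 * u x.2).
pose G (x : (R * R) * (R * R)) : R[i] := (\1_Om x.1)%:C%C * g x.
pose Psi (x : (R * R) * (R * R)) : R[i] := (\1_Om x.1)%:C%C *
  (osc k x.1 * (toC z - toC x.1)^-1) * c2 * g x.
have cg : cmeas g.
  apply: cmeasM; first by apply: cmeas_real; exact: (measurableT_comp mI measurable_snd).
  apply: cmeasM; last first.
    by case: mu => u1 u2; split; [exact: (measurableT_comp u1 measurable_snd)|
      exact: (measurableT_comp u2 measurable_snd)].
  apply: cmeasM; first by apply: cmeas_osc; exact: measurable_snd.
  apply: cmeasV; apply: cmeasD.
    by apply: cmeas_conj; apply: cmeas_toC; exact: measurable_fst.
  by apply: cmeasN; apply: cmeas_conj; apply: cmeas_toC; exact: measurable_snd.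
have cI1 : cmeas (fun x : (R * R) * (R * R) => (\1_Om x.1 : R)%:C%C).
  by apply: cmeas_real; exact: (measurableT_comp mI measurable_fst).
have cG : cmeas G by exact: cmeasM.
have cP : cmeas Psi.
  apply: cmeasM => //; apply: cmeasM; last exact: cmeas_cst.
  apply: cmeasM => //; apply: cmeasM; first by apply: cmeas_osc; exact: measurable_fst.
  apply: cmeasV; apply: cmeasD; first exact: cmeas_cst.
  by apply: cmeasN; apply: cmeas_toC; exact: measurable_fst.
have ag x : cabs (g x) = \1_Om x.2 * cabs (u x.2) * (dist x.1 x.2)^-1.
  rewrite /g !cabsM cabs_cexp_opp mul1r cabs_real ger0_norm//.
  by rewrite cabsV -conjc_toCB cabs_conj cabs_toCB mulrAC mulrA.
have uk w v : \1_Om w * cabs (u w) * (dist v w)^-1 <= \1_Om w * cabs (u w) * kap v w.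
  by rewrite ler_wpM2l ?mulr_ge0 ?cabs_ge0// /kap lerDr.
(* For almost every v the inner integral over w then converges absolutely, so the factors depending
   on v pass under it in [E1]. Integrating in v first, over [Om], leaves a multiple of the finite
   majorant. *)
have Gfin : (\int[mu2]_v \int[mu2]_w (cabs (G (v, w)))%:E < +oo)%E.
  have -> := @tonelli_plane R (fun x => (cabs (G x))%:E).
  - apply: (@le_lt_trans _ _ (\int[mu2]_w (C1%:E * H w))%E); last first.
      by rewrite ge0_integralZl// lte_mul_pinfty.
    apply: ge0_integral_mono => w _.
      by apply: integral_ge0 => v _; rewrite lee_fin cabs_ge0.
    have -> : (\int[mu2]_v (cabs (G (v, w)))%:E =
        \int[mu2]_v (\1_Om v * (\1_Om w * cabs (u w) * (dist v w)^-1))%:E)%E.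
      by apply: eq_integral => v _; rewrite /G cabsM ag cabs_real ger0_norm.
    rewrite integral_indicM.
    apply: (@le_trans _ _ (\int[mu2]_(v in Om) ((\1_Om w * cabs (u w))%:E * (kap v w `^ 1)%:E))%E).
      apply: ge0_integral_mono => v _; first by rewrite lee_fin !mulr_ge0 ?cabs_ge0 ?invr_ge0 ?dist_ge0.
      by rewrite -EFinM lee_fin powRr1 ?uk// ltW// kap_gt0.
    rewrite ge0_integralZl//; last 3 first.
    + apply/measurable_EFinP; apply: measurable_funTS; apply: measurable_powR_fun.
      by apply: measurable_kap; [exact: measurable_id|exact: measurable_cst].
    + by move=> v _; rewrite lee_fin powR_ge0.
    + by rewrite lee_fin mulr_ge0 ?cabs_ge0.
    apply: (@le_trans _ _ ((\1_Om w * cabs (u w))%:E * C1%:E)%E).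
      by rewrite lee_wpmul2l// lee_fin mulr_ge0 ?cabs_ge0.
    rewrite muleC lee_wpmul2l ?lee_fin//; apply: le_trans (Hk w).
    by rewrite lee_fin ler_peMr ?kap_ge1// mulr_ge0 ?cabs_ge0.
  - by apply/measurable_EFinP; exact: measurable_cabs.
  - by move=> x; rewrite lee_fin cabs_ge0.
have osN w : cexp (k * toC w - conjc (k * toC w)) = osc (- k) w.
  by rewrite /osc mulNr opprK rmorphN.
have inner v : cintegral Om (fun w => cexp (k * toC w - conjc (k * toC w)) *
    (conjc (toC v) - conjc (toC w))^-1 * u w) = cintegral setT (fun w => g (v, w)).
  by rewrite cintegral_indic; congr cintegral; apply/funext => w; rewrite osN.
have E1 : opAB k Om sigma u z = c1 * cintegral setT (fun v => cintegral setT (fun w => Psi (v, w))).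
  rewrite /opAB /opA /opB; congr (_ * _); rewrite cintegral_indic.
  under eq_fun do rewrite inner.
  apply: cintegral_ae_eq => //.
  - apply: cmeasM; first exact: cmeas_real.
    apply: cmeasM; last by apply: cmeasM; [exact: cmeas_cst|exact: (cmeas_section cg)].
    apply: cmeasM; first by apply: (cmeas_osc k); exact: measurable_id.
    apply: cmeasV; apply: cmeasD; first exact: cmeas_cst.
    by apply: cmeasN; apply: cmeas_toC; exact: measurable_id.
  - exact: (cmeas_section cP).
  have [N [mN N0 sub]] := ae_cint_section cG Gfin.
  exists N; split => // v /= nv; apply: sub => /= hG; apply: nv; move: hG.
  rewrite /Psi /G /= indicE; case: (v \in Om) => /= hG; last first.
    rewrite mul0r; under eq_fun do rewrite !mul0r.
    by rewrite cintegral0.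
  have hg : cint setT (fun w => g (v, w)).
    by move: hG; congr cint; apply/funext => w; rewrite mul1r.
  by rewrite cintegralZ// !mul1r mulrA.
have PE v w : Psi (v, w) = (\1_Om v)%:C%C * (c2 * (\1_Om w)%:C%C * osc (- k) w * u w * full_kernel k z w v).
  by rewrite /Psi /g /full_kernel /=; ring.
have csP : cmeas (fun x : (R * R) * (R * R) => Psi (x.2, x.1)).
  have msw : measurable_fun setT (fun x : (R * R) * (R * R) => (x.2, x.1)).
    by apply/measurable_fun_pairP; split; [exact: measurable_snd|exact: measurable_fst].
  by case: cP => P1 P2; split; [exact: (measurableT_comp P1 msw)|exact: (measurableT_comp P2 msw)].
pose be w := c2 * (\1_Om w)%:C%C * osc (- k) w * u w.
have abe w : cabs (be w) <= \1_Om w * cabs (u w).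
  rewrite /be !cabsM cabs_cexp_opp mulr1 -mulrA.
  have -> : cabs ((\1_Om w : R)%:C%C) = \1_Om w by rewrite cabs_real ger0_norm.
  by rewrite ler_piMl ?mulr_ge0 ?cabs_ge0.
have msP : measurable_fun setT (fun x : (R * R) * (R * R) => (cabs (Psi (x.2, x.1)))%:E).
  by apply/measurable_EFinP; apply: measurable_cabs; exact: csP.
(* The integral over v of the two poles is at most [Cp] / |z - w| <= [Cp * kap z w], which the
   majorant [H] dominates. *)
have Pfin : (\int[mu2]_v \int[mu2]_w (cabs (Psi (v, w)))%:E < +oo)%E.
  have mP : measurable_fun setT (fun x => (cabs (Psi x))%:E).
    by apply/measurable_EFinP; exact: measurable_cabs.
  have P0 x : (0 <= (cabs (Psi x))%:E)%E by rewrite lee_fin cabs_ge0.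
  rewrite [ltLHS](tonelli_plane mP P0).
  apply: (@le_lt_trans _ _ (\int[mu2]_w (Cp%:E * H w))%E); last first.
    by rewrite ge0_integralZl// lte_mul_pinfty.
  apply: ae_ge0_le_integral => //.
  - by move=> w _; apply: integral_ge0.
  - exact: (measurable_integral_section msP).
  - by move=> w _; rewrite mule_ge0.
  - by apply: emeasurable_funM => //; exact: measurable_cst.
  apply: (ae_off_axes (c := z)) => w w1 _ _.
  have wz : z != w by apply: contraNneq w1 => ->.
  have -> : (\int[mu2]_v (cabs (Psi (v, w)))%:E = \int[mu2]_v (\1_Om v *
      (cabs (be w) * ((dist z v)^-1 * (dist v w)^-1)))%:E)%E.
    by apply: eq_integral => v _; rewrite PE -/(be w) cabsM (cabsM (be w)) cabs_full_kernel cabs_real ger0_norm.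
  rewrite integral_indicM; under eq_integral do rewrite EFinM.
  rewrite ge0_integralZl//; last 3 first.
  - apply/measurable_EFinP; apply: measurable_funTS; apply: measurable_funM.
      by apply: measurable_inv_ge0; [move=> v; exact: dist_ge0|
        apply: measurable_dist; [exact: measurable_cst|exact: measurable_id]].
    by apply: measurable_inv_ge0; [move=> v; exact: dist_ge0|
        apply: measurable_dist; [exact: measurable_id|exact: measurable_cst]].
  - by move=> v _; rewrite lee_fin mulr_ge0 ?invr_ge0 ?dist_ge0.
  - by rewrite lee_fin cabs_ge0.
  apply: (@le_trans _ _ ((cabs (be w))%:E * (Cp * (dist z w)^-1)%:E)%E).
    by rewrite lee_wpmul2l ?lee_fin ?cabs_ge0// hCp.
  apply: (@le_trans _ _ (Cp%:E * (\1_Om w * cabs (u w) * kap z w)%:E)%E); last first.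
    by rewrite lee_wpmul2l ?lee_fin.
  rewrite -!EFinM lee_fin mulrCA ler_wpM2l//; apply: le_trans (uk w z).
  by rewrite ler_wpM2r ?invr_ge0 ?dist_ge0.
have Ck0 : 0 <= C / cabs k * (jbr z)^-1.
  by rewrite mulr_ge0 ?(ltW j0)// mulr_ge0// invr_ge0 ltW.
have PI w : w != z -> ((cabs (cintegral setT (fun v => Psi (v, w))))%:E <=
    (C / cabs k * (jbr z)^-1)%:E * H w)%E.
  move=> wz; rewrite (_ : cintegral _ _ = be w * cintegral Om (full_kernel k z w)); last first.
    rewrite -cintegralZ//; last by apply: cint_full_kernel; rewrite eq_sym.
    by rewrite [RHS]cintegral_indic; congr cintegral; apply/funext => v; rewrite PE.
  rewrite cabsM EFinM.
  have [Ow|Ow] := pselect (Om w); last first.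
    have -> : cabs (be w) = 0.
      apply: le_anti; rewrite cabs_ge0 andbT (le_trans (abe w))//.
      by rewrite indicE memNset// mul0r.
    by rewrite mul0e mule_ge0.
  apply: (@le_trans _ _ ((\1_Om w * cabs (u w))%:E *
      ((C / cabs k)%:E * ((jbr z)^-1%:E * kernel Om M (z, w))))%E).
    by apply: lee_pmul; rewrite ?lee_fin ?cabs_ge0// hC// eq_sym.
  by rewrite le_eqVlt /H; apply/orP; left; apply/eqP; rewrite EFinM !muleA; congr (_ * _)%E;
    rewrite -!EFinM; congr EFin; ring.
rewrite E1 (cintegral_fubini cP Pfin) cabsM.
have cS := cmeas_section csP.
apply: (@le_trans _ _ (cabs (cintegral setT (fun w => cintegral setT (fun v => Psi (v, w)))))%:E).
  by rewrite lee_fin ler_piMl ?cabs_ge0.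
apply: (le_trans (cintegral_le measurableT cS)).
apply: (@le_trans _ _ (2%:E * \int[mu2]_w ((C / cabs k * (jbr z)^-1)%:E * H w))%E).
  rewrite lee_wpmul2l ?lee_fin//; apply: ae_ge0_le_integral => //.
  - by move=> w _; rewrite lee_fin cabs_ge0.
  - by apply/measurable_EFinP; exact: measurable_cabs.
  - by move=> w _; rewrite mule_ge0// lee_fin.
  - by apply: emeasurable_funM => //; exact: measurable_cst.
  apply: (ae_off_axes (c := z)) => w w1 _ _; apply: PI.
  by apply: contraNneq w1 => ->.
rewrite ge0_integralZl ?lee_fin// !muleA -!EFinM lee_wpmul2r ?integral_ge0// lee_fin.
rewrite mulrA ler_wpM2r ?(ltW j0)// mulrA ler_wpM2r ?invr_ge0 ?(ltW k0)//.
by rewrite lerDl.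
Qed.

End OperatorBound.

(** * From the pointwise bound to L^q norms *)

Section LqBound.
Variable R : realType.
Local Notation mu2 := (@leb2 R).
Variables (Om : set (R * R)).
Hypothesis oOm : open Om.
Hypothesis bOm : bounded_set Om.
Hypothesis convOm : strictly_convex Om.

Lemma bounded_coordinates : exists M : R, forall z, Om z -> `|z.1| <= M /\ `|z.2| <= M.
Proof.
(* [bounded_set] bounds the norm by every number strictly above [M], hence [M + 1]; the norm on the
   plane is the maximum of the coordinates. *)
have [M [Mr hM]] := bOm; exists (M + 1) => z Oz.
have nz : `|z| <= M + 1 by apply: hM Oz; rewrite ltrDl.
by move: nz; rewrite prod_normE ge_max => /andP[].
Qed.

Lemma convex_segments (z w : R * R) (t : R) : Om z -> Om w -> 0 < t < 1 ->
  Om ((1 - t) *: z + t *: w).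
Proof.
move=> Oz Ow t01; have [->|zw] := eqVneq z w.
  by rewrite -scalerDl subrK scale1r.
by apply: convOm => //; exact: subset_closure.
Qed.

Lemma cLnorm_powR (q : R) (f : R * R -> R[i]) : 0 < q ->
  (cLnorm q f `^ q = \int[mu2]_z (cabs (f z) `^ q)%:E)%E.
Proof.
move=> q0; rewrite /cLnorm poweR_Lnorm ?gt_eqF//.
by apply: eq_integral => z _ /=; rewrite ger0_norm ?cabs_ge0.
Qed.

(** The weight jbr^(-eps) times the factor 1 / jbr of [opAB_le] is [decay eps], so
    [weighted_bound_kernel] bounds the q-th power of the norm by [A]; taking q-th roots produces
    A^(1/q). *)
Lemma opAB_Lq_le (q eps sigma : R) : 1 < q -> 2 < (1 + eps) * q -> `|sigma| = 1 ->
  exists C : R, forall (k : R[i]), 1 <= cabs k -> forall u : R * R -> R[i], in_Lq q u ->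
  (cLnorm q (fun z => ((jbr z `^ (- eps))%:C%C * opAB k Om sigma u z)%R)
     <= (C / cabs k)%:E * cLnorm q u)%E.
Proof.
move=> q1 eq2 sig; have q0 : 0 < q by rewrite (lt_trans _ q1).
have [M hM] := bounded_coordinates.
have [C C0 hC] := opAB_le oOm convex_segments hM.
have [mK K0 [A A0 hA]] := weighted_bound_kernel oOm hM q1 eq2.
exists (C * A `^ q^-1) => k k1 u [u1 [u2 _]].
have cu : cmeas u by split.
have k0 : 0 < cabs k by rewrite (lt_le_trans _ k1).
have Ck : 0 <= C / cabs k by rewrite divr_ge0 // ltW.
have mU := measurable_cabs cu.
have N0 (f : R * R -> R[i]) : (0 <= cLnorm q f)%E by exact: Lnorm_ge0.
have Cq0 : 0 <= C * A `^ q^-1 / cabs k by rewrite mulrAC mulr_ge0 ?powR_ge0.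
suff : (cLnorm q (fun z => ((jbr z `^ (- eps))%:C%C * opAB k Om sigma u z)%R) `^ q <=
    ((C * A `^ q^-1 / cabs k)%:E * cLnorm q u) `^ q)%E.
  move=> h; have := @gt0_ler_poweR R q^-1 _ _ _ _ _ h.
  rewrite -!poweRrM !mulfV ?gt_eqF// !poweRe1 ?mule_ge0//; apply.
  - by rewrite invr_ge0 ltW.
  - by rewrite in_itv /= leey poweR_ge0.
  - by rewrite in_itv /= leey poweR_ge0.
rewrite poweRM ?lee_fin// !cLnorm_powR// poweR_EFin mulrAC powRM ?powR_ge0//.
rewrite -[(A `^ _) `^ q]powRrM mulVf ?gt_eqF// powRr1// EFinM -muleA.
apply: le_trans (_ : _ <= ((C / cabs k) `^ q)%:E * \int[mu2]_z (((decay eps z)%:E *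
    \int[mu2]_(w in Om) ((cabs (u w))%:E * kernel Om M (z, w))) `^ q))%E _; last first.
  by rewrite lee_wpmul2l ?lee_fin ?powR_ge0// hA// => w; exact: cabs_ge0.
have mX : measurable_fun setT (fun z => (((decay eps z)%:E *
    \int[mu2]_(w in Om) ((cabs (u w))%:E * kernel Om M (z, w))) `^ q)%E).
  apply: measurable_poweR_fun; apply: emeasurable_funM.
    by apply/measurable_EFinP; exact: measurable_decay.
  by apply: (measurable_apply oOm mK K0 mU) => w; exact: cabs_ge0.
rewrite -ge0_integralZl ?lee_fin ?powR_ge0//; last by move=> z _; exact: poweR_ge0.
apply: ge0_integral_mono => z _; first by rewrite lee_fin powR_ge0.
have I0 : (0 <= \int[mu2]_(w in Om) ((cabs (u w))%:E * kernel Om M (z, w)))%E.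
  by apply: integral_ge0 => w _; rewrite mule_ge0 ?lee_fin ?cabs_ge0.
have D0 : (0 <= (decay eps z)%:E)%E by rewrite lee_fin decay_ge0.
have dE : decay eps z = jbr z `^ (- eps) * (jbr z)^-1.
  rewrite /decay opprD addrC powRD ?(gt_eqF (jbr_gt0 z)) ?implybT//.
  by rewrite powR_inv1// ltW// jbr_gt0.
move: (decay eps z) D0 dE => d D0 dE.
rewrite -!poweR_EFin -poweRM ?lee_fin// ?mule_ge0//.
apply: gt0_ler_poweR; rewrite ?(ltW q0)//.
- by rewrite in_itv /= leey lee_fin cabs_ge0.
- by rewrite in_itv /= leey !mule_ge0 ?lee_fin.
rewrite dE cabsM cabs_real ger0_norm ?powR_ge0//.
rewrite EFinM [(jbr z `^ _ * _)%:E]EFinM -muleA [leRHS]muleCA.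
by rewrite lee_wpmul2l ?lee_fin ?powR_ge0// hC.
Qed.

End LqBound.

Unset Implicit Arguments.

Theorem theorem2p2 (R : realType) (Om : set (R * R)) (sigma : R) :
  open Om -> bounded_set Om -> strictly_convex Om -> smooth_boundary Om ->
  (sigma = 1 \/ sigma = -1) ->
  (* case 2 < q < oo : AB bounded L^q -> L^q with norm <= C/|k| *)
  (forall q : R, 2 < q ->
     exists C : R, forall (k : R[i]), 1 <= cabs k ->
       forall u : R * R -> R[i], in_Lq q u ->
         (cLnorm q (opAB k Om sigma u) <= (C / cabs k)%:E * cLnorm q u)%E) /\
  (* case 1 < q <= 2, eps > 2/q - 1 : AB bounded L^q -> <.>^eps L^q *)
  (forall q eps : R, 1 < q <= 2 -> 2 / q - 1 < eps ->
     exists C : R, forall (k : R[i]), 1 <= cabs k ->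
       forall u : R * R -> R[i], in_Lq q u ->
         (cLnorm q (fun z => ((jbr z `^ (- eps))%:C%C * opAB k Om sigma u z)%R)
            <= (C / cabs k)%:E * cLnorm q u)%E).
Proof.
move=> oOm bOm convOm _ sig.
have sig1 : `|sigma| = 1 by case: sig => ->; rewrite ?normrN normr1.
split => [q q2|q eps /andP[q1 q2] he].
  have q1 : 1 < q by rewrite (lt_trans _ q2) ?ltr1n.
  (* For q > 2 the factor 1 / jbr z already lies in L^q, so no weight is added. *)
  have [|C hC] := opAB_Lq_le oOm bOm convOm q1 _ sig1 (eps := 0).
    by rewrite addr0 mul1r.
  exists C => k k1 u hu; have := hC k k1 u hu.
  by under [X in cLnorm _ X]eq_fun do rewrite oppr0 powRr0 mul1r.
apply: opAB_Lq_le => //.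
have q0 : 0 < q by rewrite (lt_trans _ q1).
by rewrite -ltr_pdivrMr// -ltrBlDl.
Qed.
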